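(* Let $\Gamma\subset\mathbb{R}^n$ be a graph and let $\Sigma$ be a surface in the class $\mathcal{S}_\Gamma$ which is strongly stationary with respect to $\Gamma$. Then for every $p\in\Sigma\setminus\Gamma$, $$2\pi\,\Theta_\Sigma(p)\le\mathcal{C}_{\rm tot}(\Gamma).$$
   Context: Graph: $\Gamma$ is a finite graph, the union of finitely many immersed arcs meeting at vertices; each arc is $C^2$ in its interior and $C^1$ up to its end points, and each vertex has valence at least two (valence = number of times the vertex occurs as an endpoint of the arcs). Class $\mathcal{S}_\Gamma$: $\Sigma\in\mathcal{S}_\Gamma$ means that $\Sigma$ is a finite union (including the boundaries) of $C^2$-smooth open embedded 2-dimensional manifolds $\Sigma_i$ with compact closure, $C^1$ up to the boundary $\partial\Sigma_i$, with $\partial\Sigma_i$ piecewise $C^1$, and $\Gamma$ is a subset of $S:=\bigcup_i\partial\Sigma_i$. Strongly stationary: $\Sigma$ is strongly stationary with respect to $\Gamma$ if for every smooth $\phi:\mathbb{R}\times\mathbb{R}^n\to\mathbb{R}^n$ with $\phi(0,x)\equiv x$, $\frac{d}{dt}\big(\mathrm{Area}(\phi(t,\Sigma))+\mathrm{Area}(\phi([0,t]\times\Gamma))\big)\big|_{t=0}\ge0$ (derivative from the right). Equivalently, there is an $\mathcal{H}^1$-measurable vector field $\nu$ along $\Gamma$, normal to $\Gamma$, with $\sup|\nu|\le1$, such that $\int_\Sigma\mathrm{div}_\Sigma X\,dA=\int_\Gamma\langle X,\nu\rangle\,ds$ for all smooth vector fields $X$ on $\mathbb{R}^n$, where $\mathrm{div}_\Sigma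 X$ is the trace on the tangent planes of $\Sigma$ of the ambient covariant derivative of $X$. Density: $\Theta_\Sigma(p)=\lim_{\varepsilon\to0}\frac{\mathrm{Area}(\Sigma\cap B_\varepsilon(p))}{\pi\varepsilon^2}$. Total curvature: for a vertex $q$ of valence $d$ with unit tangent vectors $T_1,\dots,T_d$ to the arcs at $q$ (pointing into the arcs), $\mathrm{tc}(q)=\sup_{e}\sum_{\ell=1}^d\left(\frac{\pi}{2}-\beta_\ell(e)\right)$, the supremum over unit vectors $e$, where $\beta_\ell(e)\in[0,\pi]$ is the angle between $T_\ell$ and $e$. Then $\mathcal{C}_{\rm tot}(\Gamma)=\int_{\Gamma^{\rm reg}}|\vec{k}|\,ds+\sum\{\mathrm{tc}(q):q\text{ a vertex of }\Gamma\}$, where $\vec{k}$ is the curvature vector of the arcs and $\Gamma^{\rm reg}=\Gamma\setminus\{\text{vertices}\}$. *)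

(* Defs.v *)
From HB Require Import structures.
From mathcomp Require Import all_boot all_order all_algebra.
From mathcomp Require Import all_classical all_reals all_analysis.

Set Implicit Arguments.
Unset Strict Implicit.
Unset Printing Implicit Defensive.

Import Order.TTheory GRing.Theory Num.Theory.
Import numFieldNormedType.Exports.

Local Open Scope classical_set_scope.
Local Open Scope ring_scope.

(** The library norm on ['rV[R]_n] is the max norm.  It is used only through
    the topology and the differential calculus, which do not depend on the
    choice of a norm; all metric quantities use the Euclidean norm [enorm]. *)

Definition dotp (R : realType) (n : nat) (u v : 'rV[R]_n) : R :=
  \sum_(i < n) u 0 i * v 0 i.

Definition enorm (R : realType) (n : nat) (u : 'rV[R]_n) : R :=
  Num.sqrt (dotp u u).

Definition eball (R : realType) (n : nat) (p : 'rV[R]_n) (e : R) :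
    set 'rV[R]_n :=
  [set x | enorm (x - p) < e].

Definition unit_vec (R : realType) (n : nat) (u : 'rV[R]_n) : 'rV[R]_n :=
  (enorm u)^-1 *: u.

(** In finite dimension, [Ck_on k U f] is the usual notion of a [C^k] map on
    the open set [U]: every iterated directional derivative of order at most
    [k] exists and is continuous on [U]. *)
Fixpoint Ck_on (R : realType) (V W : normedModType R) (k : nat) (U : set V)
    (f : V -> W) : Prop :=
  match k with
  | 0%N => forall x, U x -> {for x, continuous f}
  | k'.+1 => (forall x, U x -> differentiable f x) /\
             (forall v : V, Ck_on k' U ('D_v f))
  end.

Definition smooth (R : realType) (V W : normedModType R) (f : V -> W) : Prop :=
  forall k, Ck_on k setT f.

(** Area is two-dimensional Hausdorff measure, normalized by the area [pi / 4]
    of the disk of diameter 1, so that it is Lebesgue measure on planes. *)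

(* 0 is adjoined so that the empty set has diameter 0 instead of -oo. *)
Definition ediam (R : realType) (n : nat) (A : set 'rV[R]_n) : \bar R :=
  ereal_sup (0%E |` [set (enorm (z.1 - z.2))%:E | z in A `*` A]).

Definition area_delta (R : realType) (n : nat) (delta : R)
    (A : set 'rV[R]_n) : \bar R :=
  ereal_inf [set (\sum_(0 <= k <oo) ((pi / 4)%:E * ediam (U k) ^+ 2))%E
    | U in [set U : nat -> set 'rV[R]_n |
        A `<=` \bigcup_k U k /\ forall k, (ediam (U k) <= delta%:E)%E]].

Definition area (R : realType) (n : nat) (A : set 'rV[R]_n) : \bar R :=
  ereal_sup [set area_delta delta A | delta in [set delta : R | 0 < delta]].

(** A [C^1] arc is parametrized by the restriction to [[0, 1]] of a [C^1] map
    on the line, which is what being [C^1] up to the end points means; the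
    values outside [[0, 1]] play no role.  The non-vanishing velocity makes the
    arc immersed, with a tangent direction at both ends. *)
Definition C1_arc (R : realType) (n : nat) (c : R -> 'rV[R]_n) : Prop :=
  @Ck_on R R^o 'rV[R]_n 1 setT c /\
  forall t : R, `[0, 1]%classic t -> derive1 c t != 0.

(** A pair [(i, b)] is an end of the arc [i]: its initial end at parameter 0
    for [b = false], its final end at parameter 1 for [b = true].  The vertices
    are the positions of these ends.  Arcs may have crossings. *)
Definition arc_end (R : realType) (n m : nat) (c : 'I_m -> R -> 'rV[R]_n)
    (ib : 'I_m * bool) : 'rV[R]_n :=
  c ib.1 (ib.2 : nat)%:R.

Definition arcs_valence (R : realType) (n m : nat) (c : 'I_m -> R -> 'rV[R]_n)
    (q : 'rV[R]_n) : nat :=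
  #|[set ib : 'I_m * bool | arc_end c ib == q]%SET|.

Record graph (R : realType) (n : nat) := Graph {
  narcs : nat;
  edge : 'I_narcs -> R -> 'rV[R]_n;
  edge_C1 : forall i, C1_arc (edge i);
  edge_C2 : forall i, @Ck_on R R^o 'rV[R]_n 2 `]0, 1[%classic (edge i);
  vertex_valence : forall ib, (2 <= arcs_valence edge (arc_end edge ib))%N }.

Definition graph_set (R : realType) (n : nat) (G : graph R n) :
    set 'rV[R]_n :=
  \bigcup_(i in [set: 'I_(narcs G)]) (edge i @` `[0, 1]).

Definition vertices (R : realType) (n : nat) (G : graph R n) :
    seq 'rV[R]_n :=
  undup [seq arc_end (@edge R n G) ib | ib : 'I_(narcs G) * bool].

(* The sign makes the tangent vector point into the arc at both ends. *)
Definition end_tangent (R : realType) (n : nat) (G : graph R n)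
    (ib : 'I_(narcs G) * bool) : 'rV[R]_n :=
  (-1) ^+ ib.2 *: unit_vec (derive1 (edge ib.1) (ib.2 : nat)%:R).

Definition vertex_curvature (R : realType) (n : nat) (G : graph R n)
    (q : 'rV[R]_n) : R :=
  sup [set \sum_(ib : 'I_(narcs G) * bool | arc_end (@edge R n G) ib == q)
             (pi / 2 - acos (dotp (end_tangent ib) e))
      | e in [set e : 'rV[R]_n | enorm e = 1]].

(** The derivative of the unit tangent with respect to arclength. *)
Definition curvature (R : realType) (n : nat) (c : R -> 'rV[R]_n) (t : R) :
    'rV[R]_n :=
  (enorm (derive1 c t))^-1 *: derive1 (fun s => unit_vec (derive1 c s)) t.

(* The line element along an arc [c] is [enorm (derive1 c t)] times [dt]. *)
Definition total_curvature (R : realType) (n : nat) (G : graph R n) : \bar R :=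
  (\sum_(i < narcs G)
     \int[lebesgue_measure]_(t in `]0%R, 1%R[)
       (enorm (curvature (edge i) t) * enorm (derive1 (edge i) t))%:E
   + (\sum_(q <- vertices G) vertex_curvature G q)%R%:E)%E.

(** [M] is locally the image of a [C^k] immersion of a plane open set which is
    a homeomorphism onto its image. *)
Definition embedded_surface (R : realType) (n k : nat) (M : set 'rV[R]_n) :
    Prop :=
  forall p, M p ->
    exists (W : set 'rV[R]_n) (V : set 'rV[R]_2) (f : 'rV[R]_2 -> 'rV[R]_n)
           (g : 'rV[R]_n -> 'rV[R]_2),
      [/\ open W /\ W p, open V, f @` V = M `&` W,
          Ck_on k V f /\ (forall x, V x -> injective ('d f x)) &
          (forall x, V x -> g (f x) = x) /\ {within M `&` W, continuous g}].

(** The boundary of an embedded open surface with compact closure. *)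
Definition surf_boundary (R : realType) (n : nat) (M : set 'rV[R]_n) :
    set 'rV[R]_n :=
  closure M `\` M.

(** The closure is, near each boundary point, part of a [C^1] surface extending
    across the boundary. *)
Definition C1_up_to_boundary (R : realType) (n : nat) (M : set 'rV[R]_n) :
    Prop :=
  forall p, surf_boundary M p ->
    exists W N : set 'rV[R]_n,
      [/\ open W, W p, embedded_surface 1 N & closure M `&` W `<=` N].

Definition piecewise_C1 (R : realType) (n : nat) (B : set 'rV[R]_n) : Prop :=
  exists (m : nat) (c : 'I_m -> R -> 'rV[R]_n),
    (forall i, C1_arc (c i)) /\
    B = \bigcup_(i in [set: 'I_m]) (c i @` `[0, 1]).

Definition surface_class (R : realType) (n : nat) (G : graph R n)
    (Sigma : set 'rV[R]_n) : Prop :=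
  exists (m : nat) (M : 'I_m -> set 'rV[R]_n),
    [/\ forall i, embedded_surface 2 (M i) /\ compact (closure (M i)),
        forall i, C1_up_to_boundary (M i),
        forall i, piecewise_C1 (surf_boundary (M i)),
        Sigma = \bigcup_(i in [set: 'I_m]) closure (M i) &
        graph_set G `<=` \bigcup_(i in [set: 'I_m]) surf_boundary (M i)].

Definition swept_area (R : realType) (n : nat) (G : graph R n)
    (Sigma : set 'rV[R]_n) (phi : R -> 'rV[R]_n -> 'rV[R]_n) (t : R) : \bar R :=
  (area (phi t @` Sigma) +
   area ((fun z => phi z.1 z.2) @` (`[0%R, t] `*` graph_set G)))%E.

(** The right derivative at 0 is taken in the extended reals, so that its
    existence as a real number forces the areas involved to be finite. *)
Definition strongly_stationary (R : realType) (n : nat) (G : graph R n)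
    (Sigma : set 'rV[R]_n) : Prop :=
  forall phi : R -> 'rV[R]_n -> 'rV[R]_n,
    smooth (fun z : R^o * 'rV[R]_n => phi z.1 z.2) ->
    (forall x, phi 0 x = x) ->
    exists l : R,
      ((swept_area G Sigma phi t - swept_area G Sigma phi 0) * t^-1%:E)%E
        @[t --> 0^'+] --> l%:E /\
      0 <= l.

Definition density_ratio (R : realType) (n : nat) (Sigma : set 'rV[R]_n)
    (p : 'rV[R]_n) (e : R) : \bar R :=
  (area (Sigma `&` eball p e) * ((pi * e ^+ 2)^-1)%:E)%E.

Definition density (R : realType) (n : nat) (Sigma : set 'rV[R]_n)
    (p : 'rV[R]_n) : \bar R :=
  lim (density_ratio Sigma p e @[e --> 0^'+]).

(* Main.v *)
From HB Require Import structures.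
Require Import Defs.
From mathcomp Require Import all_boot all_order all_algebra.
From mathcomp Require Import all_classical all_reals all_analysis.
From mathcomp Require measurable_realfun.
From mathcomp Require Import zify ring lra.

Set Implicit Arguments.
Unset Strict Implicit.
Unset Printing Implicit Defensive.

Import Order.TTheory GRing.Theory Num.Theory.
Import numFieldNormedType.Exports.

Local Open Scope classical_set_scope.
Local Open Scope ring_scope.

(** Write [s] for the squared distance to [p].  The radial deformation
    [x |-> x - t * g s *: (x - p)] with [g s = 1 / max ep s] contracts the
    surface inside the ball [s < ep], where it loses area at the rate
    [2 * area / ep], while outside of the ball area does not increase to first
    order because [g s + s * g' s = 0] there.  Strong stationarity says that this
    loss cannot exceed the rate at which the graph sweeps out area.  That rate
    is the length of the radial projection of the graph to the unit sphere
    about [p], the integral of [sin psi / r] where [psi] is the angle between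
    the tangent and the ray from [p] and [r] the distance to [p].  Along an arc
    [psi' <= k - sin psi / r] with [k] the curvature, so an arc projects to
    length at most its curvature plus the value of [psi] at its beginning minus
    the value at its end.  Summed over the arcs, the end values are the terms of
    the total curvature of the vertices for the unit vector pointing from a
    vertex to [p], so they are bounded by the suprema.  With [ep = r ^ 2], the
    loss [2 * area / ep] is [2 * pi] times the density ratio in the ball of
    radius [r].  The limit of the density ratios exists because they are
    monotone: the profile [max (1 / max ep s - 1 / b) 0] moves only points with
    [s < b], so the graph sweeps nothing when it stays outside of that ball.
    The first variation is [radial_first_variation], its two consequences are
    [ball_area_monotone] and [ball_area_le_sweep], the estimate along an arc is
    [area_arc_sweep_le] and the vertices are treated in [angle_sum_le].

    Area is a Hausdorff outer measure, and everything is done by comparing areas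
    of sets, without an area formula.  A map with Gram determinant at most
    [J ^ 2] on the tangent planes multiplies areas on a smooth surface by at
    most [J] ([area_radial_flow]).  This is local by measurability of Borel sets
    ([area_expands_le_global]).  In a chart which is nearly an isometry
    ([embedded_area_expands_le]) it is a comparison, dyadic square by dyadic
    square, of two images of a plane domain ([area_compare]): the area [c] of
    the unit square enters both sides and cancels.  Only for the sweep of the
    graph does its value matter, through [c <= 1] ([unit_square_area_le1]).
    The rate of the sweep is bounded by an increment of a primitive
    ([area_strip_le]), which spares the integral of [sin psi / r].

    Three regularizations are made: [max] is replaced by a smooth function, so
    that the deformations are smooth; the argument of [acos] is divided by
    [lam > 1], since [psi] need not be differentiable where it is [0] or [pi];
    and short pieces at the ends of an arc, where the curvature may be unbounded,
    are estimated by their length. *)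

(** * The Euclidean norm *)

Section Euclid.
Variables (R : realType) (n : nat).
Implicit Types (u v w : 'rV[R]_n) (a : R).

Lemma dotpC u v : dotp u v = dotp v u.
Proof. by apply: eq_bigr => i _; rewrite mulrC. Qed.

Lemma dotpDl u v w : dotp (u + v) w = dotp u w + dotp v w.
Proof. by rewrite -big_split; apply: eq_bigr => i _; rewrite mxE mulrDl. Qed.

Lemma dotpDr u v w : dotp w (u + v) = dotp w u + dotp w v.
Proof. by rewrite dotpC dotpDl !(dotpC w). Qed.

Lemma dotpZl a u v : dotp (a *: u) v = a * dotp u v.
Proof. by rewrite mulr_sumr; apply: eq_bigr => i _; rewrite mxE mulrA. Qed.

Lemma dotpZr a u v : dotp u (a *: v) = a * dotp u v.
Proof. by rewrite dotpC dotpZl dotpC. Qed.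

Lemma dotpNl u v : dotp (- u) v = - dotp u v.
Proof. by rewrite -scaleN1r dotpZl mulN1r. Qed.

Lemma dotpNr u v : dotp u (- v) = - dotp u v.
Proof. by rewrite dotpC dotpNl dotpC. Qed.

Lemma dotpBl u v w : dotp (u - v) w = dotp u w - dotp v w.
Proof. by rewrite dotpDl dotpNl. Qed.

Lemma dotpBr u v w : dotp w (u - v) = dotp w u - dotp w v.
Proof. by rewrite dotpDr dotpNr. Qed.

Lemma dot0p v : dotp 0 v = 0.
Proof. by rewrite -(scale0r v) dotpZl mul0r. Qed.

Lemma dotp0 v : dotp v 0 = 0.
Proof. by rewrite dotpC dot0p. Qed.

Lemma dotp_ge0 u : 0 <= dotp u u.
Proof. by apply: sumr_ge0 => i _; rewrite -expr2 sqr_ge0. Qed.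

Lemma dotp_eq0 u : (dotp u u == 0) = (u == 0).
Proof.
apply/eqP/eqP => [|->]; last by rewrite dot0p.
move/eqP; rewrite psumr_eq0; last by move=> i _; rewrite -expr2 sqr_ge0.
move=> /allP h; apply/rowP => i; rewrite mxE; apply/eqP.
by have := h i (mem_index_enum _); rewrite /= -expr2 sqrf_eq0.
Qed.

Lemma sqr_enorm u : enorm u ^+ 2 = dotp u u.
Proof. by rewrite sqr_sqrtr ?dotp_ge0. Qed.

Lemma enorm_ge0 u : 0 <= enorm u.
Proof. exact: sqrtr_ge0. Qed.

Lemma enorm_eq0 u : (enorm u == 0) = (u == 0).
Proof. by rewrite -sqrf_eq0 sqr_enorm dotp_eq0. Qed.

Lemma enorm_gt0 u : (0 < enorm u) = (u != 0).
Proof. by rewrite lt0r enorm_eq0 enorm_ge0 andbT. Qed.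

Lemma enorm0 : enorm (0 : 'rV[R]_n) = 0.
Proof. by apply/eqP; rewrite enorm_eq0. Qed.

Lemma enormZ a u : enorm (a *: u) = `|a| * enorm u.
Proof.
by rewrite /enorm dotpZl dotpZr mulrA -expr2 sqrtrM ?sqr_ge0// sqrtr_sqr.
Qed.

Lemma enormN u : enorm (- u) = enorm u.
Proof. by rewrite -scaleN1r enormZ normrN1 mul1r. Qed.

Lemma enormBC u v : enorm (u - v) = enorm (v - u).
Proof. by rewrite -enormN opprB. Qed.

Lemma dotp_sqr_le u v : dotp u v ^+ 2 <= dotp u u * dotp v v.
Proof.
have [->|v0] := eqVneq v 0; first by rewrite !dotp0 expr0n mulr0.
have vv : 0 < dotp v v by rewrite lt0r dotp_eq0 v0 dotp_ge0.
have := dotp_ge0 (dotp v v *: u - dotp u v *: v).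
rewrite !(dotpBl, dotpBr, dotpZl, dotpZr) (dotpC v u) => h.
have {}h : 0 <= dotp v v * (dotp u u * dotp v v - dotp u v ^+ 2).
  by apply: le_trans h _; rewrite le_eqVlt; apply/orP; left; apply/eqP; ring.
by rewrite pmulr_rge0 // subr_ge0 in h.
Qed.

Lemma dotp_le_enorm u v : `|dotp u v| <= enorm u * enorm v.
Proof.
rewrite -(@ler_pXn2r _ 2) ?nnegrE ?mulr_ge0 ?enorm_ge0//.
by rewrite exprMn !sqr_enorm real_normK ?num_real ?dotp_sqr_le.
Qed.

Lemma enormD u v : enorm (u + v) <= enorm u + enorm v.
Proof.
rewrite -(@ler_pXn2r _ 2) ?nnegrE ?addr_ge0 ?enorm_ge0//.
rewrite sqrrD !sqr_enorm dotpDl !dotpDr (dotpC v u).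
have := dotp_le_enorm u v; have := ler_norm (dotp u v); lra.
Qed.

Lemma enormB u v : enorm (u - v) <= enorm u + enorm v.
Proof. by rewrite -(enormN v); exact: enormD. Qed.

Lemma enorm_sum (I : Type) (s : seq I) (F : I -> 'rV[R]_n) :
  enorm (\sum_(i <- s) F i) <= \sum_(i <- s) enorm (F i).
Proof.
elim/big_ind2 : _ => [|x1 x2 y1 y2 h1 h2|//]; first by rewrite enorm0.
by apply: le_trans (enormD _ _) _; exact: lerD.
Qed.

Lemma enorm_coord u (i : 'I_n) : `|u 0 i| <= enorm u.
Proof.
rewrite -(@ler_pXn2r _ 2) ?nnegrE ?enorm_ge0// sqr_enorm real_normK ?num_real//.
rewrite /dotp (bigD1 i)//= expr2 lerDl; apply: sumr_ge0 => j _.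
by rewrite -expr2 sqr_ge0.
Qed.

Lemma norm_le_enorm u : `|u| <= enorm u.
Proof.
rewrite /Num.norm/= mx_normrE; apply/bigmax_leP; split; first exact: enorm_ge0.
by move=> [i j] _ /=; rewrite ord1 enorm_coord.
Qed.

Lemma coord_le_norm u (i : 'I_n) : `|u 0 i| <= `|u|.
Proof.
rewrite [leRHS]/Num.norm/= mx_normrE.
exact: (le_bigmax_cond _ (fun k : 'I_1 * 'I_n => `|u k.1 k.2|) (j := (0, i))).
Qed.

Lemma enorm_le_norm u : enorm u <= n%:R * `|u|.
Proof.
rewrite -(@ler_pXn2r _ 2) ?nnegrE ?enorm_ge0 ?mulr_ge0//.
rewrite sqr_enorm exprMn.
apply: (@le_trans _ _ (\sum_(i < n) `|u| ^+ 2)).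
  apply: ler_sum => i _; rewrite -expr2 -[leLHS]real_normK ?num_real//.
  by rewrite ler_pXn2r ?nnegrE// coord_le_norm.
rewrite sumr_const card_ord -[leLHS]mulr_natl; apply: ler_wpM2r; first exact: sqr_ge0.
by rewrite -natrX ler_nat; case: (n) => // k; rewrite -mulnn leq_pmulr.
Qed.

Lemma enorm_sub_lip u v : `|enorm u - enorm v| <= enorm (u - v).
Proof.
rewrite ler_norml; apply/andP; split.
  by have := enormD u (v - u); rewrite addrC subrK (enormBC u); lra.
by have := enormD v (u - v); rewrite addrC subrK; lra.
Qed.

End Euclid.

(** * Area as an outer measure *)

Section Diameter.
Variables (R : realType) (n : nat).
Implicit Types (A B : set 'rV[R]_n).
Local Open Scope ereal_scope.

Lemma ediam_ge0 A : 0 <= ediam A.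
Proof. by apply: ereal_sup_ubound; left. Qed.

Lemma ediam_le A (d : \bar R) : 0 <= d ->
  (forall x y, A x -> A y -> (enorm (x - y))%:E <= d) -> ediam A <= d.
Proof.
by move=> d0 h; apply: ge_ereal_sup => _ [->//|[[x y] [/= Ax Ay]] <-]; exact: h.
Qed.

Lemma enorm_le_ediam A x y : A x -> A y -> (enorm (x - y))%:E <= ediam A.
Proof. by move=> Ax Ay; apply: ereal_sup_ubound; right; exists (x, y). Qed.

Lemma ediam0 : ediam (set0 : set 'rV[R]_n) = 0.
Proof. by apply/eqP; rewrite eq_le ediam_ge0 andbT; apply: ediam_le. Qed.

Definition disk_area A : \bar R := (pi / 4)%:E * ediam A ^+ 2.

Lemma pi4_ge0 : (0 <= pi / 4 :> R)%R.
Proof. by rewrite divr_ge0 ?pi_ge0. Qed.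

Lemma disk_area_ge0 A : 0 <= disk_area A.
Proof. by rewrite mule_ge0 ?lee_fin ?pi4_ge0// expe_ge0// ediam_ge0. Qed.

Lemma disk_area0 : disk_area set0 = 0.
Proof. by rewrite /disk_area ediam0 expe2 mul0e mule0. Qed.

Lemma disk_area_le A (d : R) : (0 <= d)%R -> ediam A <= d%:E ->
  disk_area A <= (pi / 4 * d ^+ 2)%:E.
Proof.
move=> d0 Ad; rewrite EFinM; apply: lee_wpmul2l; first by rewrite lee_fin pi4_ge0.
by rewrite expr2 EFinM expe2 lee_pmul ?ediam_ge0.
Qed.

End Diameter.

Section AreaDelta.
Variables (R : realType) (n : nat) (d : {posnum R}).
Implicit Types (A B : set 'rV[R]_n).
Local Open Scope ereal_scope.
Let D A := area_delta d%:num A.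

Lemma area_delta_cover A (U : nat -> set 'rV[R]_n) :
  A `<=` \bigcup_k U k -> (forall k, ediam (U k) <= d%:num%:E) ->
  D A <= \sum_(0 <= k <oo) disk_area (U k).
Proof. by move=> AU Ud; apply: ereal_inf_lbound; exists U. Qed.

Lemma area_delta_ge0 A : 0 <= D A.
Proof.
apply: le_ereal_inf_tmp => _ [U _ <-]; apply: nneseries_ge0 => k _ _.
exact: disk_area_ge0.
Qed.

Lemma area_delta_single A : ediam A <= d%:num%:E -> D A <= disk_area A.
Proof.
move=> Ad; apply: le_trans (@area_delta_cover A (fun k => if k is 0%N then A else set0) _ _) _.
- by move=> x Ax; exists 0%N.
- by case=> // k; rewrite ediam0 lee_fin.
- rewrite nneseries_recl//; last by move=> *; exact: disk_area_ge0.
  rewrite eseries_cond eseries0 ?adde0// => -[//|k] _ _; exact: disk_area0.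
Qed.

Lemma area_delta0 : D set0 = 0.
Proof.
apply/eqP; rewrite eq_le area_delta_ge0 andbT -(@disk_area0 R n).
by apply: area_delta_single; rewrite ediam0 lee_fin.
Qed.

Lemma area_deltaS A B : A `<=` B -> D A <= D B.
Proof.
move=> AB; apply: le_ereal_inf_tmp => _ [U [BU Ud] <-].
by apply: area_delta_cover => //; exact: subset_trans AB BU.
Qed.

Let cost (U : set (g_sigma_algebraType [set: set 'rV[R]_n])) : \bar R :=
  if ediam U <= d%:num%:E then disk_area U else +oo.

Let cost0 : cost set0 = 0.
Proof. by rewrite /cost ediam0 lee_fin ltW// disk_area0. Qed.

Let cost_ge0 U : 0 <= cost U.
Proof. by rewrite /cost; case: ifP => // _; exact: disk_area_ge0. Qed.

(** [area_delta] is the outer measure generated by the area of disks, with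
    infinite cost for the sets of large diameter; countable subadditivity is
    then a general fact. *)
Lemma area_deltaE A : D A = mu_ext cost A.
Proof.
apply/eqP; rewrite eq_le; apply/andP; split; apply: le_ereal_inf_tmp.
  move=> _ [U [_ AU] <-]; have [Ud|] := pselect (forall k, ediam (U k) <= d%:num%:E).
    apply: le_trans (area_delta_cover AU Ud) _.
    by apply: lee_nneseries => k _; [move=> _; exact: disk_area_ge0|rewrite /cost Ud].
  move=> /existsNP[k /negP/negbTE Uk].
  by rewrite (@eseries_pinfty _ _ _ k) ?leey// => [i _|]; rewrite /cost ?Uk// -ltNye;
    exact: lt_le_trans (cost_ge0 _).
move=> _ [U [AU Ud] <-]; apply: ereal_inf_lbound; exists U.
  by split => // k; exact: sub_sigma_algebra.
by apply: eq_eseriesr => k _; rewrite /cost Ud.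
Qed.

Lemma area_delta_sigma_subadditive : sigma_subadditive D.
Proof.
move=> A; rewrite area_deltaE (eq_eseriesr (fun k _ => area_deltaE (A k))).
exact: mu_ext_sigma_subadditive.
Qed.

End AreaDelta.

HB.instance Definition _ (R : realType) (n : nat) (d : {posnum R}) :=
  isOuterMeasure.Build R 'rV[R]_n (@area_delta R n d%:num)
    (area_delta0 n d) (@area_delta_ge0 R n d)
    (@area_deltaS R n d) (@area_delta_sigma_subadditive R n d).

Section Area.
Variables (R : realType) (n : nat).
Implicit Types (A B : set 'rV[R]_n).
Local Open Scope ereal_scope.

Lemma area_delta_le_area (d : {posnum R}) A : area_delta d%:num A <= area A.
Proof. by apply: ereal_sup_ubound; exists d%:num => /=. Qed.

Lemma area_le A (m : \bar R) :
  (forall d : {posnum R}, area_delta d%:num A <= m) -> area A <= m.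
Proof. by move=> h; apply: ge_ereal_sup => _ [d /= d0 <-]; exact: (h (PosNum d0)). Qed.

Lemma area_set0 : area (set0 : set 'rV[R]_n) = 0.
Proof.
apply/eqP; rewrite eq_le; apply/andP; split.
  by apply: area_le => d; rewrite outer_measure0.
by rewrite -(outer_measure0 (@area_delta R n (PosNum (@ltr01 R))%:num)) area_delta_le_area.
Qed.

Lemma area_ge0 A : 0 <= area A.
Proof.
by apply: le_trans (area_delta_le_area (PosNum (@ltr01 R)) A); exact: (@outer_measure_ge0 _ _ (@area_delta R n (PosNum (@ltr01 R))%:num)).
Qed.

Lemma areaS A B : A `<=` B -> area A <= area B.
Proof.
move=> AB; apply: area_le => d; apply: le_trans (area_delta_le_area d B).
exact: (@le_outer_measure _ _ (@area_delta R n d%:num)).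
Qed.

Lemma area_sigma_subadditive : sigma_subadditive (@area R n).
Proof.
move=> F; apply: area_le => d.
apply: le_trans (outer_measure_sigma_subadditive (@area_delta R n d%:num) F) _.
apply: lee_nneseries => k _; first by move=> _; exact: (@outer_measure_ge0 _ _ (@area_delta R n d%:num)).
exact: area_delta_le_area.
Qed.

HB.instance Definition _ := isOuterMeasure.Build R 'rV[R]_n (@area R n)
  area_set0 area_ge0 areaS area_sigma_subadditive.

Lemma areaU A B : area (A `|` B) <= area A + area B.
Proof. exact: outer_measureU2. Qed.

Lemma area_delta_anti (d e : {posnum R}) A : (d%:num <= e%:num)%R ->
  area_delta e%:num A <= area_delta d%:num A.
Proof.
move=> de; apply: le_ereal_inf_tmp => _ [U [AU Ud] <-].
by apply: area_delta_cover => // k; apply: le_trans (Ud k) _; rewrite lee_fin.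
Qed.

(** Sets at positive distance: a cover by sets smaller than the distance splits
    into a cover of each. *)
Lemma area_separated A B (r : R) : (0 < r)%R ->
  (forall x y, A x -> B y -> (r <= enorm (x - y))%R) ->
  area A + area B <= area (A `|` B).
Proof.
move=> r0 sep.
have key (d : {posnum R}) : (d%:num < r)%R ->
    area_delta d%:num A + area_delta d%:num B <= area_delta d%:num (A `|` B).
  move=> dr; apply: le_ereal_inf_tmp => _ [U [ABU Ud] <-].
  (* A set of the cover meets at most one of [A] and [B]. *)
  pose UA k := if `[< U k `&` A !=set0 >] then U k else set0.
  pose UB k := if `[< U k `&` A !=set0 >] then set0 else U k.
  have -> : \sum_(0 <= k <oo) disk_area (U k) =
      \sum_(0 <= k <oo) disk_area (UA k) + \sum_(0 <= k <oo) disk_area (UB k).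
    rewrite -nneseriesD//; try by move=> *; exact: disk_area_ge0.
    apply: eq_eseriesr => k _; rewrite /UA /UB.
    by case: ifP => _; rewrite disk_area0 ?adde0 ?add0e.
  apply: leeD; apply: area_delta_cover.
  - move=> x Ax; have [k _ Ukx] := ABU x (or_introl Ax); exists k => //.
    by rewrite /UA asboolT//; exists x.
  - by move=> k; rewrite /UA; case: ifP => // _; rewrite ediam0 lee_fin.
  - move=> y By; have [k _ Uky] := ABU y (or_intror By); exists k => //.
    rewrite /UB asboolF// => -[x [Ukx Ax]].
    have := le_trans (enorm_le_ediam Ukx Uky) (Ud k).
    by rewrite lee_fin => /(le_trans (sep _ _ Ax By)); rewrite leNgt dr.
  - by move=> k; rewrite /UB; case: ifP => // _; rewrite ediam0 lee_fin.
have {}key (d e : {posnum R}) :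
    area_delta d%:num A + area_delta e%:num B <= area (A `|` B).
  have f0 : (0 < Num.min (Num.min d%:num e%:num) (r / 2))%R.
    by rewrite !lt_min !gt0 divr_gt0.
  pose g := PosNum f0.
  have gd : (g%:num <= d%:num)%R by rewrite /= !ge_min lexx.
  have ge : (g%:num <= e%:num)%R by rewrite /= !ge_min lexx orbT.
  have gr : (g%:num < r)%R by rewrite /= gt_min; apply/orP; right; lra.
  apply: le_trans (leeD (area_delta_anti _ gd) (area_delta_anti _ ge)) _.
  by apply: le_trans (key _ gr) _; exact: area_delta_le_area.
case E : (area (A `|` B)) => [m| |]; last 2 first.
- by rewrite leey.
- by have := area_ge0 (A `|` B); rewrite E.
have fd (d : {posnum R}) C : C `<=` A `|` B -> area_delta d%:num C \is a fin_num.
  move=> CAB; rewrite ge0_fin_numE; last exact: (@outer_measure_ge0 _ _ (@area_delta R n d%:num)).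
  by apply: le_lt_trans (area_delta_le_area _ _) _; apply: le_lt_trans (areaS CAB) _; rewrite E ltry.
have fin C : C `<=` A `|` B -> area C \is a fin_num.
  by move=> CAB; rewrite ge0_fin_numE ?area_ge0//; apply: le_lt_trans (areaS CAB) _; rewrite E ltry.
rewrite -leeBrDr ?fin//; apply: area_le => d.
rewrite leeBrDr ?fin// addeC -leeBrDr ?fd//; apply: area_le => e.
by rewrite leeBrDr ?fd// addeC -E key.
Qed.

Definition lip1 (u : 'rV[R]_n -> R) :=
  forall x y, (`|u x - u y| <= enorm (x - y))%R.

(** The argument of Caratheodory for metric outer measures: the shells next to
    the level [r], taken alternately, are separated, so their areas are
    summable and the part of the set close to the level has small area. *)
Lemma caratheodory_sublevel (u : 'rV[R]_n -> R) (r : R) : lip1 u ->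
  (@area R n).-caratheodory [set x | (u x < r)%R].
Proof.
move=> lu; apply: le_caratheodory_measurable => X.
set C := [set x | (u x < r)%R].
change (area (X `&` C) + area (X `&` ~` C) <= area X).
have [->|] := eqVneq (area X) +oo; first by rewrite leey.
move=> Xoo; have fX : area X \is a fin_num.
  by rewrite ge0_fin_numE ?area_ge0// ltey.
pose iv (k : nat) : R := (k.+1%:R^-1)%R.
pose Y (k : nat) := X `&` [set x | (u x < r - iv k)%R].
have inv_lt k : (iv k.+1 < iv k)%R.
  by rewrite /iv ltf_pV2 ?posrE// ltr_nat.
have YS k : Y k `<=` Y k.+1.
  by move=> x [Xx /= ux]; split => //=; have := inv_lt k; lra.
have YX k : area (Y k) <= area X by apply: areaS => x [].
have sepY (k : nat) Z : (forall x, Z x -> (r - iv k.+1 <= u x)%R) ->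
    area (Y k) + area Z <= area (Y k `|` Z).
  move=> hZ; apply: (@area_separated _ _ (iv k - iv k.+1)%R).
    by have := inv_lt k; lra.
  move=> x y [Xx /= ux] Zy; have := lu x y; have := hZ _ Zy.
  by rewrite ler_norml => h /andP[]; lra.
pose A j := Y j.+2 `\` Y j.+1.
(* Consecutive shells may touch, so two alternating sums are needed. *)
have sumA N : \sum_(0 <= j < N) area (A j) <= area (Y N.+1) + area (Y N).
  elim: N => [|N IH]; first by rewrite big_geq// adde_ge0 ?area_ge0.
  rewrite big_nat_recr//=; apply: le_trans (leeD2r _ IH) _.
  rewrite -addeA [leLHS]addeC; apply: leeD2r; apply: le_trans (sepY _ _ _) _.
    by move=> x [[Xx _] h]; rewrite leNgt; apply/negP => ?; apply: h; split.
  by apply: areaS; move=> x [/YS/YS//|[]].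
have sumAoo : \sum_(0 <= j <oo) area (A j) <= area X + area X.
  apply: lime_le; first by apply: is_cvg_nneseries => *; exact: area_ge0.
  by apply: nearW => N; apply: le_trans (sumA N) _; apply: leeD; exact: YX.
have tail : \sum_(N <= j <oo) area (A j) @[N --> \oo] --> 0.
  apply: nneseries_tail_cvg; last by move=> *; exact: area_ge0.
  by apply: le_lt_trans sumAoo _; rewrite ltey_eq fin_numD fX.
have main N : area (X `&` C) + area (X `&` ~` C) <=
    area X + \sum_(N <= j <oo) area (A j).
  have CXN : X `&` C `<=` Y N.+1 `|` \bigcup_(j in ~` `I_N) A j.
    move=> x [Xx Cx].
    have [|hN] := pselect (Y N.+1 x); [by left|right].
    have [k Ykx] : exists k, Y k.+1 x.
      have /ltr_add_invr[k] : (u x < r)%R by []; rewrite -/(iv k) => hk.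
      exists k; split => //=; have := inv_lt k; lra.
    have YSle i j : (i <= j)%N -> Y i `<=` Y j.
      by move=> /subnK <-; elim: (j - i)%N => // m IH y /IH /YS.
    have {k Ykx} [k Ykx kmin] := ex_minnP (ex_intro (fun k => `[< Y k.+1 x >]) k (asboolT Ykx)).
    move: Ykx => /asboolP Ykx.
    have Nk : (N < k)%N.
      by rewrite ltnNge; apply/negP => kN; apply: hN; exact: (YSle k.+1).
    case: k Nk Ykx kmin => // k Nk Ykx kmin.
    exists k; first by rewrite /= ltnNge -ltnS Nk.
    split => //.
    by move=> /asboolT /kmin; rewrite ltnn.
  apply: le_trans (leeD2r _ (areaS CXN)) _.
  apply: le_trans (leeD2r _ (areaU _ _)) _.
  rewrite addeAC; apply: leeD; last first.
    exact: outer_measure_sigma_subadditive_tail.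
  apply: le_trans (sepY N.+1 _ _) _.
    move=> x [_ /= /negP]; rewrite -leNgt => h.
    by have : (0 < iv N.+2)%R by [rewrite /iv invr_gt0 ltr0Sn]; lra.
  by apply: areaS => x [[]|[]].
have : (fun N => area X + \sum_(N <= j <oo) area (A j)) @ \oo --> area X + 0.
  by apply: cvgeD; [rewrite fin_num_adde_defl | exact: cvg_cst | exact: tail].
rewrite adde0 => h; rewrite -(cvg_lim _ h)//; apply: lime_ge.
  by apply/cvg_ex; exists (area X).
by apply: nearW => N; exact: main.
Qed.

End Area.

(** The image of a cover is a cover by sets at most [K] times as large. *)
Lemma area_lip (R : realType) (m n : nat) (F : 'rV[R]_m -> 'rV[R]_n)
    (A : set 'rV[R]_m) (K : R) : (0 < K) ->
  (forall x y, A x -> A y -> enorm (F x - F y) <= K * enorm (x - y)) ->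
  (area (F @` A) <= (K ^+ 2)%:E * area A)%E.
Proof.
move=> K0 lipF; apply: area_le => d.
have dK0 : 0 < d%:num / K by rewrite divr_gt0.
pose e := PosNum dK0.
apply: (@le_trans _ _ ((K ^+ 2)%:E * area_delta e%:num A)%E); last first.
  by apply: lee_wpmul2l; [rewrite lee_fin sqr_ge0|exact: area_delta_le_area].
rewrite muleC -lee_pdivrMr ?exprn_gt0//; apply: le_ereal_inf_tmp => _ [U [AU Ud] <-].
rewrite lee_pdivrMr ?exprn_gt0// muleC -nneseriesZl; last by move=> *; exact: disk_area_ge0.
have dFU k : (ediam (F @` (U k `&` A)) <= K%:E * ediam (U k))%E.
  apply: ediam_le; first by rewrite mule_ge0 ?ediam_ge0// lee_fin ltW.
  move=> _ _ [x [Ux Ax] <-] [y [Uy Ay] <-].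
  apply: (@le_trans _ _ (K%:E * (enorm (x - y))%:E)%E); first by rewrite lee_fin lipF.
  by apply: lee_wpmul2l; [rewrite lee_fin ltW|exact: enorm_le_ediam].
apply: (@le_trans _ _ (\sum_(0 <= k <oo) disk_area (F @` (U k `&` A)))%E).
  apply: area_delta_cover.
    move=> _ [x Ax <-]; have [k _ Ukx] := AU x Ax.
    by exists k => //; exists x.
  move=> k; apply: le_trans (dFU k) _.
  by rewrite muleC -lee_pdivlMr//; exact: Ud.
apply: lee_nneseries => [*|k _]; first exact: disk_area_ge0.
rewrite /disk_area [leRHS]muleCA; apply: lee_wpmul2l; first by rewrite lee_fin pi4_ge0.
by rewrite !expe2 expr2 EFinM muleACA; apply: lee_pmul; rewrite ?ediam_ge0//; exact: dFU.
Qed.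

(** * Areas in the plane *)

(** Errors of order [1 / N] are the ones left by the subdivisions used below. *)
Lemma lee_lim_invS (R : realType) (x : \bar R) (p q : R) :
  (forall N, x <= (p + q / N.+1%:R)%:E)%E -> (x <= p%:E)%E.
Proof.
move=> h; apply/lee_addgt0Pr => e e0.
have q0 : 0 < e / (`|q| + 1) by rewrite divr_gt0// ltr_wpDl.
have /ltr_add_invr[N] := q0; rewrite add0r => hN.
apply: le_trans (h N) _; rewrite -EFinD lee_fin lerD2l.
apply: (@le_trans _ _ (`|q| * (e / (`|q| + 1)))).
  apply: (@le_trans _ _ (`|q| / N.+1%:R)); last exact/ler_wpM2l/ltW.
  by apply: ler_wpM2r => //; exact: ler_norm.
by rewrite mulrCA ler_piMr ?(ltW e0)// ler_pdivrMr ?mul1r ?lerDl// ltr_wpDl.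
Qed.

Lemma outer_measure_cover (R : realType) (T : Type)
    (mu : {outer_measure set T -> \bar R}) (A : set T) (N : nat)
    (Q : nat -> set T) :
  (forall x, A x -> exists2 i, (i < N)%N & Q i x) ->
  (mu A <= \sum_(i < N) mu (Q i))%E.
Proof.
move=> AQ; apply: le_trans (outer_measure_subadditive mu Q N).
by apply: le_outer_measure => x /AQ[i iN Qix]; rewrite -bigcup_mkord; exists i.
Qed.

Lemma outer_measure_cover_cst (R : realType) (T : Type)
    (mu : {outer_measure set T -> \bar R}) (A : set T) (N : nat)
    (Q : nat -> set T) (k : R) :
  (forall x, A x -> exists2 i, (i < N)%N & Q i x) ->
  (forall i, (i < N)%N -> (mu (Q i) <= k%:E)%E) ->
  (mu A <= (N%:R * k)%:E)%E.
Proof.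
move=> AQ Qk; apply: le_trans (outer_measure_cover mu AQ) _.
apply: (@le_trans _ _ (\sum_(i < N) k%:E)%E); first by apply: lee_sum => i _; exact: Qk.
by rewrite sumEFin sumr_const card_ord mulr_natl.
Qed.

Lemma cell_exists (R : realType) (f : nat -> R) (N : nat) (x : R) :
  f 0%N <= x -> x <= f N.+1 ->
  exists2 i, (i < N.+1)%N & f i <= x <= f i.+1.
Proof.
move=> f0; elim: N => [|N IH] fN; first by exists 0%N => //; rewrite f0.
have [/IH[i iN h]|h] := leP x (f N.+1); first by exists i => //; exact: ltnW.
by exists N.+1 => //; rewrite (ltW h).
Qed.

Section Plane.
Variable R : realType.
Implicit Types (a b w h s x y : R).

Definition pt x y : 'rV[R]_2 := \row_(i < 2) (if i == 0 then x else y).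

Lemma pt0 x y : pt x y 0 0 = x. Proof. by rewrite mxE. Qed.
Lemma pt1 x y : pt x y 0 1 = y. Proof. by rewrite mxE. Qed.
Lemma ptE (z : 'rV[R]_2) : pt (z 0 0) (z 0 1) = z.
Proof.
apply/rowP => i; rewrite mxE; case: i => -[|[|//]] i /=; congr (z _ _); exact: val_inj.
Qed.

Lemma dotp2 (u v : 'rV[R]_2) : dotp u v = u 0 0 * v 0 0 + u 0 1 * v 0 1.
Proof.
rewrite /dotp !big_ord_recl big_ord0 addr0.
by congr (_ * _ + _ * _); congr (_ _ _); exact: val_inj.
Qed.

Lemma sqr_enorm2 (u v : 'rV[R]_2) :
  enorm (u - v) ^+ 2 = (u 0 0 - v 0 0) ^+ 2 + (u 0 1 - v 0 1) ^+ 2.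
Proof. by rewrite sqr_enorm dotp2 !mxE !expr2. Qed.

Definition rect a b w h : set 'rV[R]_2 :=
  [set z | a <= z 0 0 <= a + w /\ b <= z 0 1 <= b + h].

(** Stated for an arbitrary outer measure because it serves both for [area] and
    for the measures [area_delta]. *)
Lemma rect_cover (mu : {outer_measure set 'rV[R]_2 -> \bar R}) (s k : R) :
  0 < s -> 0 <= k ->
  (forall a b, (mu (rect a b s s) <= (k * s ^+ 2)%:E)%E) ->
  forall a b w h, 0 <= w -> 0 <= h ->
  (mu (rect a b w h) <= (k * (w + s) * (h + s))%:E)%E.
Proof.
move=> s0 k0 sq a b w h w0 h0.
have cells l c x : 0 <= l -> c <= x <= c + l ->
    exists2 i, (i < (Num.truncn (l / s)).+1)%N & c + i%:R * s <= x <= c + i%:R * s + s.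
  move=> l0 /andP[cx xl].
  have [||i iN /andP[h1 h2]] := @cell_exists R (fun i => c + i%:R * s) (Num.truncn (l / s)) x.
  - by rewrite mul0r addr0.
  - apply: le_trans xl _; rewrite lerD2l -ler_pdivrMr//.
    by have /andP[_ /ltW] := truncn_itv (divr_ge0 l0 (ltW s0)).
  - by exists i => //; rewrite h1 (le_trans h2)// -natr1 mulrDl mul1r addrA.
have count l : 0 <= l -> (Num.truncn (l / s)).+1%:R * s <= l + s.
  move=> l0; rewrite -natr1 mulrDl mul1r lerD2r -ler_pdivlMr//.
  by have /andP[] := truncn_itv (divr_ge0 l0 (ltW s0)).
pose N := (Num.truncn (w / s)).+1; pose M := (Num.truncn (h / s)).+1.
apply: (@le_trans _ _ (N%:R * (M%:R * (k * s ^+ 2)))%:E).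
  apply: (@outer_measure_cover_cst _ _ mu _ N (fun i => rect (a + i%:R * s) b s h)).
    by move=> z [za zb]; have [i iN hi] := cells _ _ _ w0 za; exists i.
  move=> i _.
  apply: (@outer_measure_cover_cst _ _ mu _ M (fun j => rect (a + i%:R * s) (b + j%:R * s) s s)).
    by move=> z [za zb]; have [j jN hj] := cells _ _ _ h0 zb; exists j.
  by move=> j _; exact: sq.
rewrite lee_fin.
have -> : N%:R * (M%:R * (k * s ^+ 2)) = k * ((N%:R * s) * (M%:R * s)) by ring.
rewrite -[leRHS]mulrA; apply: ler_wpM2l => //; apply: ler_pM; rewrite ?mulr_ge0 ?(ltW s0)//.
  exact: count.
exact: count.
Qed.

Lemma rect_cover_lim (mu : {outer_measure set 'rV[R]_2 -> \bar R}) (d k : R) :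
  0 < d -> 0 <= k ->
  (forall s a b, 0 < s -> s <= d -> (mu (rect a b s s) <= (k * s ^+ 2)%:E)%E) ->
  forall a b w h, 0 <= w -> 0 <= h ->
  (mu (rect a b w h) <= (k * w * h)%:E)%E.
Proof.
move=> d0 k0 sq a b w h w0 h0.
apply: (@lee_lim_invS _ _ _ (Num.min 1 d * k * (w + h + 1))) => N.
pose s := Num.min 1 d / N.+1%:R.
have m0 : 0 < Num.min 1 d by rewrite lt_min ltr01.
have sm : s <= Num.min 1 d by rewrite ler_pdivrMr// ler_peMr ?(ltW m0)// ler1n.
have s0 : 0 < s by rewrite divr_gt0.
have s1 : s <= 1 by apply: le_trans sm _; rewrite ge_min lexx.
have sd : s <= d by apply: le_trans sm _; rewrite ge_min lexx orbT.
apply: le_trans (rect_cover s0 k0 _ _ _ w0 h0) _.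
  by move=> a' b'; exact: sq.
rewrite lee_fin.
have -> : Num.min 1 d * k * (w + h + 1) / N.+1%:R = s * (k * (w + h + 1)) by rewrite /s; ring.
rewrite -subr_ge0.
have -> : k * w * h + s * (k * (w + h + 1)) - k * (w + s) * (h + s) = k * s * (1 - s) by ring.
by apply: mulr_ge0; [rewrite mulr_ge0// ltW|rewrite subr_ge0].
Qed.

Definition unit_square_area : \bar R := area (rect 0 0 1 1).

Lemma ediam_rect a b s : 0 <= s -> (ediam (rect a b s s) <= (2 * s)%:E)%E.
Proof.
move=> s0; apply: ediam_le; first by rewrite lee_fin mulr_ge0.
move=> z z' [/andP[? ?] /andP[? ?]] [/andP[? ?] /andP[? ?]]; rewrite lee_fin.
rewrite -(@ler_pXn2r _ 2) ?nnegrE ?enorm_ge0 ?mulr_ge0//.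
have sq t : - s <= t -> t <= s -> t ^+ 2 <= s ^+ 2 by move=> ? ?; nra.
rewrite sqr_enorm2; apply: le_trans (lerD (sq _ _ _) (sq _ _ _)) _; try lra.
nra.
Qed.

Lemma unit_square_area_fin : unit_square_area \is a fin_num.
Proof.
rewrite ge0_fin_numE ?area_ge0//.
apply: (@le_lt_trans _ _ (pi * 1 * 1)%:E); last by rewrite ltry.
apply: area_le => d; apply: (@rect_cover_lim (@area_delta R 2 d%:num) (d%:num / 2)) => //.
  exact: pi_ge0.
move=> s a b s0 sd; apply: le_trans (area_delta_single _) _.
  by apply: le_trans (ediam_rect _ _ (ltW s0)) _; rewrite lee_fin; lra.
apply: le_trans (@disk_area_le _ _ _ (2 * s) _ (ediam_rect _ _ (ltW s0))) _.
  by rewrite mulr_ge0// ltW.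
by rewrite lee_fin le_eqVlt; apply/orP; left; apply/eqP; field.
Qed.

Let c := fine unit_square_area.

Lemma unit_square_areaE : unit_square_area = c%:E.
Proof. by rewrite fineK// unit_square_area_fin. Qed.

Lemma unit_square_area_ge0 : 0 <= c. Proof. by rewrite fine_ge0// area_ge0. Qed.

Lemma area_square_le a b s : 0 < s -> (area (rect a b s s) <= (c * s ^+ 2)%:E)%E.
Proof.
move=> s0; rewrite mulrC EFinM -unit_square_areaE.
apply: le_trans (@area_lip _ 2 2 (fun z => pt a b + s *: z) (rect 0 0 1 1) s s0 _).
  apply: areaS => z [/andP[? ?] /andP[? ?]].
  exists (s^-1 *: (z - pt a b)); last first.
    by rewrite scalerA mulfV ?gt_eqF// scale1r addrC subrK.
  have cell t l : l <= t -> t <= l + s -> 0 <= s^-1 * (t - l) <= 0 + 1.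
    move=> ? ?; rewrite mulr_ge0 ?invr_ge0 ?(ltW s0) ?subr_ge0//= add0r.
    by rewrite ler_pdivrMl// mulr1; lra.
  by split; rewrite !mxE /=; exact: cell.
by move=> x y _ _; rewrite opprD addrACA subrr add0r -scalerBr enormZ gtr0_norm.
Qed.

Lemma area_square_ge a b s : 0 < s -> ((c * s ^+ 2)%:E <= area (rect a b s s))%E.
Proof.
move=> s0; rewrite EFinM -unit_square_areaE -lee_pdivlMr ?exprn_gt0// muleC -exprVn.
have si : 0 < s^-1 by rewrite invr_gt0.
apply: le_trans (@area_lip _ 2 2 (fun z => s^-1 *: (z - pt a b)) (rect a b s s) s^-1 si _).
  apply: areaS => z [/andP[? ?] /andP[? ?]].
  exists (pt a b + s *: z); last first.
    by rewrite addrAC subrr add0r scalerA mulVf ?gt_eqF// scale1r.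
  rewrite /rect /= !mxE /=; split; apply/andP; split; nra.
move=> x y _ _; rewrite -scalerBr opprB addrA subrK enormZ gtr0_norm//.
Qed.

Lemma area_rect_le a b w h : 0 <= w -> 0 <= h ->
  (area (rect a b w h) <= (c * w * h)%:E)%E.
Proof.
move=> w0 h0; apply: (@rect_cover_lim (@area R 2) 1) => //; first exact: unit_square_area_ge0.
by move=> s a' b' s0 _; exact: area_square_le.
Qed.

(** A map of a rectangle whose increments are dominated by a positive definite
    quadratic form factors, by a Cholesky decomposition of the form, through a
    1-Lipschitz map of a parallelogram; thin slices of the parallelogram are
    nearly rectangles. *)
Lemma area_quad (n : nat) (G : R -> R -> 'rV[R]_n) (A B C a b l1 l2 : R) :
  0 < A -> 0 < A * C - B ^+ 2 -> 0 <= l1 -> 0 <= l2 ->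
  (forall x y x' y', a <= x <= a + l1 -> b <= y <= b + l2 ->
     a <= x' <= a + l1 -> b <= y' <= b + l2 ->
     enorm (G x y - G x' y') ^+ 2 <=
     A * (x - x') ^+ 2 + 2 * B * (x - x') * (y - y') + C * (y - y') ^+ 2) ->
  (area [set G z.1 z.2 | z in [set z : R * R |
      a <= z.1 <= a + l1 /\ b <= z.2 <= b + l2]%R]
    <= (c * Num.sqrt (A * C - B ^+ 2) * l1 * l2)%:E)%E.
Proof.
move=> A0 D0 l10 l20 hG.
(* The Cholesky factor of the form is the matrix with rows (al, be) and (0, ga). *)
pose al := Num.sqrt A; pose be := B / al; pose ga := Num.sqrt (A * C - B ^+ 2) / al.
have al0 : 0 < al by rewrite sqrtr_gt0.
have ga0 : 0 < ga by rewrite divr_gt0// sqrtr_gt0.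
have al2 : al ^+ 2 = A by rewrite sqr_sqrtr// ltW.
have q dx dy : A * dx ^+ 2 + 2 * B * dx * dy + C * dy ^+ 2 =
    (al * dx + be * dy) ^+ 2 + (ga * dy) ^+ 2.
  rewrite /be [(ga * dy) ^+ 2]exprMn /ga exprMn sqr_sqrtr ?(ltW D0)// exprVn al2.
  have -> : (al * dx + B / al * dy) ^+ 2 =
      al ^+ 2 * dx ^+ 2 + 2 * B * dx * dy * (al / al) + B ^+ 2 * dy ^+ 2 * (al ^+ 2)^-1.
    by field; rewrite gt_eqF.
  by rewrite al2 mulfV ?gt_eqF//; field; rewrite gt_eqF.
apply: (@lee_lim_invS _ _ _ (c * (2 * `|be| * l2) * (ga * l2))) => N.
pose st := l2 / N.+1%:R.
have st0 : 0 <= st by rewrite divr_ge0.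
have Nst : N.+1%:R * st = l2 by rewrite mulrCA mulfV ?mulr1// pnatr_eq0.
pose Dom (k : nat) := [set z : R * R | a <= z.1 <= a + l1 /\
  b + k%:R * st <= z.2 <= b + k%:R * st + st].
apply: (@le_trans _ _ (N.+1%:R * (c * (al * l1 + 2 * `|be| * st) * (ga * st)))%:E).
  apply: (@outer_measure_cover_cst _ _ (@area R n) _ N.+1
    (fun k => [set G z.1 z.2 | z in Dom k])).
    move=> _ [[x y] /= [hx /andP[hy1 hy2]] <-].
    have [||k kN /andP[h1 h2]] := @cell_exists R (fun i => b + i%:R * st) N y.
    - by rewrite mul0r addr0.
    - by rewrite Nst.
    - exists k => //; exists (x, y) => //; split => //=.
      by rewrite h1 (le_trans h2)// -natr1 mulrDl mul1r addrA.
  move=> k kN; set bk := b + k%:R * st.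
  pose Psi (z : 'rV[R]_2) := G ((z 0 0 - be * (z 0 1 / ga)) / al) (z 0 1 / ga).
  pose Z := [set pt (al * z.1 + be * z.2) (ga * z.2) | z in Dom k].
  have PsiE x y : Psi (pt (al * x + be * y) (ga * y)) = G x y.
    rewrite /Psi pt0 pt1 (mulrC ga) mulfK ?gt_eqF// addrK (mulrC al) mulfK ?gt_eqF//.
  have -> : [set G z.1 z.2 | z in Dom k] = Psi @` Z.
    apply/seteqP; split.
      by move=> _ [z zD <-]; exists (pt (al * z.1 + be * z.2) (ga * z.2)); [exists z|exact: PsiE].
    by move=> _ [_ [z zD <-] <-]; exists z => //; rewrite PsiE.
  have subk y : bk <= y <= bk + st -> b <= y <= b + l2.
    move=> /andP[h1 h2]; apply/andP; split.
      by apply: le_trans h1; rewrite lerDl mulr_ge0.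
    apply: le_trans h2 _; rewrite -addrA lerD2l -Nst -{2}(mul1r st) -mulrDl.
    by apply: ler_wpM2r => //; rewrite natr1 ler_nat.
  apply: le_trans (@area_lip _ _ _ Psi Z 1 ltr01 _) _.
    move=> _ _ [z [z1 z2] <-] [z' [z1' z2'] <-]; rewrite mul1r.
    rewrite -(@ler_pXn2r _ 2) ?nnegrE ?enorm_ge0// !PsiE.
    apply: le_trans (hG _ _ _ _ _ _ _ _) _; rewrite ?z1 ?z1' ?subk//.
    rewrite q sqr_enorm2 !pt0 !pt1 le_eqVlt; apply/orP; left; apply/eqP.
    by congr (_ + _); ring.
  rewrite expr1n mul1e.
  pose a' := al * a + be * bk - `|be| * st.
  apply: (@le_trans _ _ (area (rect a' (ga * bk) (al * l1 + 2 * `|be| * st) (ga * st)))).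
    apply: areaS => _ [[x y] [/andP[/= x1 x2] /andP[/= y1 y2]] <-].
    rewrite -/bk in y1 y2.
    have hbe : `|be * (y - bk)| <= `|be| * st.
      by rewrite normrM; apply: ler_wpM2l => //; rewrite ger0_norm; lra.
    have /andP[hb1 hb2] : - (`|be| * st) <= be * (y - bk) <= `|be| * st by rewrite -ler_norml.
    by rewrite /rect /= pt0 pt1 /a'; split; apply/andP; split; nra.
  apply: area_rect_le; last by rewrite mulr_ge0// ltW.
  by rewrite addr_ge0// !mulr_ge0// ltW.
rewrite lee_fin le_eqVlt; apply/orP; left; apply/eqP.
have gal : Num.sqrt (A * C - B ^+ 2) = ga * al by rewrite divfK ?gt_eqF.
rewrite gal /st; have := pnatr_eq0 R N.+1; set M := N.+1%:R => /negbT M0.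
by field.
Qed.

(** Lower Riemann sums for the area of a quarter of the unit disk, for the
    partition of the radius by the points [sin (j h)]. *)
Lemma quarter_disk_sum N (h := pi / 2 / N.+1%:R : R) :
  pi / 4 - h <= \sum_(j < N.+1) (sin (j.+1%:R * h) - sin (j%:R * h)) * cos (j.+1%:R * h).
Proof.
have h0 : 0 < h by rewrite !divr_gt0 ?pi_gt0.
have Nh : N.+1%:R * h = pi / 2 by rewrite mulrCA mulfV ?mulr1// pnatr_eq0.
have stepE j : j.+1%:R * h = j%:R * h + h by rewrite -natr1 mulrDl mul1r.
have jh_ge0 j : 0 <= j%:R * h by rewrite mulr_ge0// ltW.
have jh_le j : (j <= N.+1)%N -> j%:R * h <= pi / 2.
  by move=> jN; rewrite -Nh ler_pM2r// ler_nat.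
(* A primitive of [cos ^ 2]. *)
pose P t : R := (t + sin t * cos t) / 2.
have dP (t : R) : is_derive t 1 P (cos t ^+ 2).
  apply: is_derive_eq; rewrite /GRing.scale/=.
  have := cos2Dsin2 t; set x := cos t; set y := sin t => e.
  rewrite !expr2 in e *; lra.
have cosle x y : 0 <= x -> x <= y -> y <= pi / 2 -> 0 <= cos y <= cos x.
  move=> x0 xy y2; have p0 := pi_gt0 R; apply/andP; split.
    by apply: cos_ge0_pihalf; rewrite y2 andbT; lra.
  rewrite le_eqVlt in xy; case/orP: xy => [/eqP->//|xy].
  by apply/ltW; rewrite ltr_cos// in_itv/=; apply/andP; split; lra.
have low j : (j < N.+1)%N ->
    h * cos (j.+1%:R * h) ^+ 2 <= (sin (j.+1%:R * h) - sin (j%:R * h)) * cos (j.+1%:R * h).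
  move=> jN; have lt : j%:R * h < j.+1%:R * h by rewrite stepE ltrDl.
  have [|t /[!in_itv]/= /andP[t1 t2] ->] := @MVT R sin cos _ _ lt.
    by apply: continuous_subspaceT => x; exact: continuous_sin.
  have /andP[c0 ct] := cosle t _ (le_trans (jh_ge0 j) (ltW t1)) (ltW t2) (jh_le _ jN).
  have -> : j.+1%:R * h - j%:R * h = h by rewrite stepE addrAC subrr add0r.
  rewrite expr2 mulrA (mulrC (cos t)).
  by apply: ler_wpM2r => //; apply: ler_wpM2l => //; exact: ltW.
have up j : (j.+1 < N.+1)%N -> P (j.+2%:R * h) - P (j.+1%:R * h) <= h * cos (j.+1%:R * h) ^+ 2.
  move=> jN; have lt : j.+1%:R * h < j.+2%:R * h by rewrite (stepE j.+1) ltrDl.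
  have [|t /[!in_itv]/= /andP[t1 t2] ->] := @MVT R P (fun t => cos t ^+ 2) _ _ lt.
    apply: derivable_within_continuous => x _; exact: (@ex_derive _ _ _ _ _ _ _ (dP x)).
  have /andP[c0 ct] := cosle _ t (jh_ge0 _) (ltW t1) (le_trans (ltW t2) (jh_le _ jN)).
  have -> : j.+2%:R * h - j.+1%:R * h = h by rewrite (stepE j.+1) addrAC subrr add0r.
  rewrite mulrC; apply: ler_wpM2l; first exact: ltW.
  by rewrite ler_pXn2r ?nnegrE// (le_trans c0).
apply: (@le_trans _ _ (\sum_(j < N.+1) h * cos (j.+1%:R * h) ^+ 2)); last first.
  by apply: ler_sum => j _; exact: low.
rewrite big_ord_recr/= Nh cos_pihalf expr0n mulr0 addr0.
apply: (@le_trans _ _ (\sum_(j < N) (P (j.+2%:R * h) - P (j.+1%:R * h)))); last first.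
  by apply: ler_sum => j _; apply: up; rewrite ltnS.
rewrite -(big_mkord xpredT (fun j => P (j.+2%:R * h) - P (j.+1%:R * h))).
rewrite (telescope_sumr_eq (fun j => P (j.+1%:R * h)))// Nh mul1r.
rewrite /P sin_pihalf cos_pihalf mulr0 addr0.
have : P h - P 0 <= h.
  have [|t _ ->] := @MVT R P (fun t => cos t ^+ 2) _ _ h0.
    apply: derivable_within_continuous => x _; exact: (@ex_derive _ _ _ _ _ _ _ (dP x)).
  by rewrite subr0 ler_piMl ?(ltW h0)// expr_le1// ?cos_ge0.
rewrite /P sin0 mul0r addr0; lra.
Qed.

(** A square is the union of its inscribed disk and of four corners covered by
    rectangles of total area close to [1 - pi / 4] times the square. *)
Lemma square_le_disk (d : {posnum R}) (a b s : R) (N : nat) : 0 < s -> s <= d%:num ->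
  (area_delta d%:num (rect a b s s) <=
   ((pi / 4 + c * (1 - (pi / 4 - pi / 2 / N.+1%:R))) * s ^+ 2)%:E)%E.
Proof.
move=> s0 sd; set h := pi / 2 / N.+1%:R : R.
pose r := s / 2; have r0 : 0 < r by rewrite divr_gt0.
have h0 : 0 < h by rewrite !divr_gt0 ?pi_gt0.
have p0 := pi_gt0 R.
have Nh : N.+1%:R * h = pi / 2 by rewrite mulrCA mulfV ?mulr1// pnatr_eq0.
pose x0 := a + r; pose y0 := b + r.
pose D := [set z : 'rV[R]_2 | (z 0 0 - x0) ^+ 2 + (z 0 1 - y0) ^+ 2 <= r ^+ 2].
pose L := rect a b s s `\` D.
pose sn j := r * sin (j%:R * h); pose cs j := r * cos (j%:R * h).
have rng j : (j < N.+1)%N -> 0 < j.+1%:R * h <= pi / 2.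
  move=> jN; rewrite mulr_gt0//=.
  by rewrite -Nh ler_pM2r// ler_nat.
have cs0 j : (j < N.+1)%N -> 0 <= cs j.+1 <= r.
  move=> jN; have /andP[j1 j2] := rng _ jN; rewrite mulr_ge0 ?(ltW r0)//=.
    by rewrite ler_piMr ?(ltW r0)// cos_le1.
  by apply: cos_ge0_pihalf; apply/andP; split; lra.
have sn_le j : (j < N.+1)%N -> 0 <= sn j.+1 - sn j.
  move=> jN; rewrite subr_ge0 /sn ler_pM2l//.
  have /andP[j1 j2] := rng _ jN.
  have j0 : 0 <= j%:R * h by rewrite mulr_ge0// ltW.
  have jj : j%:R * h <= j.+1%:R * h by rewrite ler_pM2r// ler_nat.
  move: jj; rewrite le_eqVlt => /orP[/eqP->//|jj].
  by apply/ltW; rewrite ltr_sin// in_itv/=; apply/andP; split; lra.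
pose k j := c * (sn j.+1 - sn j) * (r - cs j.+1).
pose Q1 j := rect (x0 + sn j) (y0 + cs j.+1) (sn j.+1 - sn j) (r - cs j.+1).
pose Q2 j := rect (x0 + sn j) (y0 - r) (sn j.+1 - sn j) (r - cs j.+1).
pose Q3 j := rect (x0 - sn j.+1) (y0 + cs j.+1) (sn j.+1 - sn j) (r - cs j.+1).
pose Q4 j := rect (x0 - sn j.+1) (y0 - r) (sn j.+1 - sn j) (r - cs j.+1).
have aL : (area L <= (\sum_(j < N.+1) 4 * k j)%:E)%E.
  apply: le_trans (@outer_measure_cover _ _ (@area R 2) L N.+1
    (fun j => Q1 j `|` Q2 j `|` (Q3 j `|` Q4 j)) _) _.
    move=> z [[/andP[z1 z2] /andP[z3 z4]] /negP]; rewrite -ltNge => out.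
    pose u := `|z 0 0 - x0|; pose v := `|z 0 1 - y0|.
    have ur : u <= r by rewrite /u ler_norml /x0 /r; apply/andP; split; lra.
    have vr : v <= r by rewrite /v ler_norml /y0 /r; apply/andP; split; lra.
    have {}out : r ^+ 2 < u ^+ 2 + v ^+ 2 by rewrite !real_normK ?num_real.
    have [||j jN /andP[u1 u2]] := @cell_exists R sn N u.
    - by rewrite /sn mul0r sin0 mulr0; exact: normr_ge0.
    - by rewrite /sn Nh sin_pihalf mulr1.
    exists j => //.
    have csv : cs j.+1 <= v.
      rewrite leNgt; apply/negP => vc.
      have := cos2Dsin2 (j.+1%:R * h) => /(congr1 (fun t => r ^+ 2 * t)).
      rewrite mulrDr mulr1 -!exprMn -/(cs j.+1) -/(sn j.+1).
      have u0 : 0 <= u by exact: normr_ge0.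
      have v0 : 0 <= v by exact: normr_ge0.
      have h1 : u ^+ 2 <= sn j.+1 ^+ 2 by rewrite ler_pXn2r ?nnegrE// (le_trans u0).
      have h2 : v ^+ 2 <= cs j.+1 ^+ 2 by rewrite ler_pXn2r ?nnegrE ?(ltW vc)// (le_trans v0) ?ltW.
      lra.
    have := cs0 _ jN; have := sn_le _ jN => snj /andP[csj1 csj2].
    have [zx|zx] := lerP x0 (z 0 0); have [zy|zy] := lerP y0 (z 0 1).
    - left; left; rewrite /Q1 /rect /=.
      rewrite /u ger0_norm ?subr_ge0// in u1 u2 ur.
      rewrite /v ger0_norm ?subr_ge0// in csv vr.
      by split; apply/andP; split; lra.
    - left; right; rewrite /Q1 /rect /=.
      rewrite /u ger0_norm ?subr_ge0// in u1 u2 ur.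
      rewrite /v ltr0_norm ?subr_lt0// in csv vr.
      by split; apply/andP; split; lra.
    - right; left; rewrite /Q1 /rect /=.
      rewrite /u ltr0_norm ?subr_lt0// in u1 u2 ur.
      rewrite /v ger0_norm ?subr_ge0// in csv vr.
      by split; apply/andP; split; lra.
    - right; right; rewrite /Q1 /rect /=.
      rewrite /u ltr0_norm ?subr_lt0// in u1 u2 ur.
      rewrite /v ltr0_norm ?subr_lt0// in csv vr.
      by split; apply/andP; split; lra.
  rewrite -sumEFin; apply: lee_sum => j _.
  have hk x y : (area (rect x y (sn j.+1 - sn j) (r - cs j.+1)) <= (k j)%:E)%E.
    apply: area_rect_le; first exact: sn_le.
    by rewrite subr_ge0; have /andP[] := cs0 _ (ltn_ord j).
  have -> : 4 * k j = (k j + k j) + (k j + k j) by ring.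
  rewrite !EFinD; apply: le_trans (areaU _ _) _.
  by apply: leeD; (apply: le_trans (areaU _ _) _; apply: leeD; exact: hk).
apply: (@le_trans _ _ (area_delta d%:num D + area_delta d%:num L)%E).
  apply: le_trans (@outer_measureU2 _ _ (@area_delta R 2 d%:num) D L).
  apply: area_deltaS => z zr.
  by have [?|?] := pselect (D z); [left|right].
have dD : (ediam D <= s%:E)%E.
  have DE z : D z -> enorm (z - pt x0 y0) <= r.
    move=> Dz; rewrite -(@ler_pXn2r _ 2) ?nnegrE ?enorm_ge0 ?(ltW r0)//.
    by rewrite sqr_enorm2 pt0 pt1.
  apply: ediam_le; first by rewrite lee_fin ltW.
  move=> z z' /DE hz /DE hz'; rewrite lee_fin.
  have -> : z - z' = (z - pt x0 y0) - (z' - pt x0 y0) by rewrite opprB addrA subrK.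
  by apply: le_trans (enormB _ _) _; rewrite /r in hz hz'; lra.
rewrite mulrDl EFinD; apply: leeD.
  apply: le_trans (area_delta_single _) _; last exact: disk_area_le (ltW s0) dD.
  by apply: le_trans dD _; rewrite lee_fin.
apply: le_trans (area_delta_le_area _ _) _; apply: le_trans aL _; rewrite lee_fin.
have hS := quarter_disk_sum N; rewrite -/h in hS.
have kE j : 4 * k j = (c * s ^+ 2) * ((sin (j.+1%:R * h) - sin (j%:R * h)) -
    (sin (j.+1%:R * h) - sin (j%:R * h)) * cos (j.+1%:R * h)).
  by rewrite /k /sn /cs /r; field.
under eq_bigr do rewrite kE.
rewrite -mulr_sumr sumrB.
have -> : \sum_(j < N.+1) (sin (j.+1%:R * h) - sin (j%:R * h)) = 1.
  rewrite -(big_mkord xpredT (fun j => sin (j.+1%:R * h) - sin (j%:R * h))).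
  by rewrite (telescope_sumr_eq (fun j => sin (j%:R * h)))// Nh mul0r sin0 sin_pihalf subr0.
rewrite -(mulrA c) -(mulrA c) (mulrC _ (s ^+ 2)).
apply: ler_wpM2l; first exact: unit_square_area_ge0.
by apply: ler_wpM2l; [rewrite exprn_ge0// ltW|rewrite lerD2l lerN2].
Qed.

(** Filling a square by small squares, and those by disks and corners, gives
    [c <= pi / 4 + c * (1 - pi / 4)]. *)
Lemma unit_square_area_le1 : c <= 1.
Proof.
have p0 := pi_gt0 R; have cc0 := unit_square_area_ge0.
suff h : c <= pi / 4 + c * (1 - pi / 4) by nra.
rewrite -lee_fin -unit_square_areaE.
apply: (@lee_lim_invS _ _ _ (c * (pi / 2))) => N.
apply: area_le => d.
have -> : pi / 4 + c * (1 - pi / 4) + c * (pi / 2) / N.+1%:R =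
   (pi / 4 + c * (1 - (pi / 4 - pi / 2 / N.+1%:R))) * 1 * 1 by ring.
apply: (@rect_cover_lim (@area_delta R 2 d%:num) d%:num) => //.
  have i0 : 0 <= pi / 2 / N.+1%:R :> R by rewrite !divr_ge0// ltW.
  have p4 : pi / 4 <= 1 :> R.
    by have /ltW := @pihalf_lt2 R; lra.
  set e := pi / 2 / _ in i0 *.
  by apply: addr_ge0; [|apply: mulr_ge0 => //]; lra.
by move=> s a b s0 sd; exact: square_le_disk.
Qed.

End Plane.

(** * From local to global comparison of areas *)

Section EuclideanTopology.
Variables (R : realType) (n : nat).
Implicit Types (x y p : 'rV[R]_n) (U C : set 'rV[R]_n).

Lemma eball_nbhs U x : nbhs x U <-> exists2 r : R, 0 < r & eball x r `<=` U.
Proof.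
split.
  move=> /nbhs_ballP[e /= e0 xU]; exists e => // y xy; apply: xU.
  rewrite -ball_normE /= -normrN opprB.
  exact: le_lt_trans (norm_le_enorm _) xy.
move=> [r r0 xU]; apply/nbhs_ballP; exists (r / (n%:R + 1)) => /=.
  by rewrite divr_gt0// ltr_wpDl.
move=> y; rewrite -ball_normE /= => xy; apply: xU; rewrite /eball/= enormBC.
apply: le_lt_trans (enorm_le_norm _) _.
apply: (@le_lt_trans _ _ ((n%:R + 1) * `|x - y|)).
  by apply: ler_wpM2r => //; rewrite lerDl.
by rewrite mulrC -ltr_pdivlMr// ltr_wpDl.
Qed.

Lemma eball_open U x : open U -> U x -> exists2 r : R, 0 < r & eball x r `<=` U.
Proof. by move=> oU Ux; apply/eball_nbhs; exact: open_nbhs_nbhs. Qed.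

Lemma eball_center x (r : R) : 0 < r -> eball x r x.
Proof. by rewrite /eball /= subrr enorm0. Qed.

Lemma open_eball x (r : R) : open (eball x r).
Proof.
rewrite openE => y xy; apply/eball_nbhs; exists (r - enorm (y - x)).
  by rewrite subr_gt0.
move=> z; rewrite /eball /= in xy *; rewrite ltrBrDr; apply: le_lt_trans.
by have := enormD (z - y) (y - x); rewrite addrA subrK.
Qed.

Lemma enorm_cvg (T : Type) (F : set_system T) (FF : Filter F)
    (f : T -> 'rV[R]_n) x :
  (f @ F --> x) <-> (forall e, 0 < e -> \forall t \near F, enorm (f t - x) < e).
Proof.
split=> [fx e e0|h].
  by apply: (fx (eball x e)); apply/eball_nbhs; exists e.
move=> U /eball_nbhs[r r0 xU]; apply: filterS (h r r0) => t; exact: xU.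
Qed.

Lemma eball_lip1 p : lip1 (fun x => enorm (x - p)).
Proof.
move=> x y; apply: le_trans (enorm_sub_lip _ _) _.
by rewrite opprB addrA subrK.
Qed.

Lemma rational_approx x (r : R) : 0 < r ->
  exists q : 'rV[rat]_n, enorm (map_mx ratr q - x) < r.
Proof.
move=> r0; pose d := r / (n%:R + 1).
have d0 : 0 < d by rewrite divr_gt0// ltr_wpDl.
have h i : exists q : rat, `|ratr q - x 0 i| < d.
  have [|q] := @rat_in_itvoo R (x 0 i - d) (x 0 i + d); first lra.
  rewrite in_itv/= => /andP[q1 q2]; exists q; rewrite ltr_norml; apply/andP; split; lra.
have [q hq] := choice h; exists (\row_i q i).
apply: le_lt_trans (enorm_le_norm _) _.
have : `|map_mx ratr (\row_i q i) - x| <= d.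
  rewrite [leLHS]/Num.norm/= mx_normrE; apply/bigmax_leP; split; first exact: ltW.
  by move=> [i j] _ /=; rewrite ord1 !mxE ltW.
move=> /(ler_wpM2l (ler0n R n)) /le_lt_trans; apply.
rewrite /d mulrCA gtr_pMr// ltr_pdivrMr ?ltr_wpDl// mul1r ltrDl//.
Qed.

Definition base_ball (k : nat) : set 'rV[R]_n :=
  if @unpickle ('rV[rat]_n * nat)%type k is Some (q, m)
  then eball (map_mx ratr q) m.+1%:R^-1 else set0.

(** Rational centres and radii make the base countable. *)
Lemma base_ballP U x : open U -> U x ->
  exists2 k, base_ball k x & base_ball k `<=` U.
Proof.
move=> oU Ux; have [r r0 xU] := eball_open oU Ux.
have /ltr_add_invr[m] : 0 < r / 2 by rewrite divr_gt0.
rewrite add0r => hm; have im0 : 0 < m.+1%:R^-1 :> R by rewrite invr_gt0 ltr0Sn.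
have [q hq] := rational_approx x im0.
exists (pickle (q, m)); rewrite /base_ball pickleK.
  by rewrite /eball /= enormBC.
move=> y /= yq; apply: xU; rewrite /eball /=.
have := enormD (y - map_mx ratr q) (map_mx ratr q - x); rewrite addrA subrK.
move=> /le_lt_trans; apply; apply: lt_trans (ltrD yq hq) _.
by rewrite (splitr r) ltrD.
Qed.

Lemma open_base_ball k : open (base_ball k).
Proof.
rewrite /base_ball; case: unpickle => [[q m]|]; [exact: open_eball|exact: open0].
Qed.

Lemma caratheodory_eball p (r : R) : (@area R n).-caratheodory (eball p r).
Proof. exact: caratheodory_sublevel (eball_lip1 p). Qed.

Lemma caratheodory_base_ball k : (@area R n).-caratheodory (base_ball k).
Proof.
rewrite /base_ball; case: unpickle => [[q m]|]; first exact: caratheodory_eball.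
exact: (@caratheodory_measurable_set0 R _ (@area R n)).
Qed.

Lemma caratheodory_open U : open U -> (@area R n).-caratheodory U.
Proof.
move=> oU.
have -> : U = \bigcup_k (if `[< base_ball k `<=` U >] then base_ball k else set0).
  apply/seteqP; split => [x Ux|x [k _]].
    by have [k kx kU] := base_ballP oU Ux; exists k => //; rewrite asboolT.
  by case: asboolP => // kU; exact: kU.
apply: (@caratheodory_measurable_bigcup R _ (@area R n)) => k.
case: ifP => _; first exact: caratheodory_base_ball.
exact: (@caratheodory_measurable_set0 R _ (@area R n)).
Qed.

Lemma caratheodory_closed C : closed C -> (@area R n).-caratheodory C.
Proof.
move=> cC; rewrite -(setCK C); apply: (@caratheodory_measurable_setC R _ (@area R n)).
by apply: caratheodory_open; exact: closed_openC.
Qed.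

Definition thickening C (j : nat) : set 'rV[R]_n :=
  \bigcup_(y in C) eball y j.+1%:R^-1.

Lemma open_thickening C j : open (thickening C j).
Proof. by apply: bigcup_open => y _; exact: open_eball. Qed.

Lemma thickeningS C j : thickening C j.+1 `<=` thickening C j.
Proof.
move=> x [y Cy xy]; exists y => //; rewrite /eball /= in xy *.
by apply: lt_trans xy _; rewrite ltf_pV2 ?posrE// ltr_nat.
Qed.

Lemma bigcap_thickening C : closed C -> \bigcap_j thickening C j = C.
Proof.
move=> cC; apply/seteqP; split => [x hx|x Cx j _]; last first.
  by exists x => //; apply: eball_center; rewrite invr_gt0.
apply: contrapT => nCx.
have [r r0 xC] := eball_open (closed_openC cC) nCx.
have /ltr_add_invr[j] : 0 < r by []; rewrite add0r => jr.
have [y Cy] := hx j I; rewrite /eball /= => xy.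
by apply: (xC y) => //; rewrite /eball /= enormBC; exact: lt_trans xy jr.
Qed.

End EuclideanTopology.

(** Continuity from above.  [X] need not be measurable: Caratheodory additivity
    is used only on the differences [O j `\` O j.+1], inside [X]. *)
Lemma outer_measure_bigcap_le (R : realType) (T : Type)
    (mu : {outer_measure set T -> \bar R}) (X : set T) (O : nat -> set T) (e : R) :
  (mu X < +oo)%E -> (forall j, mu.-caratheodory (O j)) ->
  (forall j, O j.+1 `<=` O j) -> 0 < e ->
  exists N, (mu (X `&` O N) <= mu (X `&` \bigcap_j O j) + e%:E)%E.
Proof.
move=> Xoo mO OS e0; pose E j := O j `\` O j.+1.
have Ole i j : (i <= j)%N -> O j `<=` O i.
  by move=> /subnK <-; elim: (j - i)%N => // m IH x /OS /IH.
have mE j : mu.-caratheodory (E j) by exact: (@caratheodory_measurable_setD R _ mu).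
have tE : trivIset setT E.
  apply/trivIsetP => i j _ _; wlog ij : i j / (i < j)%N.
    move=> W; rewrite neq_ltn => /orP[] ij; first by apply: W => //; rewrite ltn_eqF.
    by rewrite setIC; apply: W => //; rewrite ltn_eqF.
  move=> _; apply/seteqP; split => // x [[_ nx] [xj _]]; apply: nx.
  exact: Ole xj.
have sE : (\sum_(0 <= k <oo) mu (X `&` E k) < +oo)%E.
  apply: le_lt_trans Xoo; apply: le_trans (caratheodory_lime_le mE tE X).
  by rewrite leeDl// outer_measure_ge0.
have tail : (\sum_(N <= j <oo) mu (X `&` E j))%E @[N --> \oo] --> 0%E.
  by apply: nneseries_tail_cvg => // *; exact: outer_measure_ge0.
have [N hN] : exists N, (\sum_(N <= j <oo) mu (X `&` E j) <= e%:E)%E.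
  apply: contrapT => hN.
  have : (e%:E <= 0)%E.
    rewrite -(cvg_lim _ tail)//; apply: lime_ge; first by apply/cvg_ex; exists 0%E.
    by apply: nearW => N; rewrite leNgt; apply/negP => /ltW h; apply: hN; exists N.
  by rewrite lee_fin leNgt e0.
exists N.
apply: (@le_trans _ _ (mu (X `&` \bigcap_j O j) +
    mu (\bigcup_(j in ~` `I_N) (X `&` E j)))%E); last first.
  by apply: leeD2l; apply: le_trans hN; exact: outer_measure_sigma_subadditive_tail.
apply: le_trans (outer_measureU2 mu _ _); apply: le_outer_measure.
move=> x [Xx ONx]; have [h|h] := pselect (forall j, O j x); first by left; split => // j _.
right; have /existsNP[j0 hj0] := h.
have [j /asboolP nj jmin] := ex_minnP (ex_intro (fun j => `[< ~ O j x >]) j0 (asboolT hj0)).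
have Nj : (N < j)%N by rewrite ltnNge; apply/negP => jN; apply: nj; exact: Ole ONx.
case: j nj jmin Nj => // j nj jmin Nj; exists j; first by rewrite /= ltnNge -ltnS Nj.
split => //; split => //; apply: contrapT => /asboolT /jmin; by rewrite ltnn.
Qed.

Section LocalToGlobal.
Variables (R : realType) (n n' : nat) (phi : 'rV[R]_n -> 'rV[R]_n').
Variables (M : set 'rV[R]_n) (K : R).

(** Quantifying over the open subsets of [U0] makes the property pass to smaller
    neighbourhoods. *)
Definition area_expands_le (U0 : set 'rV[R]_n) :=
  forall U, open U -> U `<=` U0 ->
    (area (phi @` (M `&` U)) <= K%:E * area (M `&` U))%E.

Hypotheses (K0 : 0 <= K) (Moo : (area M < +oo)%E).

(** A closed set is a decreasing intersection of open thickenings. *)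
Lemma area_expands_le_closed U0 U C : area_expands_le U0 -> open U ->
  U `<=` U0 -> closed C ->
  (area (phi @` (M `&` U `&` C)) <= K%:E * area (M `&` U `&` C))%E.
Proof.
move=> hU0 oU UU0 cC; apply/lee_addgt0Pr => e e0.
have e1 : 0 < e / (K + 1) by rewrite divr_gt0// ltr_wpDl.
have Xoo : (area (M `&` U) < +oo)%E.
  by apply: le_lt_trans Moo; apply: areaS => x [].
have [N hN] := @outer_measure_bigcap_le R _ (@area R n) (M `&` U)
  (thickening C) _ Xoo (fun j => caratheodory_open (@open_thickening R n C j))
  (@thickeningS R n C) e1.
rewrite bigcap_thickening// in hN.
apply: (@le_trans _ _ (K%:E * area (M `&` (U `&` thickening C N)))%E).
  apply: (@le_trans _ _ (area (phi @` (M `&` (U `&` thickening C N))))).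
    apply: areaS => _ [x [[Mx Ux] Cx] <-]; exists x => //; split => //; split => //.
    by move: Cx; rewrite -{1}(bigcap_thickening cC); exact.
  apply: hU0; last by move=> x [/UU0].
  by apply: openI => //; exact: open_thickening.
rewrite setIA; apply: le_trans (lee_wpmul2l _ hN) _; first by rewrite lee_fin.
rewrite muleDr; last 2 first.
- by [].
- by rewrite ge0_adde_def ?inE ?area_ge0// lee_fin ltW.
apply: leeD2l; rewrite -EFinM lee_fin mulrCA ler_piMr ?(ltW e0)//.
by rewrite ler_pdivrMr ?mul1r ?lerDl// ltr_wpDl.
Qed.

(** Countably many good base neighbourhoods cover the piece; made disjoint, each
    becomes the trace of an open and of a closed set. *)
Lemma area_expands_le_global U C : open U -> closed C ->
  (forall p, (M `&` U `&` C) p ->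
     exists U0, [/\ open U0, U0 p & area_expands_le U0]) ->
  (area (phi @` (M `&` U `&` C)) <= K%:E * area (M `&` U `&` C))%E.
Proof.
move=> oU cC hloc; set A := M `&` U `&` C.
pose B k := if `[< area_expands_le (@base_ball R n k) >] then @base_ball R n k else set0.
have oB k : open (B k) by rewrite /B; case: ifP => _; [exact: open_base_ball|exact: open0].
have eB k : area_expands_le (B k).
  rewrite /B; case: asboolP => // _ V oV V0.
  have -> : M `&` V = set0 by apply/seteqP; split => // x [_ /V0].
  by rewrite image_set0 !area_set0 mule0.
have AB : A `<=` \bigcup_k B k.
  move=> p Ap; have [U0 [oU0 U0p hU0]] := hloc p Ap.
  have [k kp kU0] := base_ballP oU0 U0p; exists k => //.
  by rewrite /B asboolT// => V oV Vk; apply: hU0 => //; exact: subset_trans kU0.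
pose D := seqDU B.
have mD k : (@area R n).-caratheodory (D k).
  apply: (@caratheodory_measurable_setD R _ (@area R n)); first exact: caratheodory_open.
  rewrite -(big_mkord xpredT).
  elim/big_ind : _ => [|X Y|i _].
  - exact: (@caratheodory_measurable_set0 R _ (@area R n)).
  - exact: (@caratheodory_measurable_setU R _ (@area R n)).
  - exact: caratheodory_open.
have hD k : (area (phi @` (A `&` D k)) <= K%:E * area (A `&` D k))%E.
  have -> : A `&` D k = M `&` (U `&` B k) `&` (C `&` ~` \big[setU/set0]_(i < k) B i).
    by apply/seteqP; split => [x [[[? ?] ?] [? ?]]|x [[? [? ?]] [? ?]]].
  apply: (@area_expands_le_closed (B k)) => //.
  - exact: openI.
  - apply: closedI => //; apply: open_closedC; rewrite -(big_mkord xpredT).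
    by elim/big_ind : _ => [|X Y|i _]; [exact: open0|exact: openU|exact: oB].
apply: (@le_trans _ _ (\sum_(0 <= k <oo) area (phi @` (A `&` D k)))%E).
  apply: (@le_trans _ _ (area (\bigcup_k (phi @` (A `&` D k))))).
    apply: areaS => _ [x Ax <-].
    have [k _ Dx] : (\bigcup_k D k) x by rewrite -seqDU_bigcup_eq; exact: AB.
    by exists k => //; exists x.
  exact: (outer_measure_sigma_subadditive (@area R n')).
apply: (@le_trans _ _ (\sum_(0 <= k <oo) (K%:E * area (A `&` D k)))%E).
  by apply: lee_nneseries => [*|k _]; [exact: area_ge0|exact: hD].
rewrite nneseriesZl; last by move=> *; exact: area_ge0.
apply: lee_wpmul2l; first by rewrite lee_fin.
apply: le_trans (caratheodory_lime_le mD (trivIset_seqDU B) A).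
by rewrite leeDl// area_ge0.
Qed.

End LocalToGlobal.

(** * Strict differentiability *)

Section CoordinateDerivative.
Variables (R : realType) (V : normedModType R) (n : nat).

Lemma is_derive_rV (f : V -> 'rV[R]_n) (t v : V) (df : 'rV[R]_n) :
  is_derive t v f df <-> forall i, is_derive t v (fun x => f x 0 i) (df 0 i).
Proof.
split=> [[d e] i|h].
  split; first by move/derivable_mxP: d; exact.
  by rewrite -e derive_mx// mxE.
have d : derivable f t v.
  by apply/derivable_mxP => i j; rewrite (ord1 i); exact: (@ex_derive _ _ _ _ _ _ _ (h j)).
split => //; rewrite derive_mx//; apply/rowP => i; rewrite mxE.
exact: (@derive_val _ _ _ _ _ _ _ (h i)).
Qed.

Lemma is_derive_dotp (f g : V -> 'rV[R]_n) (t v : V) (df dg : 'rV[R]_n) :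
  is_derive t v f df -> is_derive t v g dg ->
  is_derive t v (fun x => dotp (f x) (g x)) (dotp df (g t) + dotp (f t) dg).
Proof.
move=> /is_derive_rV hf /is_derive_rV hg.
have -> : (fun x => dotp (f x) (g x)) = \sum_(i < n) ((fun x => f x 0 i) * (fun x => g x 0 i)).
  by apply/funext => x; rewrite /dotp fct_sumE.
have h i := is_deriveM (hf i) (hg i).
apply: is_derive_eq; rewrite /dotp -big_split; apply: eq_bigr => i _ /=.
by rewrite addrC /GRing.scale /= (mulrC (g t 0 i)).
Qed.

End CoordinateDerivative.

Section MeanValue.
Variable R : realType.

Lemma is_derive_continuous (W : normedModType R) (f : R -> W) (t : R) (df : W) :
  is_derive t 1 f df -> {for t, continuous f}.
Proof. by move=> [d _]; apply/differentiable_continuous/derivable1_diffP. Qed.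

(** The scalar mean value theorem is applied to the component along the
    increment. *)
Lemma mean_value_enorm (n : nat) (h h' : R -> 'rV[R]_n) (w : 'rV[R]_n) (k a b : R) :
  a <= b -> (forall t, a <= t <= b -> is_derive t 1 h (h' t)) ->
  (forall t, a <= t <= b -> enorm (h' t - w) <= k) ->
  enorm (h b - h a - (b - a) *: w) <= k * (b - a).
Proof.
move=> ab hd hk; set e := h b - h a - _.
pose f t := dotp (h t - t *: w) e.
have fd t : a <= t <= b -> is_derive t 1 f (dotp (h' t - w) e).
  move=> tab; have h1 := hd t tab.
  have h2 : is_derive t 1 (fun s : R => h s - s *: w) (h' t - w).
    have h3 : is_derive t 1 (fun s : R => s *: w) w.
      apply/is_derive_rV => i; rewrite (_ : (fun x => _) = (fun x => x * w 0 i)); last first.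
        by apply/funext => s; rewrite mxE.
      by apply: is_derive_eq; rewrite ?scaler0 ?addr0 ?add0r /GRing.scale /= ?mulr1 ?mul1r.
    exact: is_deriveB.
  have h4 := is_derive_dotp h2 (is_derive_cst e t 1).
  by rewrite /f; apply: is_derive_eq; rewrite dotp0 addr0.
have [||t /[!in_itv]/= tab] := @MVT_segment R f (fun t => dotp (h' t - w) e) a b ab.
- move=> x /[!in_itv]/= /andP[? ?]; apply: fd; lra.
- apply: derivable_within_continuous => x /[!in_itv]/= xab.
  exact: (@ex_derive _ _ _ _ _ _ _ (fd x xab)).
have -> : f b - f a = enorm e ^+ 2.
  rewrite /f -dotpBl sqr_enorm; congr (dotp _ e).
  by rewrite /e scalerBl !opprB addrACA [RHS]addrAC -!addrA; congr (_ + _); rewrite addrCA.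
move=> he; have [->|e0] := eqVneq (enorm e) 0.
  have := hk a; rewrite lexx ab => /(_ isT) /(le_trans (enorm_ge0 _)) k0.
  by rewrite mulr_ge0// subr_ge0.
have {}e0 : 0 < enorm e by rewrite lt0r e0 enorm_ge0.
rewrite -(ler_pM2r e0) -expr2 he mulrAC; apply: ler_wpM2r; first by rewrite subr_ge0.
apply: le_trans (ler_norm _) _; apply: le_trans (dotp_le_enorm _ _) _.
by apply: ler_wpM2r; [exact: ltW|exact: hk].
Qed.

Lemma is_derive_comp1 (V W : normedModType R) (g : R -> V) (F : V -> W) (t : R) (dg : V) :
  is_derive t 1 g dg -> differentiable F (g t) ->
  is_derive t 1 (fun s => F (g s)) ('d F (g t) dg).
Proof.
move=> hg hF; have dfg : differentiable g t.
  by apply/derivable1_diffP; exact: (@ex_derive _ _ _ _ _ _ _ hg).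
have dFg : differentiable (F \o g) t by exact: differentiable_comp.
split; first exact: (@diff_derivable _ _ _ (F \o g)).
rewrite (@deriveE _ _ _ (F \o g))// diff_comp//=; congr ('d F (g t) _).
by rewrite -deriveE// (@derive_val _ _ _ _ _ _ _ hg).
Qed.

Lemma is_derive_segment (V : normedModType R) (z v : V) (t : R) :
  is_derive t 1 (fun s : R => z + s *: v) v.
Proof.
have h : is_derive t 1 (fun s : R => s *: v) v.
  have d : differentiable (fun s : R => s *: v) t by apply: differentiableZl.
  split; first exact: (@diff_derivable _ _ _ (fun s : R => s *: v)).
  by rewrite deriveE// diffZl//= diff_val scale1r.
by have := is_deriveD (is_derive_cst z t 1) h; rewrite add0r.
Qed.

End MeanValue.

Section StrictDifferentiability.
Variable R : realType.

(** Two-point differentiability is what the comparison of areas needs: it bounds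
    all the increments of a map near a point, and not only those from it. *)
Definition strict_diff_at (m n : nat) (F : 'rV[R]_m -> 'rV[R]_n) (x0 : 'rV[R]_m)
    (L : 'rV[R]_m -> 'rV[R]_n) :=
  forall eta, 0 < eta -> exists2 d, 0 < d & forall z z', eball x0 d z -> eball x0 d z' ->
    enorm (F z - F z' - L (z - z')) <= eta * enorm (z - z').

Lemma eball_segment (m : nat) (x0 z z' : 'rV[R]_m) (d t : R) : 0 <= t <= 1 ->
  eball x0 d z -> eball x0 d z' -> eball x0 d (z' + t *: (z - z')).
Proof.
rewrite /eball /= => /andP[t0 t1] hz hz'.
have -> : z' + t *: (z - z') - x0 = t *: (z - x0) + (1 - t) *: (z' - x0).
  by apply/rowP => i; rewrite !mxE; ring.
apply: le_lt_trans (enormD _ _) _; rewrite !enormZ !ger0_norm ?subr_ge0//.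
have [->|tn0] := eqVneq t 0; first by rewrite mul0r add0r subr0 mul1r.
have : t * enorm (z - x0) < t * d by rewrite ltr_pM2l// lt0r tn0.
have : (1 - t) * enorm (z' - x0) <= (1 - t) * d by apply: ler_wpM2l; [rewrite subr_ge0|exact: ltW].
lra.
Qed.

Lemma linear_diff_bound (m n : nat) (A B : {linear 'rV[R]_m -> 'rV[R]_n}) (et : R) v :
  (forall i, enorm (A (delta_mx 0 i) - B (delta_mx 0 i)) <= et) ->
  enorm (A v - B v) <= m%:R * et * enorm v.
Proof.
have rep (L : {linear 'rV[R]_m -> 'rV[R]_n}) : L v = \sum_(i < m) v 0 i *: L (delta_mx 0 i).
  by rewrite {1}(row_sum_delta v) linear_sum; apply: eq_bigr => i _; rewrite linearZ.
move=> h; rewrite (rep A) (rep B) -sumrB.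
apply: le_trans (enorm_sum _ _) _.
apply: (@le_trans _ _ (\sum_(i < m) enorm v * et)).
  apply: ler_sum => i _; rewrite -scalerBr enormZ.
  by apply: ler_pM => //; [exact: enorm_ge0|exact: enorm_coord].
by rewrite sumr_const card_ord -[leLHS]mulr_natl (mulrC (enorm v)) mulrA.
Qed.

(** Continuous partial derivatives make the differential nearly constant, and the
    mean value inequality applies along segments. *)
Lemma Ck_on1_strict_diff (m n : nat) (F : 'rV[R]_m -> 'rV[R]_n) (U : set 'rV[R]_m) x0 :
  open U -> U x0 -> Ck_on 1 U F -> strict_diff_at F x0 ('d F x0).
Proof.
move=> oU Ux0 [dF cF] eta eta0; have [r r0 xU] := eball_open oU Ux0.
pose et := eta / m.+1%:R; have et0 : 0 < et by rewrite divr_gt0.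
have /choice[dl hdl] (i : 'I_m) : exists d, 0 < d /\ forall y, eball x0 d y ->
    enorm ('D_(delta_mx 0 i) F y - 'D_(delta_mx 0 i) F x0) < et.
  have /enorm_cvg/(_ _ et0)/eball_nbhs[d d0 hd] := cF (delta_mx 0 i) x0 Ux0.
  by exists d.
(* A common radius for all the partial derivatives. *)
pose d := \big[Num.min/r]_(i < m) dl i.
have d0 : 0 < d by apply: lt_bigmin => // i _; have [] := hdl i.
have dr : d <= r by exact: bigmin_le_id.
have ddl i : d <= dl i by exact: bigmin_le_cond.
have inU y : eball x0 d y -> U y by move=> h; apply: xU; exact: lt_le_trans h dr.
have close y v : eball x0 d y -> enorm ('d F y v - 'd F x0 v) <= eta * enorm v.
  move=> hy; apply: le_trans (@linear_diff_bound _ _ ('d F y) ('d F x0) et v _) _.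
    move=> i; have := (hdl i).2 y (lt_le_trans hy (ddl i)).
    by rewrite (deriveE _ (dF y (inU y hy))) (deriveE _ (dF x0 Ux0)); exact: ltW.
  apply: ler_wpM2r; first exact: enorm_ge0.
  rewrite /et mulrCA ler_piMr ?(ltW eta0)// ler_pdivrMr// mul1r ler_nat; exact: leqnSn.
exists d => // z z' hz hz'.
have := @mean_value_enorm R n (fun t => F (z' + t *: (z - z')))
  (fun t => 'd F (z' + t *: (z - z')) (z - z')) ('d F x0 (z - z')) (eta * enorm (z - z')) 0 1 ler01.
rewrite subr0 mulr1 !scale1r scale0r addr0 (addrC z') subrK; apply.
  move=> t t01; apply: is_derive_comp1; first exact: is_derive_segment.
  by apply: dF; apply: inU; exact: eball_segment.
by move=> t t01; apply: close; exact: eball_segment.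
Qed.

Lemma linear_enorm_bound (m n : nat) (A : {linear 'rV[R]_m -> 'rV[R]_n}) :
  exists2 k, 0 < k & forall v, enorm (A v) <= k * enorm v.
Proof.
exists (1 + \sum_(i < m) enorm (A (delta_mx 0 i))).
  by rewrite ltr_wpDr// sumr_ge0// => i _; exact: enorm_ge0.
move=> v; rewrite {1}(row_sum_delta v) linear_sum.
apply: le_trans (enorm_sum _ _) _.
apply: (@le_trans _ _ (\sum_(i < m) enorm (A (delta_mx 0 i)) * enorm v)).
  apply: ler_sum => i _; rewrite linearZ enormZ mulrC; apply: ler_wpM2l; first exact: enorm_ge0.
  exact: enorm_coord.
by rewrite -mulr_suml; apply: ler_wpM2r; [exact: enorm_ge0|rewrite lerDr].
Qed.

Lemma strict_diff_at_comp (m n q : nat) (F : 'rV[R]_m -> 'rV[R]_n) (G : 'rV[R]_n -> 'rV[R]_q)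
    x0 (L : {linear 'rV[R]_m -> 'rV[R]_n}) (N : {linear 'rV[R]_n -> 'rV[R]_q}) :
  strict_diff_at F x0 L -> strict_diff_at G (F x0) N ->
  strict_diff_at (G \o F) x0 (N \o L).
Proof.
move=> hF hG eta eta0.
have [k k0 hk] := linear_enorm_bound L; have [l l0 hl] := linear_enorm_bound N.
have e1 : 0 < Num.min 1 (eta / (2 * l)) by rewrite lt_min ltr01 divr_gt0// mulr_gt0.
have e2 : 0 < eta / (2 * (k + 1)) by rewrite divr_gt0// mulr_gt0// addr_gt0.
have [d1 d10 h1] := hF _ e1; have [d2 d20 h2] := hG _ e2.
have lip z z' : eball x0 d1 z -> eball x0 d1 z' ->
    enorm (F z - F z') <= (k + 1) * enorm (z - z').
  move=> hz hz'; rewrite -(subrK (L (z - z')) (F z - F z')).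
  apply: le_trans (enormD _ _) _; rewrite mulrDl mul1r addrC.
  apply: lerD; [exact: hk|apply: le_trans (h1 _ _ hz hz') _].
  by rewrite ler_piMl ?enorm_ge0// ge_min lexx.
exists (Num.min d1 (d2 / (k + 1))); first by rewrite lt_min d10 divr_gt0// addr_gt0.
have k1 : 0 < k + 1 by rewrite addr_gt0.
have sub z : eball x0 (Num.min d1 (d2 / (k + 1))) z -> eball x0 d1 z /\ eball (F x0) d2 (F z).
  rewrite {1}/eball /= lt_min => /andP[z1 z2]; split=> //; rewrite /eball/=.
  apply: le_lt_trans (lip _ _ z1 (eball_center _ d10)) _.
  by rewrite mulrC -ltr_pdivlMr.
move=> z z' /sub[z1 z2] /sub[z1' z2'] /=.
have -> : G (F z) - G (F z') - N (L (z - z')) =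
    (G (F z) - G (F z') - N (F z - F z')) + N (F z - F z' - L (z - z')).
  by rewrite (linearB N (F z - F z')) addrA subrK.
apply: le_trans (enormD _ _) _.
have a1 := le_trans (h2 _ _ z2 z2') (ler_wpM2l (ltW e2) (lip _ _ z1 z1')).
have a2 := le_trans (hl _) (ler_wpM2l (ltW l0) (h1 _ _ z1 z1')).
apply: le_trans (lerD a1 a2) _; rewrite mulrA [l * _]mulrA -mulrDl.
apply: ler_wpM2r; first exact: enorm_ge0.
have -> : eta / (2 * (k + 1)) * (k + 1) = eta / 2 by field; rewrite gt_eqF.
have : l * Num.min 1 (eta / (2 * l)) <= l * (eta / (2 * l)).
  by apply: ler_wpM2l; [exact: ltW|rewrite ge_min lexx orbT].
have -> : l * (eta / (2 * l)) = eta / 2 by field; rewrite gt_eqF.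
lra.
Qed.

End StrictDifferentiability.

(** With [k] small the form is [(1 + k)] times the Gram form plus [k] times the
    identity: the cross terms are absorbed by [2 a b <= k a ^ 2 + b ^ 2 / k],
    and the second term keeps the form definite when [u] and [v] are
    dependent. *)
Lemma quad_perturb (R : realType) (La ep : R) : 0 <= La -> 0 < ep ->
  exists2 eta : R, 0 < eta & forall (n : nat) (u v : 'rV[R]_n),
    enorm u <= La -> enorm v <= La ->
    exists A B C : R, [/\ 0 < A, 0 < A * C - B ^+ 2,
      Num.sqrt (A * C - B ^+ 2) <= Num.sqrt (dotp u u * dotp v v - dotp u v ^+ 2) + ep &
      forall dx dy e, enorm e ^+ 2 <= eta ^+ 2 * (dx ^+ 2 + dy ^+ 2) ->
        enorm (dx *: u + dy *: v + e) ^+ 2 <=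
        A * dx ^+ 2 + 2 * B * dx * dy + C * dy ^+ 2].
Proof.
(* The determinant grows by at most [k * Q]. *)
move=> La0 ep0; pose Q := 3 * La ^+ 4 + 4 * La ^+ 2 + 1.
have Q0 : 0 < Q by rewrite ltr_wpDl// addr_ge0// mulr_ge0// exprn_ge0.
pose k := Num.min 1 (ep ^+ 2 / Q).
have k0 : 0 < k by rewrite lt_min ltr01 divr_gt0// exprn_gt0.
have k1 : k <= 1 by rewrite ge_min lexx.
have kQ : k * Q <= ep ^+ 2 by rewrite -ler_pdivlMr// ge_min lexx orbT.
exists (k / 2); first by rewrite divr_gt0.
move=> n u v hu hv; set uu := dotp u u; set vv := dotp v v; set uv := dotp u v.
have uu0 : 0 <= uu by exact: dotp_ge0.
have vv0 : 0 <= vv by exact: dotp_ge0.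
have uuL : uu <= La ^+ 2 by rewrite /uu -sqr_enorm ler_pXn2r ?nnegrE ?enorm_ge0.
have vvL : vv <= La ^+ 2 by rewrite /vv -sqr_enorm ler_pXn2r ?nnegrE ?enorm_ge0.
have g0 : 0 <= uu * vv - uv ^+ 2 by rewrite subr_ge0 dotp_sqr_le.
exists ((1 + k) * uu + k), ((1 + k) * uv), ((1 + k) * vv + k).
have DE : ((1 + k) * uu + k) * ((1 + k) * vv + k) - ((1 + k) * uv) ^+ 2 =
    (1 + k) ^+ 2 * (uu * vv - uv ^+ 2) + k * (1 + k) * (uu + vv) + k ^+ 2 by ring.
rewrite DE; set g := uu * vv - uv ^+ 2 in g0 *.
have gL : g <= La ^+ 4.
  apply: (@le_trans _ _ (uu * vv)); first by rewrite /g lerBlDr lerDl sqr_ge0.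
  by rewrite (_ : La ^+ 4 = La ^+ 2 * La ^+ 2) ?ler_pM// -exprD.
have D0 : 0 < (1 + k) ^+ 2 * g + k * (1 + k) * (uu + vv) + k ^+ 2.
  apply: ltr_wpDl; last exact: exprn_gt0.
  apply: addr_ge0; apply: mulr_ge0 => //; first exact: sqr_ge0.
    by rewrite mulr_ge0// ?addr_ge0// ltW.
  exact: addr_ge0.
split => //.
- by rewrite ltr_wpDl// mulr_ge0// addr_ge0// ltW.
- rewrite -(@ler_pXn2r _ 2) ?nnegrE ?sqrtr_ge0 ?addr_ge0 ?sqrtr_ge0 ?(ltW ep0)//.
  rewrite sqr_sqrtr ?(ltW D0)// [leRHS]sqrrD sqr_sqrtr//.
  have s0 : 0 <= Num.sqrt g * ep by rewrite mulr_ge0 ?sqrtr_ge0// ltW.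
  have kg : k * g <= k * La ^+ 4 by rewrite ler_pM2l.
  have k2g : k ^+ 2 * g <= k * La ^+ 4.
    apply: le_trans kg; apply: ler_wpM2r => //.
    by rewrite expr2 ler_piMl// ltW.
  have kuv : k * (1 + k) * (uu + vv) <= k * (4 * La ^+ 2).
    rewrite -mulrA; apply: ler_wpM2l; first exact: ltW.
    apply: (@le_trans _ _ (2 * (uu + vv))); last lra.
    by apply: ler_wpM2r; [rewrite addr_ge0|lra].
  have k2 : k ^+ 2 <= k by rewrite expr2 ler_piMl// ltW.
  have : (1 + k) ^+ 2 * g = g + 2 * (k * g) + k ^+ 2 * g by ring.
  rewrite /Q in kQ; nra.
- move=> dx dy e he; set w := dx *: u + dy *: v.
  have ww : enorm w ^+ 2 = uu * dx ^+ 2 + 2 * uv * dx * dy + vv * dy ^+ 2.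
    rewrite sqr_enorm /w !dotpDl !dotpDr !dotpZl !dotpZr (dotpC v u) /uu /vv /uv; ring.
  have hwe := enormD w e; have w0 := enorm_ge0 w; have e0 := enorm_ge0 e.
  have h1 : enorm (w + e) ^+ 2 <= (enorm w + enorm e) ^+ 2.
    by rewrite ler_pXn2r ?nnegrE ?enorm_ge0 ?addr_ge0.
  have h2 : 2 * enorm w * enorm e <= k * enorm w ^+ 2 + k^-1 * enorm e ^+ 2.
    have := sqr_ge0 (k * enorm w - enorm e) => h.
    rewrite -(ler_pM2l k0) mulrDr [k * (k^-1 * _)]mulrA mulfV ?gt_eqF// mul1r.
    move: h; set a := enorm w; set b := enorm e; nra.
  have h3 : (1 + k^-1) * enorm e ^+ 2 <= k * (dx ^+ 2 + dy ^+ 2).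
    apply: le_trans (ler_wpM2l _ he) _; first by rewrite addr_ge0// invr_ge0 ltW.
    rewrite mulrA; apply: ler_wpM2r; first by rewrite addr_ge0// sqr_ge0.
    rewrite (_ : (1 + k^-1) * (k / 2) ^+ 2 = (k ^+ 2 + k) / 4); last by field; rewrite gt_eqF.
    have : k ^+ 2 <= k by rewrite expr2 ler_piMl// ltW.
    lra.
  apply: le_trans h1 _; rewrite sqrrD.
  have -> : ((1 + k) * uu + k) * dx ^+ 2 + 2 * ((1 + k) * uv) * dx * dy +
      ((1 + k) * vv + k) * dy ^+ 2 = (1 + k) * enorm w ^+ 2 + k * (dx ^+ 2 + dy ^+ 2).
    by rewrite ww; ring.
  by move: h2 h3; rewrite !mulrDl !mul1r mulr2n; lra.
Qed.

(** * Dyadic squares in a plane domain *)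

Section Dyadic.
Variable R : realType.

Definition dyadic_square (t : nat * (nat * nat)) : set 'rV[R]_2 :=
  let s := 2 ^- t.1 in rect (t.2.1%:R * s) (t.2.2%:R * s) s s.

Lemma natr_mulSr (i : nat) (s : R) : i%:R * s + s = i.+1%:R * s.
Proof. by rewrite -natr1 mulrDl mul1r. Qed.

Lemma dyadic_cell (m : nat) (x : R) : 0 <= x ->
  let i := Num.truncn (x * 2 ^+ m) in
  i%:R * 2 ^- m <= x <= i%:R * 2 ^- m + 2 ^- m.
Proof.
move=> x0; have s0 : 0 < 2 ^+ m :> R by rewrite exprn_gt0.
have /andP[] := truncn_itv (mulr_ge0 x0 (ltW s0)).
set i := Num.truncn _ => h1 h2 /=; rewrite ler_pdivrMr// h1/=.
by rewrite natr_mulSr ler_pdivlMr// ltW.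
Qed.

(** So the dyadic squares around a point are nested. *)
Lemma dyadic_parent (m : nat) (x : R) : 0 <= x ->
  Num.truncn (x * 2 ^+ m) = (Num.truncn (x * 2 ^+ m.+1))./2.
Proof.
move=> x0; set k := Num.truncn (x * 2 ^+ m.+1).
have s0 : 0 < 2 ^+ m :> R by rewrite exprn_gt0.
have xm : 0 <= x * 2 ^+ m.+1 by rewrite mulr_ge0// exprn_ge0.
have /andP[h1 h2] := truncn_itv xm; rewrite -/k in h1 h2.
apply: truncn_def; apply/andP; split.
  have : (k./2 * 2)%:R <= k%:R :> R by rewrite ler_nat; lia.
  rewrite natrM => h; have := le_trans h h1; rewrite exprSr mulrA; lra.
have : k.+1%:R <= (k./2.+1 * 2)%:R :> R by rewrite ler_nat; lia.
rewrite natrM => h; have := lt_le_trans h2 h; rewrite exprSr mulrA; lra.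
Qed.

Lemma dyadic_nested (m m' i i' : nat) : (m <= m')%N ->
  (i * 2 ^ (m' - m) <= i' < i.+1 * 2 ^ (m' - m))%N ->
  i%:R * 2 ^- m <= i'%:R * 2 ^- m' :> R /\
  i'%:R * 2 ^- m' + 2 ^- m' <= i%:R * 2 ^- m + 2 ^- m :> R.
Proof.
move=> mm /andP[h1 h2].
have e : 2 ^- m = (2 ^ (m' - m))%:R * 2 ^- m' :> R.
  rewrite natrX -{2}(subnK mm) exprD invfM mulrA mulfV ?mul1r// expf_neq0.
have s0 : 0 < 2 ^- m' :> R by rewrite invr_gt0 exprn_gt0.
split.
  by rewrite e mulrA -natrM ler_pM2r// ler_nat.
by rewrite !natr_mulSr e mulrA -natrM ler_pM2r// ler_nat.
Qed.

Lemma dyadic_disjoint (m m' i i' : nat) : (m <= m')%N ->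
  ~~ (i * 2 ^ (m' - m) <= i' < i.+1 * 2 ^ (m' - m))%N ->
  i'%:R * 2 ^- m' + 2 ^- m' <= i%:R * 2 ^- m :> R \/
  i%:R * 2 ^- m + 2 ^- m <= i'%:R * 2 ^- m' :> R.
Proof.
move=> mm h.
have e : 2 ^- m = (2 ^ (m' - m))%:R * 2 ^- m' :> R.
  rewrite natrX -{2}(subnK mm) exprD invfM mulrA mulfV ?mul1r// expf_neq0.
have s0 : 0 < 2 ^- m' :> R by rewrite invr_gt0 exprn_gt0.
move: h; rewrite negb_and -ltnNge -leqNgt => /orP[h|h]; [left|right].
  by rewrite natr_mulSr e mulrA -natrM ler_pM2r// ler_nat.
by rewrite natr_mulSr e mulrA -natrM ler_pM2r// ler_nat.
Qed.

Definition apart (t t' : nat * (nat * nat)) :=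
  let s := 2 ^- t.1 : R in let s' := 2 ^- t'.1 : R in
  [\/ t.2.1%:R * s + s <= t'.2.1%:R * s', t'.2.1%:R * s' + s' <= t.2.1%:R * s,
      t.2.2%:R * s + s <= t'.2.2%:R * s' | t'.2.2%:R * s' + s' <= t.2.2%:R * s].

Lemma apart_sym t t' : apart t t' -> apart t' t.
Proof. by case=> h; [apply: Or42|apply: Or41|apply: Or44|apply: Or43]. Qed.

(** The parent of a square in the grid of size [2 ^- m.+1] is found by halving
    its indices. *)
Definition maximal_dyadic (O : set 'rV[R]_2) (t : nat * (nat * nat)) :=
  dyadic_square t `<=` O /\
  if t.1 is m.+1 then ~ (dyadic_square (m, (t.2.1./2, t.2.2./2)) `<=` O) else True.

(** Two dyadic squares with overlapping interiors are nested, and then the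
    parent of the smaller one is contained in the larger one. *)
Lemma maximal_dyadic_apart O t t' : maximal_dyadic O t -> maximal_dyadic O t' ->
  t <> t' -> apart t t'.
Proof.
move=> h h' tt'; wlog mm : t t' h h' tt' / (t.1 <= t'.1)%N.
  move=> W; have [?|/ltnW ?] := leqP t.1 t'.1; first exact: W.
  by apply: apart_sym; apply: W => // e; apply: tt'.
move: t t' => [m [i j]] [m' [i' j']] /= in h h' tt' mm *.
have [bi|bi] := boolP (i * 2 ^ (m' - m) <= i' < i.+1 * 2 ^ (m' - m))%N; last first.
  by have [?|?] := dyadic_disjoint mm bi; [apply: Or42|apply: Or41].
have [bj|bj] := boolP (j * 2 ^ (m' - m) <= j' < j.+1 * 2 ^ (m' - m))%N; last first.
  by have [?|?] := dyadic_disjoint mm bj; [apply: Or44|apply: Or43].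
exfalso; have [em|nm] := eqVneq m m'.
  apply: tt'; rewrite em subnn !expn0 !muln1 in bi bj *.
  by congr (_, (_, _)); lia.
have {nm} mm' : (m < m')%N by rewrite ltn_neqAle nm mm.
case: m' mm' bi bj h' {mm tt'} => // m' mm'; rewrite ltnS in mm'.
rewrite subSn// expnS => bi bj [_ /=]; apply.
have nest a a' : (a * (2 * 2 ^ (m' - m)) <= a' < a.+1 * (2 * 2 ^ (m' - m)))%N ->
  (a * 2 ^ (m' - m) <= a'./2 < a.+1 * 2 ^ (m' - m))%N by move: (2 ^ _)%N => p; nia.
have [x1 x2] := dyadic_nested mm' (nest _ _ bi).
have [y1 y2] := dyadic_nested mm' (nest _ _ bj).
apply: subset_trans h.1 => z [/andP[z1 z2] /andP[z3 z4]].
by split; rewrite /=; apply/andP; split; move: x1 x2 y1 y2 z1 z2 z3 z4 => /=; lra.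
Qed.

(** The coarsest dyadic square around the point that fits in the set.  The
    coordinates are assumed non-negative because dyadic indices are natural
    numbers. *)
Lemma maximal_dyadic_cover (O : set 'rV[R]_2) z : open O ->
  (forall z, O z -> 0 <= z 0 0 /\ 0 <= z 0 1) -> O z ->
  exists2 t, maximal_dyadic O t & dyadic_square t z.
Proof.
move=> oO Opos Oz; have [z0 z1] := Opos z Oz.
have [r r0 zr] := eball_open oO Oz.
pose T m := (m, (Num.truncn (z 0 0 * 2 ^+ m), Num.truncn (z 0 1 * 2 ^+ m))).
have Tz m : dyadic_square (T m) z by split; exact: dyadic_cell.
have [m0 hm0] : exists m, dyadic_square (T m) `<=` O.
  have /ltr_add_invr[m] : 0 < r / 2 by rewrite divr_gt0.
  rewrite add0r => hm; exists m => y Ty; apply: zr; rewrite /eball/=.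
  have s0 : 0 < 2 ^- m :> R by rewrite invr_gt0 exprn_gt0.
  have := le_trans (enorm_le_ediam Ty (Tz m)) (ediam_rect _ _ (ltW s0)).
  rewrite lee_fin => /le_lt_trans; apply.
  rewrite mulrC -ltr_pdivlMr//; apply: le_lt_trans hm.
  rewrite lef_pV2 ?posrE ?exprn_gt0// -natrX ler_nat; exact: ltn_expl.
have [m /asboolP hm mmin] := ex_minnP (ex_intro (fun m => `[< dyadic_square (T m) `<=` O >]) m0 (asboolT hm0)).
exists (T m) => //; split => //=; case: m hm mmin => // m hm mmin.
rewrite -!dyadic_parent// => hp.
by have := mmin m (asboolT hp); rewrite ltnn.
Qed.

End Dyadic.

Section AreaCompare.
Variables (R : realType) (n n' : nat).
Let c : R := fine (unit_square_area R).

(** An expanding map has a Lipschitz inverse. *)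
Lemma area_expand (m : nat) (F : 'rV[R]_m -> 'rV[R]_n) (A : set 'rV[R]_m) (l : R) :
  0 < l -> (forall z z', A z -> A z' -> enorm (z - z') <= l * enorm (F z - F z')) ->
  (area A <= (l ^+ 2)%:E * area (F @` A))%E.
Proof.
move=> l0 hF; pose H y := xget 0 [set z | A z /\ F z = y].
have HF z : A z -> H (F z) = z.
  move=> Az; rewrite /H; case: xgetP => [z' _ [Az' e]|/(_ z)[]//].
  have := hF _ _ Az' Az; rewrite e subrr enorm0 mulr0 => h.
  have : enorm (z' - z) == 0 by rewrite eq_le h enorm_ge0.
  by rewrite enorm_eq0 subr_eq0 => /eqP.
apply: le_trans (@area_lip _ _ _ H (F @` A) l l0 _).
  by apply: areaS => z Az; exists (F z); [exists z|exact: HF].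
by move=> _ _ [z Az <-] [z' Az' <-]; rewrite !HF//; exact: hF.
Qed.

Lemma area_separated_sum (A : nat -> set 'rV[R]_n) (N : nat) :
  (forall i j, (i < j)%N -> exists2 r : R, 0 < r &
     forall x y, A i x -> A j y -> r <= enorm (x - y)) ->
  (\sum_(i < N) area (A i) <= area (\big[setU/set0]_(i < N) A i))%E.
Proof.
move=> sep; elim: N => [|N IH]; first by rewrite !big_ord0 area_set0.
rewrite !big_ord_recr /=; apply: le_trans (leeD2r _ IH) _.
have /choice[r hr] (i : 'I_N) : exists r : R, 0 < r /\
    forall x y, A i x -> A N y -> r <= enorm (x - y).
  by have [r r0 hr] := sep i N (ltn_ord i); exists r.
pose d := \big[Num.min/1]_(i < N) r i.
have d0 : 0 < d by apply: lt_bigmin => // i _; have [] := hr i.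
apply: (area_separated d0) => x y; rewrite -bigcup_mkord => -[i /= iN Aix] ANy.
have [_ h] := hr (Ordinal iN); apply: le_trans (h x y Aix ANy).
exact: bigmin_le_cond.
Qed.

(** Both areas are compared with the sum of the areas of the maximal dyadic
    squares: by subadditivity for [G], and for [F] because the images of the
    slightly shrunk squares are separated. *)
Lemma area_compare (O : set 'rV[R]_2) (F : 'rV[R]_2 -> 'rV[R]_n)
    (G : 'rV[R]_2 -> 'rV[R]_n') (l A B C : R) :
  open O -> (forall z, O z -> 0 <= z 0 0 /\ 0 <= z 0 1) ->
  0 < l -> 0 < A -> 0 < A * C - B ^+ 2 ->
  (forall z z', O z -> O z' -> enorm (z - z') <= l * enorm (F z - F z')) ->
  (forall z z', O z -> O z' -> enorm (G z - G z') ^+ 2 <=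
     A * (z 0 0 - z' 0 0) ^+ 2 + 2 * B * (z 0 0 - z' 0 0) * (z 0 1 - z' 0 1)
     + C * (z 0 1 - z' 0 1) ^+ 2) ->
  (area (G @` O) <= (Num.sqrt (A * C - B ^+ 2) * l ^+ 2)%:E * area (F @` O))%E.
Proof.
move=> oO Opos l0 A0 D0 hF hG; set D := Num.sqrt _.
have D0' : 0 < D by rewrite sqrtr_gt0.
have [->|] := eqVneq (area (F @` O)) +oo%E.
  by rewrite gt0_muley ?leey// lte_fin mulr_gt0// exprn_gt0.
move=> Foo; have fF : area (F @` O) \is a fin_num.
  by rewrite ge0_fin_numE ?area_ge0// ltey.
pose S (k : nat) := if @pickle_inv (nat * (nat * nat))%type k is Some t
  then if `[< maximal_dyadic O t >] then Some t else None else None.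
have SM k t : S k = Some t -> maximal_dyadic O t.
  by rewrite /S; case: pickle_inv => // t'; case: asboolP => // h [<-].
have SE t : maximal_dyadic O t -> S (pickle t) = Some t.
  by move=> h; rewrite /S pickleK_inv asboolT.
have Sinj k t : S k = Some t -> pickle t = k.
  rewrite /S; have := @pickle_invK (nat * (nat * nat))%type k.
  by case: pickle_inv => // t'; case: asboolP => // h /= <- [<-].
pose sq (k : nat) : R := if S k is Some t then (2 ^- t.1) ^+ 2 else 0.
pose Q (k : nat) := if S k is Some t then @dyadic_square R t else set0.
have sq0 k : 0 <= sq k by rewrite /sq; case: (S k) => // t; rewrite sqr_ge0.
have s0 m : 0 < 2 ^- m :> R by rewrite invr_gt0 exprn_gt0.
have up : (area (G @` O) <= \sum_(0 <= k <oo) (c * D * sq k)%:E)%E.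
  apply: (@le_trans _ _ (\sum_(0 <= k <oo) area (G @` Q k))%E).
    apply: le_trans (outer_measure_sigma_subadditive (@area R n') _).
    apply: areaS => _ [z Oz <-]; have [t Mt tz] := maximal_dyadic_cover oO Opos Oz.
    by exists (pickle t) => //; exists z => //; rewrite /Q SE.
  apply: lee_nneseries => [*|k _]; first exact: area_ge0.
  rewrite /Q /sq; case E : (S k) => [t|]; last by rewrite image_set0 area_set0 mulr0.
  have [tO _] := SM _ _ E; rewrite expr2 mulrA.
  have inO x y : t.2.1%:R * 2 ^- t.1 <= x <= t.2.1%:R * 2 ^- t.1 + 2 ^- t.1 ->
      t.2.2%:R * 2 ^- t.1 <= y <= t.2.2%:R * 2 ^- t.1 + 2 ^- t.1 -> O (pt x y).
    by move=> hx hy; apply: tO; rewrite /dyadic_square /rect /= pt0 pt1.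
  apply: le_trans (@area_quad R n' (fun x y => G (pt x y)) A B C
    (t.2.1%:R * 2 ^- t.1) (t.2.2%:R * 2 ^- t.1) _ _ A0 D0
    (ltW (s0 t.1)) (ltW (s0 t.1)) _).
    apply: areaS => _ [z [z1 z2] <-]; by exists (z 0 0, z 0 1); [split|rewrite /= ptE].
  move=> x y x' y' hx hy hx' hy'; have := hG _ _ (inO _ _ hx hy) (inO _ _ hx' hy').
  by rewrite !pt0 !pt1.
apply: le_trans up _.
have low N : \sum_(k < N) c * sq k <= l ^+ 2 * fine (area (F @` O)).
  set X := \sum_(k < N) _; set Y := _ * fine _.
  have Y0 : 0 <= Y by rewrite mulr_ge0 ?sqr_ge0// fine_ge0// area_ge0.
  (* The squares shrunk by the factor [th] have separated images. *)
  have key (th : R) : 0 < th < 1 -> th ^+ 2 * X <= Y.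
    move=> /andP[th0 th1].
    have [u u0 thu] : exists2 u : R, 0 < u & th = 1 - 2 * u by exists ((1 - th) / 2); lra.
    have thM s : th * s = s - 2 * (u * s) by rewrite thu; ring.
    pose Q' (k : nat) := if S k is Some t then
      rect (t.2.1%:R * 2 ^- t.1 + u * 2 ^- t.1) (t.2.2%:R * 2 ^- t.1 + u * 2 ^- t.1)
        (th * 2 ^- t.1) (th * 2 ^- t.1) else set0.
    have Q'O k : Q' k `<=` O.
      rewrite /Q'; case E : (S k) => [t|]; last exact: sub0set.
      have [tO _] := SM _ _ E; apply: subset_trans tO.
      have us : 0 < u * 2 ^- t.1 by rewrite mulr_gt0.
      move=> z [/andP[z1 z2] /andP[z3 z4]].
      rewrite !thM in z2 z4.
      by split; apply/andP; split=> /=; move: z1 z2 z3 z4 us;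
        set s := 2 ^- _; set us := u * s; lra.
    have sep i j : (i < j)%N -> exists2 r : R, 0 < r &
        forall x y, (F @` Q' i) x -> (F @` Q' j) y -> r <= enorm (x - y).
      move=> ij; rewrite /Q'.
      case Ei : (S i) => [t|]; last by exists 1 => // x y [? []].
      case Ej : (S j) => [t'|]; last by exists 1 => // x y _ [? []].
      have tt' : t <> t'.
        by move=> e; move: ij; rewrite -(Sinj _ _ Ei) -(Sinj _ _ Ej) e ltnn.
      have ap := maximal_dyadic_apart (SM _ _ Ei) (SM _ _ Ej) tt'.
      exists (l^-1 * (u * 2 ^- t.1 + u * 2 ^- t'.1)).
        by rewrite mulr_gt0 ?invr_gt0// addr_gt0// mulr_gt0.
      move=> _ _ [z zt <-] [z' zt' <-]; rewrite ler_pdivrMl//.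
      have Oz : O z by apply: (Q'O i); rewrite /Q' Ei.
      have Oz' : O z' by apply: (Q'O j); rewrite /Q' Ej.
      apply: le_trans (hF _ _ Oz Oz').
      have h0 := enorm_coord (z - z') 0; have h1 := enorm_coord (z - z') 1.
      rewrite !mxE in h0 h1.
      move: zt zt' => [/andP[z1 z2] /andP[z3 z4]] [/andP[z1' z2'] /andP[z3' z4']].
      have us : 0 < u * 2 ^- t.1 by rewrite mulr_gt0.
      have us' : 0 < u * 2 ^- t'.1 by rewrite mulr_gt0.
      rewrite !thM in z2 z4 z2' z4'.
      have {h0} [h0 h0'] : z 0 0 - z' 0 0 <= enorm (z - z') /\ z' 0 0 - z 0 0 <= enorm (z - z').
        by move: h0; rewrite ler_norml => /andP[]; lra.
      have {h1} [h1 h1'] : z 0 1 - z' 0 1 <= enorm (z - z') /\ z' 0 1 - z 0 1 <= enorm (z - z').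
        by move: h1; rewrite ler_norml => /andP[]; lra.
      move: ap; rewrite /apart /=.
      move: z1 z2 z3 z4 z1' z2' z3' z4' h0 h0' h1 h1'.
      move: (enorm _) (t.2.1%:R * _) (t.2.2%:R * _) (t'.2.1%:R * _) (t'.2.2%:R * _).
      move: (2 ^- t.1) (2 ^- t'.1) us us' (z 0 0) (z 0 1) (z' 0 0) (z' 0 1).
      move=> s s' + + x y x' y' e a b a' b'; move: (u * s) (u * s') => v v' v0 v0'.
      by move=> ? ? ? ? ? ? ? ? ? ? ? ? []; lra.
    have := area_separated_sum N sep.
    have : (area (\big[setU/set0]_(i < N) (F @` Q' i)) <= area (F @` O))%E.
      apply: areaS; rewrite -(bigcup_mkord N (fun i => F @` Q' i)) => _ [k _ [z Qz <-]].
      by exists z => //; exact: Q'O Qz.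
    move=> h1 h2; have h3 := le_trans h2 h1.
    have YE : (Y%:E = (l ^+ 2)%:E * area (F @` O))%E by rewrite /Y EFinM fineK.
    rewrite -lee_fin YE.
    apply: le_trans (lee_wpmul2l _ h3); last by rewrite lee_fin sqr_ge0.
    rewrite ge0_sume_distrr; last by move=> *; exact: area_ge0.
    rewrite /X mulr_sumr -sumEFin; apply: lee_sum => k _.
    apply: le_trans (@area_expand _ F (Q' k) l l0 _); last first.
      by move=> z z' /Q'O Oz /Q'O Oz'; exact: hF.
    rewrite /sq /Q'; case: (S k) => [t|]; last by rewrite !mulr0 area_set0.
    have -> : th ^+ 2 * (c * 2 ^- t.1 ^+ 2) = c * (th * 2 ^- t.1) ^+ 2 by rewrite exprMn mulrCA.
    by apply: area_square_ge; rewrite mulr_gt0.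
  rewrite leNgt; apply/negP => YX.
  have X0 : 0 < X by exact: le_lt_trans YX.
  pose r := Y / X; have r1 : r < 1 by rewrite ltr_pdivrMr// mul1r.
  have r0 : 0 <= r by rewrite divr_ge0// ltW.
  have := key ((1 + r) / 2) ltac:(apply/andP; split; lra).
  have -> : Y = r * X by rewrite divfK// gt_eqF.
  rewrite ler_pM2r//; nra.
apply: lime_le; first by apply: is_cvg_nneseries => k _ _; rewrite lee_fin !mulr_ge0 ?unit_square_area_ge0// ltW.
apply: nearW => N; rewrite sumEFin -[in leRHS](fineK fF) -EFinM lee_fin big_mkord.
have -> : \sum_(k < N) c * D * sq k = D * \sum_(k < N) c * sq k.
  by rewrite mulr_sumr; apply: eq_bigr => k _; rewrite mulrCA mulrA.
by rewrite -mulrA; apply: ler_wpM2l; [exact: ltW|exact: low].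
Qed.

End AreaCompare.

(** * Surfaces in nearly isometric charts *)

Lemma Ck_on_continuous (R : realType) (V W : normedModType R) (k : nat) (U : set V)
    (f : V -> W) : Ck_on k U f -> Ck_on 0 U f.
Proof. by case: k => // k [df _] x Ux; exact/differentiable_continuous/df. Qed.

Lemma Ck_onS1 (R : realType) (V W : normedModType R) (k : nat) (U : set V)
    (f : V -> W) : Ck_on k.+1 U f -> Ck_on 1 U f.
Proof. by move=> [df cf]; split => // v; exact: Ck_on_continuous (cf v). Qed.

Section OrthonormalFrame.
Variables (R : realType) (n : nat) (E : {linear 'rV[R]_2 -> 'rV[R]_n}).
Hypothesis injE : injective E.

(** The Gram-Schmidt process in the plane, for the inner product pulled back
    by [E]. *)
Lemma isometric_frame : exists w1 w2 : 'rV[R]_2,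
  [/\ dotp (E w1) (E w1) = 1, dotp (E w2) (E w2) = 1, dotp (E w1) (E w2) = 0 &
    forall v, exists x y, v = x *: w1 + y *: w2].
Proof.
have E0 v : v != 0 -> 0 < enorm (E v).
  by move=> v0; rewrite enorm_gt0; apply: contra_neq v0 => h; apply: injE; rewrite h linear0.
pose e1 := pt 1 0 : 'rV[R]_2; pose e2 := pt 0 1 : 'rV[R]_2.
have a0 : 0 < enorm (E e1).
  by apply: E0; apply/eqP => /(congr1 (fun z : 'rV_2 => z 0 0)); rewrite pt0 mxE; exact/eqP/oner_neq0.
pose w1 := (enorm (E e1))^-1 *: e1.
have u11 : dotp (E w1) (E w1) = 1.
  by rewrite -sqr_enorm linearZ enormZ gtr0_norm ?invr_gt0// mulVf ?gt_eqF// expr1n.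
pose k := dotp (E e2) (E w1); pose b := e2 - k *: w1.
have b0 : 0 < enorm (E b).
  apply: E0; apply/eqP => /(congr1 (fun z : 'rV_2 => z 0 1)).
  by rewrite !mxE /= !mulr0 subr0; exact/eqP/oner_neq0.
have bu : dotp (E b) (E w1) = 0 by rewrite linearB linearZ dotpBl dotpZl u11 mulr1 subrr.
exists w1, ((enorm (E b))^-1 *: b); split => //.
- by rewrite -sqr_enorm linearZ enormZ gtr0_norm ?invr_gt0// mulVf ?gt_eqF// expr1n.
- have -> : E ((enorm (E b))^-1 *: b) = (enorm (E b))^-1 *: E b by rewrite linearZ.
  by rewrite dotpZr dotpC bu mulr0.
move=> v; exists (v 0 0 * enorm (E e1) + v 0 1 * k), (v 0 1 * enorm (E b)).
have -> : (v 0 1 * enorm (E b)) *: ((enorm (E b))^-1 *: b) = v 0 1 *: b.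
  by rewrite scalerA mulfK ?gt_eqF.
rewrite /b scalerDl.
have -> : (v 0 0 * enorm (E e1)) *: w1 = v 0 0 *: e1.
  by rewrite /w1 scalerA mulfK ?gt_eqF.
transitivity (v 0 0 *: e1 + v 0 1 *: e2); last first.
  by apply/rowP => i; rewrite !mxE; ring.
rewrite -[LHS]ptE.
by apply/rowP => i; rewrite !mxE; case: ifP => _; rewrite ?mulr0 ?mulr1 ?addr0 ?add0r.
Qed.

End OrthonormalFrame.

Section Chart.
Variables (R : realType) (n n' k : nat) (M : set 'rV[R]_n).
Variables (phi : 'rV[R]_n -> 'rV[R]_n') (p : 'rV[R]_n).
Variables (L : {linear 'rV[R]_n -> 'rV[R]_n'}) (J K : R).
Hypotheses (hM : embedded_surface k.+1 M) (Mp : M p).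
Hypotheses (phiL : strict_diff_at phi p L) (J0 : 0 <= J) (JK : J < K).
Hypothesis gramL : forall u v, dotp u u = 1 -> dotp v v = 1 -> dotp u v = 0 ->
  dotp (L u) (L u) * dotp (L v) (L v) - dotp (L u) (L v) ^+ 2 <= J ^+ 2.

(** In a chart whose differential at [p] is an isometry, a small neighbourhood
    of [p] in the surface is nearly isometric to a plane domain, and the map is
    nearly linear on it. *)
Lemma embedded_area_expands_le :
  exists U0, [/\ open U0, U0 p & area_expands_le phi M K U0].
Proof.
have [W [V [f [g [[oW Wp] oV fV [cf injf] [gf cg]]]]]] := hM Mp.
have [x0 Vx0 fx0] : (f @` V) p by rewrite fV.
pose E : {linear 'rV[R]_2 -> 'rV[R]_n} := 'd f x0.
have injE : injective E by exact: injf.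
have sf : strict_diff_at f x0 E := Ck_on1_strict_diff oV Vx0 (Ck_onS1 cf).
have sphif : strict_diff_at (phi \o f) x0 (L \o E).
  by apply: strict_diff_at_comp => //; rewrite fx0.
move: E injE sf sphif => E injE sf sphif {cf injf}.
have [w1 [w2 [u11 u22 u12 wspan]]] := isometric_frame injE.
pose T (z : 'rV[R]_2) := z 0 0 *: w1 + z 0 1 *: w2.
have TB z z' : T (z - z') = T z - T z'.
  by rewrite /T !mxE !scalerBl opprD addrACA.
pose tau := enorm w1 + enorm w2 + 1.
have tau0 : 0 < tau by rewrite ltr_wpDl// addr_ge0 ?enorm_ge0.
have Tle z : enorm (T z) <= tau * enorm z.
  apply: le_trans (enormD _ _) _; rewrite !enormZ /tau mulrDl mul1r mulrDl.
  apply: (@le_trans _ _ (enorm w1 * enorm z + enorm w2 * enorm z)); last by rewrite lerDl enorm_ge0.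
  by apply: lerD; rewrite mulrC; apply: ler_wpM2l; rewrite ?enorm_ge0 ?enorm_coord.
have ETE z : E (T z) = z 0 0 *: E w1 + z 0 1 *: E w2 by rewrite /T linearD !linearZ.
have ETn z : enorm (E (T z)) = enorm z.
  rewrite /enorm ETE !dotpDl !dotpDr !dotpZl !dotpZr u11 u22 (dotpC (E w2)) u12 dotp2.
  by congr (Num.sqrt _); ring.
(* The chart is centred at [o], so that its domain has positive coordinates. *)
pose o : 'rV[R]_2 := pt 1 1.
pose H z := f (x0 + T (z - o)).
pose ep := (K - J) / 2; have ep0 : 0 < ep by rewrite divr_gt0// subr_gt0.
have Jep : 0 < J + ep by rewrite ltr_wpDl.
have K0 : 0 < K by exact: le_lt_trans JK.
pose La := enorm (L (E w1)) + enorm (L (E w2)).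
have [|eta eta0 hquad] := @quad_perturb R La ep _ ep0; first by rewrite addr_ge0 ?enorm_ge0.
have [||A [B [C [A0 D0 sD hq]]]] := hquad n' (L (E w1)) (L (E w2)).
- by rewrite lerDl enorm_ge0.
- by rewrite lerDr enorm_ge0.
have {}sD : Num.sqrt (A * C - B ^+ 2) <= J + ep.
  apply: le_trans sD _; rewrite lerD2r -(@ler_pXn2r _ 2) ?nnegrE ?sqrtr_ge0//.
  by rewrite sqr_sqrtr ?gramL// subr_ge0 dotp_sqr_le.
(* The distortion [th] of the chart must satisfy [J + ep <= K * (1 - th) ^+ 2]. *)
pose th := (1 - (J + ep) / K) / 2.
have JepK : J + ep < K by rewrite /ep; have := JK; lra.
have th0 : 0 < th by rewrite divr_gt0// subr_gt0 ltr_pdivrMr// mul1r.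
have th1 : th < 1.
  have : 0 <= (J + ep) / K by rewrite divr_ge0// ltW.
  by rewrite /th; lra.
have thK : (J + ep) <= K * (1 - th) ^+ 2.
  have -> : J + ep = K * ((J + ep) / K) by rewrite mulrCA mulfV ?gt_eqF// mulr1.
  have -> : (J + ep) / K = 1 - 2 * th by rewrite /th; field; rewrite gt_eqF.
  by apply: ler_wpM2l; [exact: ltW|have := sqr_ge0 th; nra].
have [d1 d10 h1] := sf _ (divr_gt0 th0 tau0).
have [d2 d20 h2] := sphif _ (divr_gt0 eta0 tau0).
have [d3 d30 h3] := eball_open oV Vx0.
pose d := Num.min d1 (Num.min d2 d3); have d0 : 0 < d by rewrite !lt_min d10 d20.
pose r := Num.min 1 (d / tau); have r0 : 0 < r by rewrite lt_min ltr01 divr_gt0.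
have inb z : eball o r z -> eball x0 d (x0 + T (z - o)).
  rewrite /eball /= => zr; rewrite addrAC subrr add0r.
  apply: le_lt_trans (Tle _) _; rewrite mulrC -ltr_pdivlMr//.
  by apply: lt_le_trans zr _; rewrite ge_min lexx orbT.
have subd z e : d <= e -> eball x0 d z -> eball x0 e z.
  by move=> de; rewrite /eball/= => h; exact: lt_le_trans h de.
have dd1 : d <= d1 by rewrite ge_min lexx.
have dd2 : d <= d2 by rewrite !ge_min lexx orbT.
have dd3 : d <= d3 by rewrite !ge_min lexx !orbT.
have dT z z' : x0 + T (z - o) - (x0 + T (z' - o)) = T (z - z').
  by rewrite opprD addrACA subrr add0r -TB opprB addrA subrK.
have tauK (a : R) z : a / tau * enorm (T z) <= a * enorm z \/ a < 0.
  have [a0|] := leP 0 a; last by right.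
  left; apply: le_trans (ler_wpM2l (divr_ge0 a0 (ltW tau0)) (Tle z)) _.
  by rewrite mulrA divfK ?gt_eqF.
have Hlow z z' : eball o r z -> eball o r z' ->
    enorm (z - z') <= (1 - th)^-1 * enorm (H z - H z').
  move=> /inb/(subd _ _ dd1) hz /inb/(subd _ _ dd1) hz'.
  rewrite ler_pdivlMl ?subr_gt0//.
  have := h1 _ _ hz hz'; rewrite dT.
  have [b|] := tauK th (z - z'); last by rewrite ltNge ltW.
  move=> /le_trans/(_ b) hh.
  rewrite -/(H z) -/(H z') in hh.
  have := enormB (H z - H z') (H z - H z' - E (T (z - z'))).
  rewrite subKr ETn mulrBl mul1r; lra.
have Hup z z' : eball o r z -> eball o r z' -> enorm (H z - H z') <= 2 * enorm (z - z').
  move=> /inb/(subd _ _ dd1) hz /inb/(subd _ _ dd1) hz'.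
  have := h1 _ _ hz hz'; rewrite dT.
  have [b|] := tauK th (z - z'); last by rewrite ltNge ltW.
  move=> /le_trans/(_ b) hh.
  have := enormD (H z - H z' - E (T (z - z'))) (E (T (z - z'))).
  rewrite subrK ETn.
  have : th * enorm (z - z') <= enorm (z - z') by rewrite ler_piMl ?enorm_ge0// ltW.
  by rewrite /H in hh *; lra.
have Gq z z' : eball o r z -> eball o r z' ->
    enorm (phi (H z) - phi (H z')) ^+ 2 <=
    A * (z 0 0 - z' 0 0) ^+ 2 + 2 * B * (z 0 0 - z' 0 0) * (z 0 1 - z' 0 1)
    + C * (z 0 1 - z' 0 1) ^+ 2.
  move=> /inb/(subd _ _ dd2) hz /inb/(subd _ _ dd2) hz'.
  have := h2 _ _ hz hz'; rewrite dT /=.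
  have [b|] := tauK eta (z - z'); last by rewrite ltNge ltW.
  move=> /le_trans/(_ b); rewrite ETE linearD !linearZ !mxE -/(H z) -/(H z').
  set v := _ *: _ + _ *: _ => hh.
  rewrite -(subrK v (phi (H z) - phi (H z'))) addrC; apply: hq.
  rewrite -sqr_enorm2 -exprMn ler_pXn2r ?nnegrE ?enorm_ge0 ?mulr_ge0 ?enorm_ge0 ?(ltW eta0)//.
have [ke ke0 hke] := linear_enorm_bound E.
have gp : g p = x0 by rewrite -fx0; exact: gf.
have : g x @[x --> within (M `&` W) (nbhs p)] --> x0.
  by rewrite -gp; move/subspace_continuousP: cg; apply.
move=> /enorm_cvg/(_ (r / ke) (divr_gt0 r0 ke0)).
rewrite near_withinE => /eball_nbhs[rho rho0 hrho].
exists (eball p rho `&` W); split.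
- by apply: openI => //; exact: open_eball.
- by split => //; exact: eball_center.
move=> U oU UU0; pose O := eball o r `&` [set z | U (H z)].
have HM z : eball o r z -> M (H z).
  move=> /inb/(subd _ _ dd3) hz.
  have : (f @` V) (H z) by exists (x0 + T (z - o)) => //; exact: h3.
  by rewrite fV => -[].
have HO : H @` O = M `&` U.
  apply/seteqP; split => [_ [z [zr Uz] <-]|y [My Uy]]; first by split => //; exact: HM.
  have [yr Wy] := UU0 y Uy.
  have [x Vx fx] : (f @` V) y by rewrite fV.
  have := hrho y yr (conj My Wy); rewrite -fx gf// => xr.
  have [a [b ab]] := wspan (x - x0).
  have Tab : T (pt a b) = x - x0 by rewrite /T pt0 pt1.
  have Hab : H (o + pt a b) = y.
    by rewrite /H (addrC o) addrK Tab addrC subrK.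
  exists (o + pt a b); last by rewrite fx.
  split; last by rewrite /= Hab.
  rewrite /eball /= (addrC o) addrK -ETn Tab.
  by apply: le_lt_trans (hke _) _; rewrite mulrC -ltr_pdivlMr.
have oO : open O.
  rewrite openE => z [zr Uz].
  have [r1 r10 hr1] := eball_open (@open_eball R 2 o r) zr.
  have [r2 r20 hr2] := eball_open oU Uz.
  apply/eball_nbhs; exists (Num.min r1 (r2 / 2)); first by rewrite lt_min r10 divr_gt0.
  move=> z'; rewrite {1}/eball /= lt_min => /andP[z1 z2]; have z'r := hr1 _ z1.
  split => //; apply: hr2; rewrite /eball /=.
  by apply: le_lt_trans (Hup _ _ z'r zr) _; rewrite mulrC -ltr_pdivlMr.
have r1 : r <= 1 by rewrite ge_min lexx.
have Opos z : O z -> 0 <= z 0 0 /\ 0 <= z 0 1.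
  move=> [zr _]; have h0 := enorm_coord (z - o) 0; have h1' := enorm_coord (z - o) 1.
  rewrite !mxE /= in h0 h1'.
  have h2' : enorm (z - o) < 1 by exact: lt_le_trans zr r1.
  by move: h0 h1'; rewrite !ler_norml => /andP[? ?] /andP[? ?]; split; lra.
have -> : phi @` (M `&` U) = (phi \o H) @` O by rewrite -HO image_comp.
have l0 : 0 < (1 - th)^-1 by rewrite invr_gt0 subr_gt0.
apply: le_trans (@area_compare R n n' O H (phi \o H) _ A B C oO Opos l0 A0 D0 _ _) _.
- by move=> z z' [zr _] [zr' _]; exact: Hlow.
- by move=> z z' [zr _] [zr' _]; exact: Gq.
rewrite HO; apply: lee_wpmul2r; first exact: area_ge0.
rewrite lee_fin exprVn ler_pdivrMr ?exprn_gt0 ?subr_gt0//.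
exact: le_trans sD thK.
Qed.

End Chart.

(** * Smooth functions *)

Section SmoothCalculus.
Variable R : realType.
Implicit Types (V W : normedModType R).

Local Notation Ck k f := (Ck_on k setT f).

Lemma CkS V W k (f : V -> W) : Ck k.+1 f -> Ck k f.
Proof.
elim: k f => [|k IH] f [df cf]; first by move=> x _; exact/differentiable_continuous/df.
by split => // v; apply: IH; exact: cf.
Qed.

Lemma Ck_step V W k (f : V -> W) (Df : V -> V -> W) :
  (forall x, differentiable f x) -> (forall v x, 'D_v f x = Df v x) ->
  (forall v, Ck k (Df v)) -> Ck k.+1 f.
Proof.
move=> df DE cD; split => // v; have -> : 'D_v f = Df v by apply/funext => x; exact: DE.
exact: cD.
Qed.

Lemma Ck_cst V W k (a : W) : Ck k (fun _ : V => a).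
Proof.
elim: k a => [|k IH] a; first by move=> x _; exact: cst_continuous.
apply: (@Ck_step _ _ _ _ (fun _ _ => 0)) => // v x; exact: derive_cst.
Qed.

Lemma Ck_affine V W k (f : V -> W) (l : V -> W) :
  (forall x, differentiable f x) -> (forall v x, 'D_v f x = l v) -> Ck k f.
Proof.
move=> df DE; case: k => [|k]; first by move=> x _; exact: differentiable_continuous.
by apply: (Ck_step df DE) => v; exact: Ck_cst.
Qed.

Lemma Ck_linear V W k (f : {linear V -> W}) : continuous f -> Ck k f.
Proof.
move=> cf; apply: (@Ck_affine _ _ _ _ f) => [x|v x]; first exact: linear_differentiable.
by rewrite deriveE ?diff_lin//; exact: linear_differentiable.
Qed.

Lemma CkD V W k (f g : V -> W) : Ck k f -> Ck k g -> Ck k (fun x => f x + g x).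
Proof.
elim: k f g => [|k IH] f g cf cg.
  by move=> x _; apply: cvgD; [exact: cf|exact: cg].
apply: (@Ck_step _ _ _ _ (fun v x => 'D_v f x + 'D_v g x)) => [x|v x|v].
- by apply: differentiableD; [exact: cf.1|exact: cg.1].
- by apply: deriveD; apply: diff_derivable; [exact: cf.1|exact: cg.1].
- by apply: IH; [exact: cf.2|exact: cg.2].
Qed.

Lemma Ck_sum V W k (I : Type) (s : seq I) (f : I -> V -> W) :
  (forall i, Ck k (f i)) -> Ck k (fun x => \sum_(i <- s) f i x).
Proof.
move=> h; elim: s => [|i s IH].
  rewrite (_ : (fun x => _) = fun=> 0); first exact: Ck_cst.
  by apply/funext => x; rewrite big_nil.
rewrite (_ : (fun x => _) = fun x => f i x + \sum_(j <- s) f j x); first exact: CkD.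
by apply/funext => x; rewrite big_cons.
Qed.

Lemma CkM V k (f g : V -> R) : Ck k f -> Ck k g -> Ck k (fun x => f x * g x).
Proof.
elim: k f g => [|k IH] f g cf cg.
  by move=> x _; apply: cvgM; [exact: cf|exact: cg].
apply: (@Ck_step _ _ _ _ (fun v x => f x * 'D_v g x + g x * 'D_v f x)) => [x|v x|v].
- by apply: (@differentiableM _ _ f g); [exact: cf.1|exact: cg.1].
- by apply: (@deriveM _ _ f g); apply: diff_derivable; [exact: cf.1|exact: cg.1].
- apply: CkD; apply: IH; [exact: CkS|exact: cg.2|exact: CkS|exact: cf.2].
Qed.

Lemma Ck_scalel V W k (a : V -> R) (w : W) : Ck k a -> Ck k (fun x => a x *: w).
Proof.
elim: k a => [|k IH] a ca; first by move=> x _; apply: cvgZr_tmp; exact: ca.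
apply: (@Ck_step _ _ _ _ (fun v x => 'D_v a x *: w)) => [x|v x|v].
- by apply: differentiableZl; exact: ca.1.
- rewrite deriveE; last by apply: differentiableZl; exact: ca.1.
  by rewrite diffZl ?deriveE//; exact: ca.1.
- by apply: IH; exact: ca.2.
Qed.

Lemma Ck_rV V n k (f : V -> 'rV[R]_n) : (forall i, Ck k (fun x => f x 0 i)) -> Ck k f.
Proof.
move=> h; have -> : f = fun x => \sum_(i < n) f x 0 i *: delta_mx 0 i.
  by apply/funext => x; exact: row_sum_delta.
by apply: Ck_sum => i; exact: Ck_scalel.
Qed.

Lemma Ck_coord V n k (f : V -> 'rV[R]_n) i : Ck k f -> Ck k (fun x => f x 0 i).
Proof.
elim: k f => [|k IH] f cf.
  by move=> x _; apply: (@continuous_comp _ _ _ f (fun M : 'rV[R]_n => M 0 i)); [exact: cf|exact: coord_continuous].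
apply: (@Ck_step _ _ _ _ (fun v x => 'D_v f x 0 i)) => [x|v x|v].
- apply: (@differentiable_comp _ _ _ _ f (fun M : 'rV[R]_n => M 0 i)); first exact: cf.1.
  exact: differentiable_coord.
- by rewrite derive_mx ?mxE//; apply: diff_derivable; exact: cf.1.
- by apply: IH; exact: cf.2.
Qed.

Lemma Ck_comp1 V k (h : R -> R) (q : V -> R) : Ck k h -> Ck k q -> Ck k (fun x => h (q x)).
Proof.
elim: k h q => [|k IH] h q ch cq.
  by move=> x _; apply: (@continuous_comp _ _ _ q h); [exact: cq|exact: ch].
apply: (@Ck_step _ _ _ _ (fun v x => 'D_1 h (q x) * 'D_v q x)) => [x|v x|v].
- by apply: (@differentiable_comp _ _ _ _ q h); [exact: cq.1|exact: ch.1].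
- have dq : differentiable q x by exact: cq.1.
  have dh : differentiable h (q x) by exact: ch.1.
  rewrite (@deriveE _ _ _ (h \o q)); last exact: differentiable_comp.
  rewrite diff_comp//= !deriveE// -[X in 'd h (q x) X]mulr1 -[_ * 1]/(_ *: 1) linearZ.
  by rewrite /GRing.scale /= mulrC.
- by apply: CkM; [apply: (IH ('D_1 h) q); [exact: ch.2|exact: CkS]|exact: cq.2].
Qed.

Lemma CkV V k (q : V -> R) : (forall x, q x != 0) -> Ck k q -> Ck k (fun x => (q x)^-1).
Proof.
move=> q0; elim: k => [|k IH] cq; first by move=> x _; apply: cvgV => //; exact: cq.
have cI := IH (CkS cq).
apply: (@Ck_step _ _ _ _ (fun v x => (- (q x)^-1) * ((q x)^-1 * 'D_v q x))) => [x|v x|v].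
- by apply: differentiableV => //; exact: cq.1.
- have dq : derivable q x v by apply: diff_derivable; exact: cq.1.
  by rewrite (deriveV (q0 x) dq) /GRing.scale /= -exprVn expr2 !mulNr mulrA.
- apply: CkM; last by apply: CkM => //; exact: cq.2.
  rewrite (_ : (fun x => _) = fun x => (-1) * (q x)^-1).
    by apply: CkM => //; exact: Ck_cst.
  by apply/funext => x; rewrite mulN1r.
Qed.

Lemma Ck_dotp V n k (f g : V -> 'rV[R]_n) : Ck k f -> Ck k g ->
  Ck k (fun x => dotp (f x) (g x)).
Proof. by move=> cf cg; apply: Ck_sum => i; apply: CkM; exact: Ck_coord. Qed.

Lemma Ck_scale V n k (a : V -> R) (f : V -> 'rV[R]_n) : Ck k a -> Ck k f ->
  Ck k (fun x => a x *: f x).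
Proof.
move=> ca cf; apply: Ck_rV => i.
rewrite (_ : (fun x => _) = fun x => a x * f x 0 i); last by apply/funext => x; rewrite mxE.
by apply: CkM => //; exact: Ck_coord.
Qed.

Lemma CkN V W k (f : V -> W) : Ck k f -> Ck k (fun x => - f x).
Proof.
elim: k f => [|k IH] f cf; first by move=> x _; apply: cvgN; exact: cf.
apply: (@Ck_step _ _ _ _ (fun v x => - 'D_v f x)) => [x|v x|v].
- by apply: differentiableN; exact: cf.1.
- by apply: deriveN; apply: diff_derivable; exact: cf.1.
- by apply: IH; exact: cf.2.
Qed.

Lemma CkB V W k (f g : V -> W) : Ck k f -> Ck k g -> Ck k (fun x => f x - g x).
Proof. by move=> cf cg; apply: CkD => //; exact: CkN. Qed.

Lemma Ck_id V k : Ck k (fun x : V => x).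
Proof.
apply: (@Ck_affine _ _ _ _ id) => [x|v x]; first exact: ex_diff.
by rewrite derive_id.
Qed.

End SmoothCalculus.

Section PositivePart.
Variables (R : realType) (eta : R).
Hypothesis eta0 : 0 < eta.
Local Notation Ck k f := (Ck_on k setT f).

(** Up to linear combinations this family is closed under differentiation, which
    gives smoothness of all its members by one induction. *)
Definition flat (m : nat) (y : R) : R :=
  if 0 < y then y^-1 ^+ m * expR (- (eta * y^-1)) else 0.

(** The bound [1 + t <= expR t] at [t = x / N.+1], raised to a power. *)
Lemma expR_ge_pow (N : nat) (x : R) : 0 <= x -> (x / N.+1%:R) ^+ N.+1 <= expR x.
Proof.
move=> x0; have -> : expR x = expR (x / N.+1%:R) ^+ N.+1.
  by rewrite -expRM_natl mulrCA mulfV ?mulr1// pnatr_eq0.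
have h0 : 0 <= x / N.+1%:R by rewrite divr_ge0.
rewrite ler_pXn2r ?nnegrE ?expR_ge0//.
by move: (x / _) h0 => t t0; have := expR_ge1Dx t; lra.
Qed.

(** The quadratic bound gives the value and the derivative at 0. *)
Lemma flat_le m : exists2 C : R, 0 <= C & forall y, `|flat m y| <= C * y ^+ 2.
Proof.
exists ((m.+2%:R / eta) ^+ m.+2); first by rewrite exprn_ge0// divr_ge0// ltW.
move=> y; rewrite /flat; case: ifPn => y0; last by rewrite normr0 mulr_ge0 ?sqr_ge0// exprn_ge0// divr_ge0// ltW.
have iy : 0 < y^-1 by rewrite invr_gt0.
rewrite ger0_norm ?mulr_ge0 ?expR_ge0 ?exprn_ge0 ?(ltW iy)// expRN.
have x0 : 0 <= eta * y^-1 by rewrite mulr_ge0// ltW.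
have h := expR_ge_pow m.+1 x0.
rewrite ler_pdivrMr ?expR_gt0//.
apply: le_trans (ler_wpM2l _ h); last by rewrite mulr_ge0 ?sqr_ge0// exprn_ge0// divr_ge0// ltW.
rewrite -[leRHS]mulrA [y ^+ 2 * _]mulrC mulrA -exprMn.
have -> : m.+2%:R / eta * (eta * y^-1 / m.+2%:R) = y^-1.
  have M0 : m.+2%:R != 0 :> R by rewrite pnatr_eq0.
  by field; rewrite ?M0 ?gt_eqF.
rewrite -addn2 exprD -mulrA -exprMn mulVf ?gt_eqF// expr1n mulr1//.
Qed.

Lemma is_derive_flat m (y : R) :
  is_derive y 1 (flat m) (eta * flat m.+2 y - m%:R * flat m.+1 y).
Proof.
have [y0|y0|->] := ltgtP y 0.
- have -> : eta * flat m.+2 y - m%:R * flat m.+1 y = 0.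
    by rewrite /flat ltNge (ltW y0) /= !mulr0 subr0.
  apply: (@near_eq_is_derive _ _ _ (cst 0)) => //.
  near=> z; rewrite /flat /cst ltNge (_ : z <= 0)//.
  by apply/ltW; near: z; exact: lt_nbhsl.
- have dV : is_derive y 1 (fun z : R => z^-1) (- y^-1 ^+ 2).
    have yn0 : y != 0 by rewrite gt_eqF.
    split; first exact: (@derivableV _ _ id).
    by rewrite (@deriveV _ _ id)// derive_id /GRing.scale /= mulr1 exprVn.
  have dE : is_derive y 1 (fun z : R => expR (- (eta * z^-1)))
      (eta * y^-1 ^+ 2 * expR (- (eta * y^-1))).
    have h : is_derive y 1 (fun z : R => - (eta * z^-1)) (eta * y^-1 ^+ 2).
      apply: is_derive_eq; rewrite /GRing.scale /=; ring.
    have := is_derive1_comp (is_derive_expR _) h.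
    by rewrite mulrC.
  have dX := is_deriveX m dV.
  have dF := is_deriveM dX dE.
  apply: (@near_eq_is_derive _ _ _ ((fun z : R => z^-1) ^+ m * (fun z : R => expR (- (eta * z^-1))))) => //.
    near=> z; have z0 : 0 < z by near: z; exact: lt_nbhsr.
    by rewrite /flat z0 mulrfctE exprfctE.
  apply: is_derive_eq; rewrite /flat y0 exprfctE /GRing.scale /=.
  case: (m) => [|k]; first by rewrite !mul0r; ring.
  rewrite /= !exprS; move: (y^-1) (k.+1%:R : R) (expR (- (eta / y))) => u q e.
  move: (u ^+ k) => uk; ring.
- have -> : eta * flat m.+2 0 - m%:R * flat m.+1 0 = 0.
    by rewrite /flat ltxx !mulr0 subr0.
  have [C C0 hC] := flat_le m.
  have lim : h^-1 *: (flat m (h *: 1 + 0) - flat m 0) @[h --> 0^'] --> (0 : R).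
    apply/cvgrPdist_le => e e0; near=> h.
    rewrite sub0r normrN /GRing.scale /= mulr1 addr0 {2}/flat ltxx subr0 normrM normfV.
    have h0 : 0 < `|h| by rewrite normr_gt0; near: h; exact: nbhs_dnbhs_neq.
    rewrite ler_pdivrMl//; apply: le_trans (hC h) _.
    rewrite -[h ^+ 2]real_normK ?num_real// expr2 mulrCA; apply: ler_wpM2l => //.
    have he : `|h| <= e / (C + 1).
      near: h; apply: dnbhs0_le; rewrite divr_gt0// ltr_wpDl//.
    apply: le_trans (ler_wpM2l C0 he) _.
    by rewrite mulrCA ler_piMr ?(ltW e0)// ler_pdivrMr ?ltr_wpDl// mul1r lerDl.
  split; first by apply/cvg_ex; exists 0.
  exact: cvg_lim lim.
Unshelve. all: by end_near. Qed.

Lemma Ck_flat k m : Ck k (flat m).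
Proof.
elim: k m => [|k IH] m; first by move=> x _; exact: is_derive_continuous (is_derive_flat m x).
have df x : differentiable (flat m) x.
  by apply/derivable1_diffP; exact: (@ex_derive _ _ _ _ _ _ _ (is_derive_flat m x)).
apply: (@Ck_step R _ _ k (flat m) (fun v x => v * (eta * flat m.+2 x - m%:R * flat m.+1 x))) => // [v x|v].
  rewrite deriveE// -[v in LHS]mulr1 -[_ * 1]/(_ *: 1) linearZ /= -deriveE//.
  by rewrite (@derive_val _ _ _ _ _ _ _ (is_derive_flat m x)).
apply: CkM; first exact: Ck_cst.
by apply: CkB; apply: CkM; (exact: Ck_cst || exact: IH).
Qed.

(** The positive part, multiplied by [exp (- eta / y)] to be smooth at 0. *)
Definition pospart (y : R) : R := y * flat 0 y.
Definition dpospart (y : R) : R := flat 0 y + eta * (y * flat 2 y).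

Lemma Ck_pospart k : Ck k pospart.
Proof. by apply: CkM; [exact: Ck_id|exact: Ck_flat]. Qed.

Lemma is_derive_pospart (y : R) : is_derive y 1 pospart (dpospart y).
Proof.
have h := is_deriveM (is_derive_id y 1) (is_derive_flat 0 y).
apply: is_derive_eq; rewrite /dpospart /GRing.scale /=; ring.
Qed.

Lemma pospart_npos y : y <= 0 -> pospart y = 0.
Proof. by move=> y0; rewrite /pospart /flat ltNge y0 mulr0. Qed.

Lemma dpospart_npos y : y <= 0 -> dpospart y = 0.
Proof. by move=> y0; rewrite /dpospart /flat ltNge y0 /= !mulr0 addr0. Qed.

Lemma pospart_ge0 y : 0 <= pospart y.
Proof.
have [y0|y0] := leP y 0; first by rewrite pospart_npos.
by rewrite /pospart /flat y0 mulr_ge0 ?(ltW y0)// expr0 mul1r expR_ge0.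
Qed.

Lemma pospart_le y : 0 <= y -> pospart y <= y.
Proof.
move=> y0; rewrite /pospart /flat; case: ifPn => // [yp|_]; last by rewrite mulr0.
rewrite expr0 mul1r ler_piMr// expRN invf_le1 ?expR_gt0//.
have h : 0 <= eta * y^-1 by rewrite mulr_ge0 ?invr_ge0// ltW.
by have := expR_ge1Dx (eta * y^-1); lra.
Qed.

Lemma pospart_ge y : y - eta <= pospart y.
Proof.
have [y0|y0] := leP y 0; first by rewrite pospart_npos//; have := eta0; lra.
rewrite /pospart /flat y0 expr0 mul1r.
apply: (@le_trans _ _ (y * (1 - eta * y^-1))).
  by rewrite mulrBr mulr1 mulrCA mulfV ?gt_eqF// mulr1.
apply: ler_wpM2l; first exact: ltW.
exact: expR_ge1Dx.
Qed.

Lemma dpospart_itv y : 0 <= dpospart y <= 1.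
Proof.
have [y0|y0] := leP y 0; first by rewrite dpospart_npos// lexx ler01.
have x0 : 0 <= eta * y^-1 by rewrite mulr_ge0 ?invr_ge0// ltW.
have -> : dpospart y = (1 + eta * y^-1) * expR (- (eta * y^-1)).
  rewrite /dpospart /flat y0 expr0 mul1r mulrDl mul1r; congr (_ + _).
  by field; rewrite gt_eqF.
rewrite mulr_ge0 ?expR_ge0 ?addr_ge0//= expRN ler_pdivrMr ?expR_gt0// mul1r.
exact: expR_ge1Dx.
Qed.

End PositivePart.

(** * Arcs and pieces of surfaces *)

Section Curves.
Variables (R : realType) (n : nat).

Lemma Ck1_is_derive (c : R -> 'rV[R]_n) (t : R) : @Ck_on R R^o 'rV[R]_n 1 setT c ->
  is_derive t 1 c (derive1 c t).
Proof.
move=> [dc _]; rewrite derive1E; apply: derivableP; apply: (@diff_derivable _ R^o); exact: dc.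
Qed.

Lemma D1_derive1 (f : R -> 'rV[R]_n) : 'D_1 f = derive1 f.
Proof. by apply/funext => s; rewrite derive1E. Qed.

Lemma Ck1_continuous_derive1 (c : R -> 'rV[R]_n) (t : R) :
  @Ck_on R R^o 'rV[R]_n 1 setT c -> {for t, continuous (derive1 c)}.
Proof.
move=> [_ /(_ 1)/(_ t I)]; by rewrite (D1_derive1 c).
Qed.

Lemma enorm_continuous : continuous (@enorm R n).
Proof.
move=> x U /nbhs_ballP[e /= e0 xU]; apply/eball_nbhs; exists e => // y xy; apply: xU.
rewrite -ball_normE /=; apply: le_lt_trans xy; rewrite enormBC.
exact: enorm_sub_lip.
Qed.

(** The speed is bounded on the compact parameter interval. *)
Lemma C1_curve_lip (c : R -> 'rV[R]_n) : @Ck_on R R^o 'rV[R]_n 1 setT c ->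
  exists2 k : R, 0 < k & forall s t, 0 <= s <= 1 -> 0 <= t <= 1 ->
    enorm (c s - c t) <= k * `|s - t|.
Proof.
move=> cc.
have cd : {within `[0, 1], continuous (fun t => enorm (derive1 c t))}.
  apply: continuous_subspaceT => t; apply: continuous_comp; last exact: enorm_continuous.
  exact: Ck1_continuous_derive1.
have [t0 _ ht0] := EVT_max (@ler01 R) cd.
pose k := enorm (derive1 c t0) + 1.
have k0 : 0 < k by rewrite ltr_wpDl ?enorm_ge0.
have main s t : 0 <= s -> s <= t -> t <= 1 -> enorm (c t - c s) <= k * (t - s).
  move=> s0 st t1.
  have := @mean_value_enorm R n c (derive1 c) 0 k s t st (fun u _ => Ck1_is_derive u cc).
  rewrite scaler0 subr0; apply => u /andP[u1 u2]; rewrite subr0.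
  apply: le_trans (ht0 u _) _; first by rewrite in_itv /= (le_trans s0)// (le_trans u2).
  by rewrite lerDl.
exists k => // s t /andP[s0 s1] /andP[t0' t1].
have [st|/ltW ts] := leP s t.
  by rewrite enormBC distrC ger0_norm ?subr_ge0//; exact: main.
by rewrite ger0_norm ?subr_ge0//; exact: main.
Qed.

(** A Lipschitz image of a degenerate rectangle. *)
Lemma area_C1_curve (c : R -> 'rV[R]_n) : @Ck_on R R^o 'rV[R]_n 1 setT c ->
  area (c @` `[0, 1]) = 0%E.
Proof.
move=> /C1_curve_lip[k k0 hk]; apply/eqP; rewrite eq_le area_ge0 andbT.
have h := @area_lip R 2 n (fun z => c (z 0 0)) (rect 0 0 1 0) k k0.
apply: (@le_trans _ _ (area ((fun z : 'rV[R]_2 => c (z 0 0)) @` rect 0 0 1 0))).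
  apply: areaS => _ [t /= t01 <-]; exists (pt t 0); last by rewrite pt0.
  by rewrite /rect /= pt0 pt1 !add0r lexx; move: t01; rewrite in_itv /= => ->.
apply: le_trans (h _) _.
  move=> x y [hx _] [hy _]; rewrite !add0r in hx hy.
  apply: le_trans (hk _ _ hx hy) _; apply: ler_wpM2l; first exact: ltW.
  by have := enorm_coord (x - y) 0; rewrite !mxE.
have -> : area (rect 0 0 1 0 : set 'rV[R]_2) = 0%E.
  apply/eqP; rewrite eq_le area_ge0 andbT.
  by apply: le_trans (area_rect_le _ _ _ _) _ => //; rewrite mulr0.
by rewrite mule0.
Qed.

Lemma area_bigcup_ord (m : nat) (F : 'I_m -> set 'rV[R]_n) :
  (area (\bigcup_(i in [set: 'I_m]) F i) <= \sum_(i < m) area (F i))%E.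
Proof.
pose F' k := if insub k is Some i then F i else set0.
apply: le_trans (@outer_measure_cover _ _ (@area R n) _ m F' _) _.
  by move=> x [i _ Fx]; exists i => //; rewrite /F' valK.
by apply: lee_sum => i _; rewrite /F' valK.
Qed.

Lemma area_bigcup_ord0 (m : nat) (F : 'I_m -> set 'rV[R]_n) :
  (forall i, area (F i) = 0%E) -> area (\bigcup_(i in [set: 'I_m]) F i) = 0%E.
Proof.
move=> F0; apply/eqP; rewrite eq_le area_ge0 andbT.
by apply: le_trans (area_bigcup_ord F) _; rewrite big1.
Qed.

End Curves.

(** The surface is, up to boundaries, the disjoint union of the parts of its
    smooth pieces outside of the closures of the preceding ones.  The images of
    the boundaries are null because the boundaries are made of arcs. *)
Lemma surface_class_area_le (R : realType) (n : nat) (G : graph R n)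
    (Sigma : set 'rV[R]_n) (phi : 'rV[R]_n -> 'rV[R]_n) (K : R) (U C : set 'rV[R]_n) :
  surface_class G Sigma -> (area Sigma < +oo)%E -> 0 <= K -> open U -> closed C ->
  (forall c, @Ck_on R R^o 'rV[R]_n 1 setT c -> area (phi @` (c @` `[0, 1])) = 0%E) ->
  (forall (M : set 'rV[R]_n) p, embedded_surface 2 M -> (M `&` U `&` C) p ->
     exists U0, [/\ open U0, U0 p & area_expands_le phi M K U0]) ->
  (area (phi @` (Sigma `&` U `&` C)) <= K%:E * area (Sigma `&` U `&` C))%E.
Proof.
move=> [m [M [hM _ hB SE _]]] Soo K0 oU cC hnull hloc; set A := Sigma `&` U `&` C.
pose N k := if insub k is Some i then M i else set0.
have NE (i : 'I_m) : N i = M i by rewrite /N valK.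
pose D := seqDU (fun k => closure (N k)).
have mcl k : (@area R n).-caratheodory (closure (N k)).
  by apply: caratheodory_closed; exact: closed_closure.
have clo k : closed (\big[setU/set0]_(i < k) closure (N i)).
  rewrite -(big_mkord xpredT (fun i => closure (N i))).
  by elim/big_ind : _ => [|X Y|i _]; [exact: closed0|exact: closedU|exact: closed_closure].
have mD k : (@area R n).-caratheodory (D k).
  apply: (@caratheodory_measurable_setD R _ (@area R n)) => //.
  exact: caratheodory_closed.
pose Bd := \bigcup_(i in [set: 'I_m]) surf_boundary (M i).
have Bd0 : area (phi @` Bd) = 0%E.
  rewrite /Bd image_bigcup; apply: area_bigcup_ord0 => i.
  have [q [c [hc ->]]] := hB i; rewrite image_bigcup; apply: area_bigcup_ord0 => j.
  by apply: hnull; exact: (hc j).1.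
have Moo i : (area (M i) < +oo)%E.
  apply: le_lt_trans Soo; apply: areaS => x Mx; rewrite SE.
  by exists i => //; exact: subset_closure.
pose P (i : 'I_m) := M i `&` (U `&` ~` \big[setU/set0]_(j < i) closure (N j)) `&` C.
have hP i : (area (phi @` P i) <= K%:E * area (P i))%E.
  apply: area_expands_le_global => //.
    by apply: openI => //; exact: closed_openC.
  by move=> p [[Mp [Up _]] Cp]; apply: hloc; [exact: (hM i).1|].
apply: (@le_trans _ _ (\sum_(i < m) area (phi @` P i) + area (phi @` Bd))%E).
  apply: (@le_trans _ _ (area ((\bigcup_(i in [set: 'I_m]) phi @` P i) `|` phi @` Bd))).
    apply: areaS => _ [x [[Sx Ux] Cx] <-].
    have [|nB] := pselect (Bd x); [by right; exists x|left].
    move: Sx; rewrite SE => -[i0 _ clx].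
    have [i /asboolP ci imin] := ex_minnP (ex_intro (fun k => `[< closure (N k) x >]) i0
      (asboolT (eq_ind_r (fun X => closure X x) clx (NE i0)))).
    have im : (i < m)%N.
      by apply: leq_ltn_trans (ltn_ord i0); apply: imin; rewrite asboolT// NE.
    pose j := Ordinal im; have cj : closure (M j) x by rewrite -NE.
    exists j => //; exists x => //; split => //; split.
      by apply: contrapT => nM; apply: nB; exists j.
    split => //; rewrite -(bigcup_mkord _ (fun k => closure (N k))) => -[k /= ki ck].
    by have := imin k (asboolT ck); rewrite leqNgt ki.
  apply: le_trans (areaU _ _) _; apply: leeD2r; exact: area_bigcup_ord.
rewrite Bd0 adde0; apply: (@le_trans _ _ (\sum_(i < m) K%:E * area (P i))%E).
  by apply: lee_sum => i _; exact: hP.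
rewrite -ge0_sume_distrr; last by move=> *; exact: area_ge0.
apply: lee_wpmul2l; first by rewrite lee_fin.
apply: (@le_trans _ _ (\sum_(i < m) area (A `&` D i))%E).
  apply: lee_sum => i _; apply: areaS => x [[Mx [Ux nx]] Cx]; split.
    by split => //; split => //; rewrite SE; exists i => //; exact: subset_closure.
  by split => //; rewrite NE; exact: subset_closure.
rewrite -(caratheodory_additive mD (trivIset_seqDU _) m A).
by apply: areaS => x [].
Qed.

(** * The radial flow *)

Section RadialFlow.
Variables (R : realType) (n : nat) (g g' : R -> R) (p : 'rV[R]_n).
Local Notation Ck k f := (Ck_on k setT f).

Definition sqdist (x : 'rV[R]_n) : R := dotp (x - p) (x - p).

Definition radial_flow (t : R) (x : 'rV[R]_n) : 'rV[R]_n :=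
  x - (t * g (sqdist x)) *: (x - p).

Hypotheses (gC : forall k, Ck k g) (dg : forall s : R, is_derive s 1 g (g' s)).

Lemma Ck_sqdist (V : normedModType R) k (xi : V -> 'rV[R]_n) :
  Ck k xi -> Ck k (fun z => sqdist (xi z)).
Proof. by move=> cx; apply: Ck_dotp; apply: CkB => //; exact: Ck_cst. Qed.

Lemma Ck_radial_flow (V : normedModType R) k (tau : V -> R) (xi : V -> 'rV[R]_n) :
  Ck k tau -> Ck k xi -> Ck k (fun z => radial_flow (tau z) (xi z)).
Proof.
move=> ct cx; apply: CkB => //; apply: Ck_scale.
  by apply: CkM => //; apply: Ck_comp1; [exact: gC|exact: Ck_sqdist].
by apply: CkB => //; exact: Ck_cst.
Qed.

Lemma smooth_radial_flow : smooth (fun z : R^o * 'rV[R]_n => radial_flow z.1 z.2).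
Proof.
move=> k; apply: Ck_radial_flow.
  by apply: (@Ck_linear R (R^o * 'rV[R]_n)%type R^o k fst); move=> x; exact: cvg_fst.
by apply: (@Ck_linear R (R^o * 'rV[R]_n)%type 'rV[R]_n k snd); move=> x; exact: cvg_snd.
Qed.

Lemma radial_flow0 x : radial_flow 0 x = x.
Proof. by rewrite /radial_flow mul0r scale0r subr0. Qed.

Lemma sqdist_ge0 x : 0 <= sqdist x. Proof. exact: dotp_ge0. Qed.

Lemma is_derive_sqdist x u : is_derive x u sqdist (2 * dotp (x - p) u).
Proof.
have h : is_derive x u (fun z : 'rV[R]_n => z - p) u.
  by have := is_deriveB (is_derive_id x u) (is_derive_cst p x u); rewrite subr0.
have := is_derive_dotp h h; rewrite (dotpC u) => h2.
by rewrite mulr_natl mulr2n.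
Qed.

(** A multiple of the identity plus a map of rank one. *)
Lemma diff_radial_flow t x u : 'd (radial_flow t) x u =
  (1 - t * g (sqdist x)) *: u - (2 * t * g' (sqdist x) * dotp (x - p) u) *: (x - p).
Proof.
have c1 : Ck 1 (radial_flow t).
  by apply: (@Ck_radial_flow 'rV[R]_n 1 (fun=> t) id); [exact: Ck_cst|exact: Ck_id].
have dr : differentiable (radial_flow t) x by exact: c1.1.
have dq : differentiable sqdist x by exact: (@Ck_sqdist _ 1 id (@Ck_id R _ 1)).1.
have dh : differentiable g (sqdist x) by exact: (gC 1).1.
have hgq : is_derive x u (g \o sqdist) (g' (sqdist x) * (2 * dotp (x - p) u)).
  split; first by apply: diff_derivable; exact: differentiable_comp.
  rewrite (@deriveE _ _ _ (g \o sqdist)); last exact: differentiable_comp.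
  rewrite diff_comp//= -(deriveE _ dq) (@derive_val _ _ _ _ _ _ _ (is_derive_sqdist x u)).
  rewrite -[X in 'd g _ X]mulr1 -[_ * 1]/(_ *: 1) linearZ /= -(deriveE _ dh).
  by rewrite (@derive_val _ _ _ _ _ _ _ (dg (sqdist x))) /GRing.scale /= mulrC.
suff : is_derive x u (radial_flow t) ((1 - t * g (sqdist x)) *: u -
    (2 * t * g' (sqdist x) * dotp (x - p) u) *: (x - p)).
  by move=> h; rewrite -(deriveE _ dr) (@derive_val _ _ _ _ _ _ _ h).
apply/is_derive_rV => i.
have hi : is_derive x u (fun z : 'rV[R]_n => z 0 i) (u 0 i).
  by apply: (proj1 (is_derive_rV id x u u)); exact: is_derive_id.
have hy : is_derive x u (fun z : 'rV[R]_n => z 0 i - p 0 i) (u 0 i).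
  by have := is_deriveB hi (is_derive_cst (p 0 i) x u); rewrite subr0.
have h1 := is_deriveM (is_deriveZ t hgq) hy.
have h2 := is_deriveB hi h1.
have -> : (fun z : 'rV[R]_n => radial_flow t z 0 i) = (fun z : 'rV[R]_n => z 0 i) -
    (t *: (g \o sqdist)) * (fun z : 'rV[R]_n => z 0 i - p 0 i).
  by apply/funext => z; rewrite /radial_flow !mxE.
apply: is_derive_eq; rewrite !mxE /GRing.scale /= /GRing.scale /=; ring.
Qed.

(** The product of the tangential and the radial stretching factors. *)
Definition jacobian_bound (t s : R) : R :=
  (1 - t * g s) * (1 - t * g s - 2 * t * s * g' s).

(** The Gram determinant depends on the plane only through the squared length of
    the projection of [x - p] to it, at most [sqdist x] by the inequality of
    Bessel, and increases with it: the worst planes contain the ray. *)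
Lemma gram_radial_flow t x u v : 0 <= t -> t * g (sqdist x) <= 1 -> g' (sqdist x) <= 0 ->
  dotp u u = 1 -> dotp v v = 1 -> dotp u v = 0 ->
  let L := 'd (radial_flow t) x in
  dotp (L u) (L u) * dotp (L v) (L v) - dotp (L u) (L v) ^+ 2 <=
  jacobian_bound t (sqdist x) ^+ 2.
Proof.
move=> t0 tg g'0 uu vv uv; rewrite /= !diff_radial_flow.
set y := x - p; set s := sqdist x in tg g'0 *.
have sE : s = dotp y y by [].
clearbody y; set h := 1 - t * g s.
pose k := - (2 * t * g' s); have k0 : 0 <= k by rewrite /k; nra.
have h0 : 0 <= h by rewrite subr_ge0.
pose a := dotp y u; pose b := dotp y v.
have bessel : a ^+ 2 + b ^+ 2 <= s.
  have := dotp_ge0 (y - a *: u - b *: v).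
  rewrite !(dotpBl, dotpBr, dotpZl, dotpZr) uu vv uv (dotpC v u) uv (dotpC u y) (dotpC v y).
  rewrite -/a -/b -sE => e.
  apply: le_trans (_ : 0 + a ^+ 2 + b ^+ 2 <= _); first by rewrite add0r.
  move: e; set rhs := (X in 0 <= X) => e.
  have -> : s = rhs + a ^+ 2 + b ^+ 2 by rewrite /rhs; ring.
  by rewrite !lerD2r.
pose m := 2 * h * k + k ^+ 2 * s.
have s0 : 0 <= s by rewrite sE dotp_ge0.
have m0 : 0 <= m by rewrite /m addr_ge0// !mulr_ge0 ?sqr_ge0.
rewrite !(dotpBl, dotpBr, dotpZl, dotpZr) uu vv uv (dotpC u y) (dotpC v y).
rewrite -/a -/b -sE.
have -> : jacobian_bound t s ^+ 2 = h ^+ 2 * (h ^+ 2 + m * s).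
  by rewrite /jacobian_bound -/h /m /k; ring.
set lhs := (X in X <= _).
have -> : lhs = h ^+ 2 * (h ^+ 2 + m * (a ^+ 2 + b ^+ 2)) by rewrite /lhs /m /k; ring.
apply: ler_wpM2l; first exact: sqr_ge0.
by rewrite lerD2l; apply: ler_wpM2l.
Qed.

(** The local comparison needs a strict bound on the Gram determinant, so it is
    applied with [k + d] for small [d]. *)
Lemma area_radial_flow (G : graph R n) (Sigma U C : set 'rV[R]_n) (t k : R) :
  surface_class G Sigma -> (area Sigma < +oo)%E -> open U -> closed C ->
  0 <= t -> (forall s, 0 <= s -> t * g s <= 1) -> (forall s, 0 <= s -> g' s <= 0) ->
  (forall x, U x -> C x -> jacobian_bound t (sqdist x) <= k) ->
  (area (radial_flow t @` (Sigma `&` U `&` C)) <= k%:E * area (Sigma `&` U `&` C))%E.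
Proof.
move=> hS Soo oU cC t0 tg g'0 hJ.
have [A0|/set0P[x0 [[Sx0 Ux0] Cx0]]] := eqVneq (Sigma `&` U `&` C) set0.
  by rewrite A0 image_set0 area_set0 mule0.
have J0 x : 0 <= jacobian_bound t (sqdist x).
  have s0 := sqdist_ge0 x; have := tg _ s0; have := g'0 _ s0; rewrite /jacobian_bound.
  move=> g1 t1; rewrite mulr_ge0 ?subr_ge0//.
  have : t * sqdist x * g' (sqdist x) <= 0 by rewrite mulr_ge0_le0// mulr_ge0.
  lra.
have k0 : 0 <= k by apply: le_trans (J0 x0) _; exact: hJ.
apply/lee_addgt0Pr => e e0.
pose V := area (Sigma `&` U `&` C).
have fV : V \is a fin_num.
  rewrite ge0_fin_numE ?area_ge0//; apply: le_lt_trans Soo.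
  by apply: areaS => x [[]].
pose d := e / (fine V + 1).
have V1 : 0 < fine V + 1 by rewrite ltr_wpDl// fine_ge0// area_ge0.
have d0 : 0 < d by rewrite divr_gt0.
apply: (@le_trans _ _ ((k + d)%:E * V)%E); last first.
  rewrite -/V -(fineK fV) -!EFinM -EFinD lee_fin mulrDl lerD2l /d.
  by rewrite mulrAC -mulrA ler_piMr ?(ltW e0)// ler_pdivrMr// mul1r lerDl.
apply: (surface_class_area_le hS Soo) => //.
- by rewrite addr_ge0// ltW.
- move=> c cc; rewrite image_comp; apply: area_C1_curve.
  apply: (@Ck_radial_flow R^o 1 (fun=> t) c) => //; exact: Ck_cst.
- move=> M x hM [[Mx Ux] Cx].
  have c1 : Ck 1 (radial_flow t).
    by apply: (@Ck_radial_flow 'rV[R]_n 1 (fun=> t) id); [exact: Ck_cst|exact: Ck_id].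
  apply: (@embedded_area_expands_le _ _ _ 1 M _ x ('d (radial_flow t) x) (jacobian_bound t (sqdist x))) => //.
  + exact: (Ck_on1_strict_diff openT).
  + by apply: le_lt_trans (hJ x Ux Cx) _; rewrite ltrDl.
  + move=> u v uu vv uv; apply: gram_radial_flow => //.
      by apply: tg; exact: sqdist_ge0.
    by apply: g'0; exact: sqdist_ge0.
Qed.

End RadialFlow.

(** * First variation along the radial flow *)

Section FirstVariation.
Variables (R : realType) (n : nat) (G : graph R n) (Sigma : set 'rV[R]_n).
Hypotheses (hS : surface_class G Sigma) (hst : strongly_stationary G Sigma).

Lemma area_graph_set : area (graph_set G) = 0%E.
Proof.
apply: area_bigcup_ord0 => i; apply: area_C1_curve; exact: (edge_C1 i).1.
Qed.

Lemma image_segment0 (phi : R -> 'rV[R]_n -> 'rV[R]_n) : (forall x, phi 0 x = x) ->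
  (fun z => phi z.1 z.2) @` (`[0%R, 0] `*` graph_set G) = graph_set G.
Proof.
move=> phi0; apply/seteqP; split => [_ [[t x] [/= t0 Gx] <-]|x Gx] /=.
  by move: t0; rewrite in_itv /= -eq_le => /eqP <-; rewrite phi0.
by exists (0, x) => /=; [split => //=; rewrite in_itv /= lexx|rewrite phi0].
Qed.

Lemma swept_area0 (phi : R -> 'rV[R]_n -> 'rV[R]_n) : (forall x, phi 0 x = x) ->
  swept_area G Sigma phi 0 = area Sigma.
Proof.
move=> phi0; rewrite /swept_area image_segment0// area_graph_set adde0.
by congr (area _); apply/seteqP; split => [_ [x Sx <-]|x Sx]; [rewrite phi0|exists x].
Qed.

(** The derivative of the constant deformation is real only if the area is. *)
Lemma stationary_area_fin : (area Sigma < +oo)%E.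
Proof.
have sm : smooth (fun z : R^o * 'rV[R]_n => z.2).
  by move=> k; apply: (@Ck_linear R (R^o * 'rV[R]_n)%type 'rV[R]_n k snd); move=> x; exact: cvg_snd.
have [l [hl _]] := hst (phi := fun _ x => x) sm (fun x => erefl).
rewrite ltey; apply/eqP => Soo.
have : (l%:E <= -oo)%E.
  apply: cvge_le hl; near=> t.
  have t0 : 0 < t by near: t; exact: nbhs_right_gt.
  rewrite (swept_area0 (phi := fun _ x => x))// Soo /= addeNy.
  by rewrite gt0_mulNye ?lte_fin ?invr_gt0.
by rewrite leeNy_eq.
Unshelve. all: by end_near. Qed.

Variable p : 'rV[R]_n.

Definition sqball (r : R) : set 'rV[R]_n := [set x | sqdist p x < r].

Lemma sqballE (r : R) : 0 < r -> sqball r = eball p (Num.sqrt r).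
Proof.
move=> r0; apply/seteqP; split => x; rewrite /sqball /eball /= /sqdist -sqr_enorm.
  by rewrite -{1}(sqr_sqrtr (ltW r0)) ltr_pXn2r ?nnegrE ?enorm_ge0 ?sqrtr_ge0.
by rewrite -{2}(sqr_sqrtr (ltW r0)) ltr_pXn2r ?nnegrE ?enorm_ge0 ?sqrtr_ge0.
Qed.

Lemma sqball_npos (r : R) : r <= 0 -> sqball r = set0.
Proof.
move=> r0; apply/seteqP; split => // x; rewrite /sqball /= => /lt_le_trans/(_ r0).
by rewrite ltNge dotp_ge0.
Qed.

Lemma open_sqball (r : R) : open (sqball r).
Proof.
have [r0|r0] := leP r 0; first by rewrite sqball_npos//; exact: open0.
by rewrite sqballE//; exact: open_eball.
Qed.

Definition ball_area (r : R) : R := fine (area (Sigma `&` sqball r)).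

Lemma fin_subarea (A : set 'rV[R]_n) : A `<=` Sigma -> area A \is a fin_num.
Proof.
move=> AS; rewrite ge0_fin_numE ?area_ge0//.
by apply: le_lt_trans stationary_area_fin; exact: areaS.
Qed.

Lemma ball_area_ge0 (r : R) : 0 <= ball_area r.
Proof. by rewrite fine_ge0// area_ge0. Qed.

Lemma ball_areaE (r : R) : area (Sigma `&` sqball r) = (ball_area r)%:E.
Proof. by rewrite fineK// fin_subarea// => x []. Qed.

Variables (g g' : R -> R) (G0 : R).
Hypotheses (gC : forall k, Ck_on k setT g) (dg : forall s : R, is_derive s 1 g (g' s)).
Hypotheses (g_ge0 : forall s, 0 <= s -> 0 <= g s) (g_le : forall s, 0 <= s -> g s <= G0).
Hypothesis g'_le0 : forall s, 0 <= s -> g' s <= 0.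

(** [g + s g'] is half the divergence of the radial field [g *: (x - p)] on a
    plane through the ray. *)
Lemma jacobian_bound_le (t s w : R) : 0 <= t -> 0 <= s -> w <= g s + s * g' s ->
  jacobian_bound g g' t s <= 1 - 2 * t * w + t ^+ 2 * G0 ^+ 2.
Proof.
move=> t0 s0 hw; have gs := g_ge0 s0; have gl := g_le s0; have gn := g'_le0 s0.
have -> : jacobian_bound g g' t s = 1 - 2 * t * (g s + s * g' s) +
    t ^+ 2 * (g s ^+ 2 + 2 * (s * g s * g' s)) by rewrite /jacobian_bound; ring.
apply: lerD.
  by rewrite lerD2l lerN2; apply: ler_wpM2l; rewrite ?mulr_ge0.
apply: ler_wpM2l; first exact: sqr_ge0.
have : s * g s * g' s <= 0 by rewrite mulr_ge0_le0// mulr_ge0.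
have : g s ^+ 2 <= G0 ^+ 2 by rewrite ler_pXn2r ?nnegrE// (le_trans gs).
lra.
Qed.

(** The surface is cut into a ball, a shell and the rest, with a lower bound for
    the radial divergence on each; [S] bounds the rate at which the graph sweeps
    out area.  The three areas are finite and add up since balls are
    measurable. *)
Lemma radial_first_variation (a b w1 w2 w3 S : R) : a <= b ->
  (forall s, 0 <= s -> s < a -> w1 <= g s + s * g' s) ->
  (forall s, 0 <= s -> a <= s -> s < b -> w2 <= g s + s * g' s) ->
  (forall s, 0 <= s -> b <= s -> w3 <= g s + s * g' s) ->
  (forall e, 0 < e -> \forall t \near 0^'+,
    (area ((fun z => radial_flow g p z.1 z.2) @` (`[0%R, t] `*` graph_set G))
       <= (t * (S + e))%:E)%E) ->
  2 * (w1 * ball_area a + w2 * (ball_area b - ball_area a) +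
       w3 * (fine (area Sigma) - ball_area b)) <= S.
Proof.
move=> ab h1 h2 h3 hsw.
have Soo := stationary_area_fin.
(* Each piece is written as the trace of an open and of a closed set. *)
pose A1 := Sigma `&` sqball a `&` setT.
pose A2 := Sigma `&` sqball b `&` ~` sqball a.
pose A3 := Sigma `&` setT `&` ~` sqball b.
have sub r s : r <= s -> sqball r `<=` sqball s.
  by move=> rs x; rewrite /sqball /= => h; exact: lt_le_trans h rs.
have E1 : area A1 = (ball_area a)%:E by rewrite /A1 setIT ball_areaE.
have mb r : (@area R n).-caratheodory (sqball r) by apply: caratheodory_open; exact: open_sqball.
have E2 : area A2 = (ball_area b - ball_area a)%:E.
  have := mb a (Sigma `&` sqball b); rewrite -/A2 -setIA (setIidr (sub _ _ ab)) !ball_areaE => h.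
  have f2 : area A2 \is a fin_num by apply: fin_subarea => x [[]].
  by move: h; rewrite -(fineK f2) -EFinD => -[->]; rewrite addrC addKr.
have E3 : area A3 = (fine (area Sigma) - ball_area b)%:E.
  have := mb b Sigma; rewrite ball_areaE.
  have -> : Sigma `&` ~` sqball b = A3 by rewrite /A3 setIT.
  have f3 : area A3 \is a fin_num by apply: fin_subarea => x [[]].
  have fS : area Sigma \is a fin_num by exact: fin_subarea.
  by rewrite -(fineK f3) -EFinD => ->; rewrite /= addrC addKr.
set V1 := ball_area a in E1 *; set V2 := ball_area b - _ in E2 *.
set V3 := _ - ball_area b in E3 *.
have V10 : 0 <= V1 by exact: ball_area_ge0.
have V20 : 0 <= V2 by rewrite -lee_fin -E2 area_ge0.
have V30 : 0 <= V3 by rewrite -lee_fin -E3 area_ge0.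
have VS : area Sigma = (V1 + V2 + V3)%:E.
  have -> : V1 + V2 + V3 = fine (area Sigma) by rewrite /V1 /V2 /V3; ring.
  by rewrite fineK//; exact: fin_subarea.
set X := w1 * V1 + w2 * V2 + w3 * V3.
have [l [hl l0]] := hst (smooth_radial_flow p gC) (radial_flow0 g p).
apply/ler_addgt0Pr => e e0.
suff : (l%:E <= (- (2 * X) + S + e)%:E)%E by rewrite lee_fin; lra.
apply: cvge_le hl.
have e2 : 0 < e / 2 by rewrite divr_gt0.
pose Y := G0 ^+ 2 * (V1 + V2 + V3).
have Y0 : 0 <= Y.
  by apply: mulr_ge0; [exact: sqr_ge0|apply: addr_ge0 => //; exact: addr_ge0].
have G00 : 0 <= G0 by apply: le_trans (g_le (lexx 0)); exact: g_ge0.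
near=> t.
have t0 : 0 < t by near: t; exact: nbhs_right_gt.
have tG : t * G0 <= 1.
  have : t <= (G0 + 1)^-1.
    by near: t; apply: nbhs_right_le; rewrite invr_gt0 ltr_wpDl.
  move=> /(ler_wpM2r G00) /le_trans; apply; rewrite mulrC ler_pdivrMr ?ltr_wpDl// mul1r.
  by rewrite lerDl.
have tY : t * Y <= e / 2.
  have : t <= e / 2 / (Y + 1).
    by near: t; apply: nbhs_right_le; rewrite divr_gt0// ltr_wpDl.
  move=> /(ler_wpM2r Y0) /le_trans; apply.
  by rewrite mulrAC -mulrA ler_piMr ?(ltW e2)// ler_pdivrMr ?ltr_wpDl// mul1r lerDl.
have hsw' : (area ((fun z => radial_flow g p z.1 z.2) @` (`[0%R, t] `*` graph_set G))
       <= (t * (S + e / 2))%:E)%E by near: t; exact: hsw.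
have tg s : 0 <= s -> t * g s <= 1.
  by move=> s0; apply: le_trans tG; rewrite ler_pM2l//; exact: g_le.
rewrite swept_area0; last exact: radial_flow0.
pose q w := 1 - 2 * t * w + t ^+ 2 * G0 ^+ 2.
have piece U C w : open U -> closed C ->
    (forall x, U x -> C x -> w <= g (sqdist p x) + sqdist p x * g' (sqdist p x)) ->
    (area (radial_flow g p t @` (Sigma `&` U `&` C)) <= (q w)%:E * area (Sigma `&` U `&` C))%E.
  move=> oU cC hw.
  apply: (@area_radial_flow R n g g' p gC dg G Sigma U C t (q w) hS Soo oU cC (ltW t0) tg g'_le0).
  move=> x Ux Cx; apply: jacobian_bound_le; first exact: ltW.
    exact: sqdist_ge0.
  exact: hw.
have P1 : (area (radial_flow g p t @` A1) <= (q w1 * V1)%:E)%E.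
  rewrite EFinM -E1; apply: piece; [exact: open_sqball|exact: closedT|].
  by move=> x xa _; apply: h1; [exact: sqdist_ge0|].
have cl r : closed (~` sqball r) by apply: open_closedC; exact: open_sqball.
have P2 : (area (radial_flow g p t @` A2) <= (q w2 * V2)%:E)%E.
  rewrite EFinM -E2; apply: piece; [exact: open_sqball|exact: cl|].
  by move=> x xb /negP; rewrite -leNgt => xa; apply: h2; [exact: sqdist_ge0| |].
have P3 : (area (radial_flow g p t @` A3) <= (q w3 * V3)%:E)%E.
  rewrite EFinM -E3; apply: piece; [exact: openT|exact: cl|].
  by move=> x _ /negP; rewrite -leNgt => xb; apply: h3; [exact: sqdist_ge0|].
have PS : (area (radial_flow g p t @` Sigma) <= (q w1 * V1 + q w2 * V2 + q w3 * V3)%:E)%E.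
  apply: (@le_trans _ _ (area (radial_flow g p t @` A1 `|` radial_flow g p t @` A2
     `|` radial_flow g p t @` A3))).
    apply: areaS => _ [x Sx <-].
    have [xb|xb] := pselect (sqball b x); last by right; exists x.
    left; have [xa|xa] := pselect (sqball a x); last by right; exists x.
    by left; exists x.
  rewrite !EFinD; apply: le_trans (areaU _ _) _; apply: leeD => //.
  by apply: le_trans (areaU _ _) _; apply: leeD.
have PA := leeD PS hsw'; rewrite -/(swept_area G Sigma (radial_flow g p) t) -EFinD in PA.
rewrite VS lee_pdivrMr// .
apply: le_trans (leeD2r _ PA) _; rewrite -EFinB -EFinM lee_fin.
have -> : q w1 * V1 + q w2 * V2 + q w3 * V3 + t * (S + e / 2) - (V1 + V2 + V3) =
   (- (2 * X) + S + e / 2 + t * Y) * t by rewrite /q /X /Y; ring.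
by apply: ler_wpM2r; [exact: ltW|lra].
Unshelve. all: by end_near. Qed.

End FirstVariation.

Section SmoothMax.
Variables (R : realType) (ep eta : R).
Hypotheses (ep0 : 0 < ep) (eta0 : 0 < eta).

(** A smooth approximation from below of [Num.max ep s], constant for
    [s <= ep]. *)
Definition smax (s : R) : R := ep + pospart eta (s - ep).

Lemma Ck_shift (k : nat) (c : R) : Ck_on k setT (fun s : R => s - c).
Proof. by apply: CkB; [exact: Ck_id|exact: Ck_cst]. Qed.

Lemma Ck_smax k : Ck_on k setT smax.
Proof.
apply: CkD; first exact: Ck_cst.
by apply: Ck_comp1; [exact: Ck_pospart|exact: Ck_shift].
Qed.

Lemma smax_ge s : ep <= smax s.
Proof. by rewrite lerDl pospart_ge0. Qed.

Lemma smax_gt0 s : 0 < smax s.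
Proof. exact: lt_le_trans ep0 (smax_ge s). Qed.

Lemma smax_ge_id s : s - eta <= smax s.
Proof. by have := pospart_ge eta0 (s - ep); rewrite /smax; lra. Qed.

Lemma smax_small s : s <= ep -> smax s = ep.
Proof. by move=> h; rewrite /smax pospart_npos ?addr0// subr_le0. Qed.

Definition dsmax (s : R) : R := dpospart eta (s - ep).

Lemma is_derive_smax (s : R) : is_derive s 1 smax (dsmax s).
Proof.
have h : is_derive s 1 (fun t : R => t - ep) 1.
  by have := is_deriveB (is_derive_id s 1) (is_derive_cst ep s 1); rewrite subr0.
have h2 := @is_derive1_comp R (pospart eta) (fun t => t - ep) s _ _ (is_derive_pospart eta0 (s - ep)) h.
by have := is_deriveD (is_derive_cst ep s 1) h2; rewrite add0r mulr1.
Qed.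

Lemma dsmax_itv s : 0 <= dsmax s <= 1. Proof. exact: dpospart_itv. Qed.

Lemma dsmax_small s : s <= ep -> dsmax s = 0.
Proof. by move=> h; rewrite /dsmax dpospart_npos// subr_le0. Qed.

Definition isq (s : R) : R := (smax s)^-1.
Definition disq (s : R) : R := - dsmax s / smax s ^+ 2.

Lemma Ck_isq k : Ck_on k setT isq.
Proof. by apply: CkV; [move=> s; rewrite gt_eqF ?smax_gt0|exact: Ck_smax]. Qed.

Lemma is_derive_isq (s : R) : is_derive s 1 isq (disq s).
Proof.
have m0 : smax s != 0 by rewrite gt_eqF ?smax_gt0.
have [d e] := is_derive_smax s; split; first exact: derivableV.
by rewrite (deriveV m0 d) e /disq /GRing.scale /= !mulNr mulrC.
Qed.

Lemma isq_ge0 s : 0 <= isq s. Proof. by rewrite invr_ge0 ltW ?smax_gt0. Qed.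

Lemma isq_le s : isq s <= ep^-1.
Proof. by rewrite lef_pV2 ?posrE ?smax_gt0// smax_ge. Qed.

Lemma disq_le0 s : disq s <= 0.
Proof.
have /andP[d0 _] := dsmax_itv s.
by rewrite /disq mulNr oppr_le0 mulr_ge0// invr_ge0 sqr_ge0.
Qed.

Lemma isq_div_small s : s <= ep -> isq s + s * disq s = ep^-1.
Proof. by move=> h; rewrite /isq /disq smax_small// dsmax_small// oppr0 mul0r mulr0 addr0. Qed.

(** For [Num.max ep s] itself the bounded quantity is [1 / ep] in the ball and 0
    outside. *)
Lemma isq_div s : 0 <= s -> - (eta / ep ^+ 2) <= isq s + s * disq s.
Proof.
move=> s0; have m0 := smax_gt0 s; have /andP[d0 d1] := dsmax_itv s.
have -> : isq s + s * disq s = (smax s - s * dsmax s) / smax s ^+ 2.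
  by rewrite /isq /disq; field; rewrite gt_eqF.
have h : - eta <= smax s - s * dsmax s.
  have : s * dsmax s <= s by rewrite ler_piMr.
  by have := smax_ge_id s; lra.
apply: (@le_trans _ _ (- eta / smax s ^+ 2)); last first.
  by apply: ler_wpM2r => //; rewrite invr_ge0 sqr_ge0.
rewrite mulNr lerN2; apply: ler_wpM2l; first exact: ltW.
by rewrite lef_pV2 ?posrE ?exprn_gt0// ler_pXn2r ?nnegrE ?(ltW ep0) ?(ltW m0)// smax_ge.
Qed.

Variable b : R.
Hypothesis b0 : 0 < b.

(** The positive part of [1 / s - 1 / b], smoothed. *)
Definition cutoff (s : R) : R := pospart eta (isq s - b^-1).
Definition dcutoff (s : R) : R := dpospart eta (isq s - b^-1) * disq s.

Lemma Ck_cutoff k : Ck_on k setT cutoff.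
Proof.
apply: Ck_comp1; first exact: Ck_pospart.
by apply: CkB; [exact: Ck_isq|exact: Ck_cst].
Qed.

Lemma is_derive_cutoff (s : R) : is_derive s 1 cutoff (dcutoff s).
Proof.
have h : is_derive s 1 (fun t : R => isq t - b^-1) (disq s).
  by have := is_deriveB (is_derive_isq s) (is_derive_cst b^-1 s 1); rewrite subr0.
exact: (@is_derive1_comp R (pospart eta) (fun t => isq t - b^-1) s _ _ (is_derive_pospart eta0 (isq s - b^-1)) h).
Qed.

Lemma cutoff_ge0 s : 0 <= cutoff s. Proof. exact: pospart_ge0. Qed.

Lemma cutoff_le s : cutoff s <= ep^-1.
Proof.
have [h|h] := leP (isq s - b^-1) 0; first by rewrite /cutoff pospart_npos// invr_ge0 ltW.
apply: le_trans (pospart_le eta0 (ltW h)) _; apply: le_trans (isq_le s).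
by rewrite lerBlDr lerDl invr_ge0 ltW.
Qed.

Lemma dcutoff_le0 s : dcutoff s <= 0.
Proof.
have /andP[d0 _] := dpospart_itv eta0 (isq s - b^-1).
by rewrite /dcutoff mulr_ge0_le0// disq_le0.
Qed.

Lemma cutoff_large s : b + eta <= s -> isq s - b^-1 <= 0.
Proof.
move=> bs; rewrite subr_le0 lef_pV2 ?posrE ?smax_gt0//.
by have := smax_ge_id s; lra.
Qed.

Lemma cutoff_div_large s : b + eta <= s -> cutoff s + s * dcutoff s = 0.
Proof.
move=> /cutoff_large h.
by rewrite /cutoff /dcutoff pospart_npos// dpospart_npos// mul0r mulr0 addr0.
Qed.

Lemma cutoff_div_small s : s <= ep -> ep^-1 - b^-1 - eta <= cutoff s + s * dcutoff s.
Proof.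
move=> h; rewrite /dcutoff /disq dsmax_small// oppr0 mul0r !mulr0 addr0.
have -> : ep^-1 = isq s by rewrite /isq smax_small.
exact: pospart_ge.
Qed.

(** This crude bound is used only in the shell between the two balls of the
    monotonicity formula, where the sharp limit is [- 1 / b]. *)
Lemma cutoff_div s : 0 <= s -> - (b^-1 + eta + eta / ep ^+ 2) <= cutoff s + s * dcutoff s.
Proof.
move=> s0; have q0 : 0 <= eta / ep ^+ 2 by rewrite divr_ge0 ?sqr_ge0// ltW.
have ib : 0 < b^-1 by rewrite invr_gt0.
have [h|h] := leP (isq s - b^-1) 0.
  rewrite /cutoff /dcutoff pospart_npos// dpospart_npos// mul0r mulr0 addr0.
  by have := eta0; lra.
have h1 := pospart_ge eta0 (isq s - b^-1).
have /andP[d0 d1] := dpospart_itv eta0 (isq s - b^-1).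
have sd : s * disq s <= 0 by rewrite mulr_ge0_le0// disq_le0.
have : s * disq s <= s * dcutoff s.
  rewrite /dcutoff -subr_ge0; set D := dpospart _ _ in d0 d1 *.
  have -> : s * (D * disq s) - s * disq s = (1 - D) * - (s * disq s) by ring.
  by rewrite mulr_ge0 ?subr_ge0 ?oppr_ge0.
have := isq_div s0; rewrite /cutoff; lra.
Qed.

End SmoothMax.

Section Monotonicity.
Variables (R : realType) (n : nat) (G : graph R n) (Sigma : set 'rV[R]_n).
Hypotheses (hS : surface_class G Sigma) (hst : strongly_stationary G Sigma).
Variable p : 'rV[R]_n.
Local Notation V := (ball_area Sigma p).

(** With the profile [max (1 / max ep s - 1 / b) 0] the graph does not move, so
    the first variation reads
    [(1 / ep - 1 / b) V ep - 1 / b * (V b - V ep) <= 0] in the limit. *)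
Lemma ball_area_monotone (ep b : R) : 0 < ep -> ep < b ->
  (forall x, graph_set G x -> b <= sqdist p x) -> V ep / ep <= V b / b.
Proof.
move=> ep0 epb hG; have b0 : 0 < b by exact: lt_trans epb.
have V1 := ball_area_ge0 Sigma p ep; have Vb := ball_area_ge0 Sigma p b.
pose d := (b - ep) / 2; have d0 : 0 < d by rewrite divr_gt0// subr_gt0.
have key eta : 0 < eta -> eta < d -> V ep / ep <= V b / (b - eta) + eta * (V ep + (V b - V ep) * (1 + ep ^- 2)).
  move=> eta0 etad; pose b' := b - eta.
  have b'0 : 0 < b' by rewrite /b' /d in etad *; lra.
  have epb' : ep <= b' by rewrite /b' /d in etad *; lra.
  have c1 k : Ck_on k setT (cutoff ep eta b') by exact: Ck_cutoff.
  have c2 (s : R) : is_derive s 1 (cutoff ep eta b') (dcutoff ep eta b' s).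
    exact: is_derive_cutoff.
  have c3 s : 0 <= s -> 0 <= cutoff ep eta b' s by move=> _; exact: cutoff_ge0.
  have c4 s : 0 <= s -> cutoff ep eta b' s <= ep^-1 by move=> _; exact: cutoff_le.
  have c5 s : 0 <= s -> dcutoff ep eta b' s <= 0 by move=> _; exact: dcutoff_le0.
  have := @radial_first_variation R n G Sigma hS hst p (cutoff ep eta b') (dcutoff ep eta b') ep^-1
    c1 c2 c3 c4 c5 ep b (ep^-1 - b'^-1 - eta) (- (b'^-1 + eta + eta / ep ^+ 2)) 0 0 (ltW epb).
  rewrite mul0r addr0 => h.
  have {}h : 2 * ((ep^-1 - b'^-1 - eta) * V ep + - (b'^-1 + eta + eta / ep ^+ 2) * (V b - V ep)) <= 0.
    apply: h.
    - by move=> s _ sep; exact: cutoff_div_small (ltW sep).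
    - by move=> s s0 _ _; exact: cutoff_div.
    - by move=> s _ sb; rewrite cutoff_div_large// /b' subrK.
    - move=> e e0; near=> t.
      have t0 : 0 < t by near: t; exact: nbhs_right_gt.
      rewrite (_ : _ @` _ = graph_set G); first by rewrite area_graph_set lee_fin add0r mulr_ge0// ltW.
      have fixed x : graph_set G x -> radial_flow (cutoff ep eta b') p ^~ x = cst x.
        move=> Gx; apply/funext => s; rewrite /radial_flow /cutoff pospart_npos ?mulr0 ?scale0r ?subr0//.
        by apply: cutoff_large => //; rewrite /b' subrK; exact: hG.
      apply/seteqP; split => [_ [[s x] [/= _ Gx] <-]|x Gx].
        by have := fixed x Gx => /(congr1 (fun f => f s)) /= ->.
      exists (0, x) => /=; first by split => //=; rewrite in_itv /= lexx ltW.
      exact: radial_flow0.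
  rewrite -/b'; move: h; set i := ep^-1; set j := b'^-1; set q := ep ^- 2.
  by rewrite -/j; lra.
apply: (@le_trans _ _ (V b / b + 0)); last by rewrite addr0.
apply/ler_addgt0Pr => e e0.
pose C' := V b * 2 / b ^+ 2 + `|V ep + (V b - V ep) * (1 + ep ^- 2)|.
have C'0 : 0 <= C' by rewrite addr_ge0// divr_ge0 ?sqr_ge0// mulr_ge0.
have C'1 : 0 < C' + 1 by rewrite ltr_wpDl.
pose eta := Num.min (d / 2) (e / (C' + 1)).
have eta0 : 0 < eta by rewrite lt_min; apply/andP; split; exact: divr_gt0.
have etad : eta < d by rewrite gt_min; apply/orP; left; lra.
apply: le_trans (key _ eta0 etad) _; rewrite addr0.
have eC : eta * C' <= e.
  apply: (@le_trans _ _ (e / (C' + 1) * C')).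
    by apply: ler_wpM2r => //; rewrite ge_min lexx orbT.
  by rewrite mulrAC -mulrA ler_piMr ?(ltW e0)// ler_pdivrMr ?ltr_wpDl// mul1r lerDl.
have be : 0 < b - eta by rewrite /d in etad; lra.
have h1 : (b - eta)^-1 <= b^-1 + eta * (2 / b ^+ 2).
  rewrite -subr_ge0.
  have -> : b^-1 + eta * (2 / b ^+ 2) - (b - eta)^-1 = eta * (b - 2 * eta) / (b ^+ 2 * (b - eta)).
    by field; rewrite !gt_eqF.
  have b2 : 0 <= b - 2 * eta by have := etad; rewrite /d; lra.
  by apply: divr_ge0; apply: mulr_ge0 => //; [exact: ltW|exact: sqr_ge0|exact: ltW].
have h2 := ler_wpM2l Vb h1.
have h3 : eta * (V ep + (V b - V ep) * (1 + ep ^- 2)) <= eta * `|V ep + (V b - V ep) * (1 + ep ^- 2)|.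
  by apply: ler_wpM2l; [exact: ltW|exact: ler_norm].
apply: le_trans (lerD h2 h3) _.
have -> : V b * (b^-1 + eta * (2 / b ^+ 2)) + eta * `|V ep + (V b - V ep) * (1 + ep ^- 2)| =
  V b / b + eta * C' by rewrite /C'; ring.
by rewrite lerD2l.
Unshelve. all: by end_near. Qed.

(** With the profile [1 / max ep s] the divergence is [1 / ep] in the ball and 0
    outside; the smoothing costs [eta / ep ^+ 2] times the total area. *)
Lemma ball_area_le_sweep (ep S : R) : 0 < ep ->
  (forall e, 0 < e -> exists2 d, 0 < d & forall eta, 0 < eta -> eta < d ->
    \forall t \near 0^'+,
    (area ((fun z => radial_flow (isq ep eta) p z.1 z.2) @` (`[0%R, t] `*` graph_set G))
       <= (t * (S + e))%:E)%E) ->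
  2 * (V ep / ep) <= S.
Proof.
move=> ep0 hsw.
have W0 : 0 <= fine (area Sigma) by rewrite fine_ge0// area_ge0.
set W := fine (area Sigma) in W0.
apply/ler_addgt0Pr => e e0; have e2 : 0 < e / 2 by rewrite divr_gt0.
have [d d0 hd] := hsw _ e2.
have V1 := ball_area_ge0 Sigma p ep.
have VW : V ep <= W.
  rewrite -lee_fin -(ball_areaE hst) /W fineK; first by apply: areaS => x [].
  exact: (fin_subarea hst).
pose C := 2 * W / ep ^+ 2; have C0 : 0 <= C by rewrite divr_ge0 ?sqr_ge0// mulr_ge0.
pose eta := Num.min (d / 2) (e / 4 / (C + 1)).
have eta0 : 0 < eta by rewrite lt_min !divr_gt0// ltr_wpDl.
have etad : eta < d by rewrite gt_min; apply/orP; left; lra.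
have c1 k : Ck_on k setT (isq ep eta) by exact: Ck_isq.
have c2 (s : R) : is_derive s 1 (isq ep eta) (disq ep eta s) by exact: is_derive_isq.
have c3 s : 0 <= s -> 0 <= isq ep eta s by move=> _; exact: isq_ge0.
have c4 s : 0 <= s -> isq ep eta s <= ep^-1 by move=> _; exact: isq_le.
have c5 s : 0 <= s -> disq ep eta s <= 0 by move=> _; exact: disq_le0.
have := @radial_first_variation R n G Sigma hS hst p (isq ep eta) (disq ep eta) ep^-1
    c1 c2 c3 c4 c5 ep ep ep^-1 (- (eta / ep ^+ 2)) (- (eta / ep ^+ 2)) (S + e / 2) (lexx _).
rewrite subrr mulr0 addr0 => h.
have {}h : 2 * (ep^-1 * V ep + - (eta / ep ^+ 2) * (W - V ep)) <= S + e / 2.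
  apply: h.
  - by move=> s _ sep; rewrite isq_div_small// ltW.
  - by move=> s s0 _ _; exact: isq_div.
  - by move=> s s0 _; exact: isq_div.
  - move=> e' e'0; have hh := hd _ eta0 etad.
    near=> t; have t0 : 0 < t by near: t; exact: nbhs_right_gt.
    have : (area ((fun z => radial_flow (isq ep eta) p z.1 z.2) @` (`[0%R, t] `*` graph_set G))
       <= (t * (S + e / 2))%:E)%E by near: t.
    by move=> /le_trans; apply; rewrite lee_fin ler_pM2l// lerDl ltW.
have eC : eta * C <= e / 4.
  apply: (@le_trans _ _ (e / 4 / (C + 1) * C)).
    by apply: ler_wpM2r => //; rewrite ge_min lexx orbT.
  by rewrite mulrAC -mulrA ler_piMr ?divr_ge0 ?(ltW e0)// ler_pdivrMr ?ltr_wpDl// mul1r lerDl.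
have hC : 2 * (eta / ep ^+ 2) * (W - V ep) <= eta * C.
  rewrite /C (_ : eta * (2 * W / ep ^+ 2) = 2 * (eta / ep ^+ 2) * W); last by ring.
  apply: ler_wpM2l; last by rewrite lerBlDr lerDl.
  by rewrite mulr_ge0// divr_ge0 ?sqr_ge0// ltW.
move: h hC; rewrite (mulrC (V ep)); lra.
Unshelve. all: by end_near. Qed.

End Monotonicity.

(** * The area swept by an arc *)

(** The supremum of the points reached from [a] is the end of the interval. *)
Lemma interval_induction (R : realType) (Q : R -> R -> Prop) (a b : R) : a <= b ->
  (forall x y z, x <= y -> y <= z -> Q x y -> Q y z -> Q x z) ->
  (forall s, a <= s <= b -> exists2 d, 0 < d & forall x y, a <= x -> x <= y -> y <= b ->
     s - d < x -> y < s + d -> Q x y) ->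
  Q a b.
Proof.
move=> ab Qtrans Qloc; pose S := [set x | a <= x <= b /\ Q a x].
have Sa : S a.
  split; first by rewrite lexx.
  by have [|d d0 h] := Qloc a; [rewrite lexx|apply: h => //; lra].
have hS : has_sup S by split; [exists a|exists b => x [/andP[]]].
have as_ : a <= sup S by apply: ub_le_sup => //; exact: hS.2.
have sb : sup S <= b by apply: ge_sup => [|x [/andP[]]]; first by exists a.
have [|d d0 h] := Qloc (sup S); first by rewrite as_.
have [x [/andP[ax xb] Qx] xs] := sup_adherent d0 hS.
have xle : x <= sup S by apply: ub_le_sup; [exact: hS.2|split => //; rewrite ax].
pose y := Num.min b (sup S + d / 2).
have xy : x <= y by rewrite le_min xb; lra.
have yb : y <= b by rewrite ge_min lexx.
have yd : y < sup S + d by rewrite gt_min; apply/orP; right; lra.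
have Qy : Q a y by apply: (Qtrans a x y) => //; apply: h.
have ys : y <= sup S by apply: ub_le_sup; [exact: hS.2|split => //; rewrite (le_trans ax)].
have yE : y = b.
  move: ys; rewrite /y ge_min => /orP[h1|]; last lra.
  by apply/le_anti; rewrite yb le_min lexx /=; lra.
by rewrite -yE.
Qed.

Lemma sqr_mean_le (R : realFieldType) (x y : R) : (x + y) ^+ 2 / 4 <= x ^+ 2 + y ^+ 2.
Proof. by have := sqr_ge0 (x - y); have := sqr_ge0 (x + y); nra. Qed.

Section Strip.
Variables (R : realType) (n : nat).

(** The mean value inequality where the velocity is nearly constant. *)
Lemma C1_curve_strict (h : R -> 'rV[R]_n) (s0 e : R) : @Ck_on R R^o 'rV[R]_n 1 setT h ->
  0 < e -> exists2 d, 0 < d & forall s s', `|s - s0| < d -> `|s' - s0| < d ->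
    enorm (h s - h s' - (s - s') *: derive1 h s0) <= e * `|s - s'|.
Proof.
move=> hC e0.
have := Ck1_continuous_derive1 (t := s0) hC => /enorm_cvg/(_ e e0)/nbhs_ballP[d /= d0 hd].
have near s : `|s - s0| < d -> enorm (derive1 h s - derive1 h s0) <= e.
  by move=> sd; apply/ltW; apply: hd; rewrite -ball_normE /= distrC.
have main s s' : s' <= s -> `|s - s0| < d -> `|s' - s0| < d ->
    enorm (h s - h s' - (s - s') *: derive1 h s0) <= e * (s - s').
  move=> ss; rewrite !ltr_norml => /andP[? ?] /andP[? ?].
  apply: (@mean_value_enorm R n h (derive1 h)) => [//|u _|u /andP[? ?]].
    exact: (Ck1_is_derive u hC).
  by apply: near; rewrite ltr_norml; apply/andP; split; lra.
exists d => // s s' hs hs'; have [ss|/ltW ss] := leP s' s.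
  by rewrite ger0_norm ?subr_ge0//; exact: main.
rewrite distrC ger0_norm ?subr_ge0// -enormN.
rewrite [X in enorm X](_ : _ = h s' - h s - (s' - s) *: derive1 h s0); first exact: main.
by apply/rowP => i; rewrite !mxE; ring.
Qed.

Variables (c Y : R -> 'rV[R]_n).
Hypotheses (cC : @Ck_on R R^o 'rV[R]_n 1 setT c) (YC : @Ck_on R R^o 'rV[R]_n 1 setT Y).

Definition strip (a b t : R) : set 'rV[R]_n :=
  [set c z.1 + z.2 *: Y z.1 | z in [set z : R * R | a <= z.1 <= b /\ 0 <= z.2 <= t]].

(** The area of the parallelogram spanned by the velocity and by [Y]. *)
Definition strip_speed (s : R) : R :=
  Num.sqrt (dotp (derive1 c s) (derive1 c s) * dotp (Y s) (Y s) -
            dotp (derive1 c s) (Y s) ^+ 2).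

Lemma strip_speed_continuous : continuous strip_speed.
Proof.
have c0 : @Ck_on R R^o 'rV[R]_n 0 setT (derive1 c).
  by move=> x _; exact: (@Ck1_continuous_derive1 R n c x cC).
have Y0 : @Ck_on R R^o 'rV[R]_n 0 setT Y := CkS YC.
have h : @Ck_on R R^o R 0 setT (fun s => dotp (derive1 c s) (derive1 c s) * dotp (Y s) (Y s) -
            dotp (derive1 c s) (Y s) * dotp (derive1 c s) (Y s)).
  by apply: CkB; apply: CkM; exact: Ck_dotp.
move=> s; apply: (@continuous_comp _ _ _ (fun s => dotp (derive1 c s) (derive1 c s) * dotp (Y s) (Y s) -
            dotp (derive1 c s) (Y s) * dotp (derive1 c s) (Y s)) Num.sqrt).
  exact: h.
exact: sqrt_continuous.
Qed.

(** Near a parameter [s0] and for small [t] a strip is nearly a parallelogram, and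
    [P] increases at least as fast as the area of that parallelogram; such local
    estimates add up along the arc.  Using a primitive [P] instead of an integral
    allows for any function that is convenient to differentiate. *)
Lemma area_strip_le (a b e : R) (P P' : R -> R) : a <= b -> 0 < e ->
  (forall s, a <= s <= b -> is_derive s 1 P (P' s)) ->
  (forall s, a <= s <= b -> strip_speed s <= P' s) ->
  \forall t \near 0^'+, (area (strip a b t) <= (t * (P b - P a + e * (b - a)))%:E)%E.
Proof.
move=> ab e0 dP hP.
pose Q x y := a <= x -> y <= b ->
  \forall t \near 0^'+, (area (strip x y t) <= (t * (P y - P x + e * (y - x)))%:E)%E.
suff : Q a b by apply.
apply: (@interval_induction R Q) => // [x y z xy yz hxy hyz ax zb|s0 s0ab].
  near=> t.
  have h1 : (area (strip x y t) <= (t * (P y - P x + e * (y - x)))%:E)%E.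
    by near: t; apply: hxy => //; exact: le_trans zb.
  have h2 : (area (strip y z t) <= (t * (P z - P y + e * (z - y)))%:E)%E.
    by near: t; apply: hyz => //; exact: le_trans xy.
  apply: (@le_trans _ _ (area (strip x y t `|` strip y z t))).
    apply: areaS => _ [[s u] /= [/andP[xs sz] hu] <-].
    have [sy|/ltW ys] := leP s y; [left|right]; exists (s, u) => //=; split => //.
      by rewrite xs.
    by rewrite ys.
  apply: le_trans (areaU _ _) _; apply: le_trans (leeD h1 h2) _.
  by rewrite -EFinD lee_fin le_eqVlt; apply/orP; left; apply/eqP; ring.
have e2 : 0 < e / 2 by rewrite divr_gt0.
(* A strip over a short interval is the image of a rectangle by a map close to an affine one. *)
pose La := enorm (derive1 c s0) + enorm (Y s0).
have [|eta eta0 hquad] := @quad_perturb R La (e / 2) _ e2; first by rewrite addr_ge0 ?enorm_ge0.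
have [||A [B [C [A0 D0 sD hq]]]] := hquad n (derive1 c s0) (Y s0).
- by rewrite lerDl enorm_ge0.
- by rewrite lerDr enorm_ge0.
have eta4 : 0 < eta / 4 by rewrite divr_gt0.
have [d1 d10 h1] := C1_curve_strict s0 cC eta4.
have [d2 d20 h2] := C1_curve_strict s0 YC ltr01.
pose La' := enorm (derive1 Y s0) + 1.
have La'0 : 0 < La' by rewrite ltr_wpDl ?enorm_ge0.
have YLip s s' : `|s - s0| < d2 -> `|s' - s0| < d2 -> enorm (Y s - Y s') <= La' * `|s - s'|.
  move=> hs hs'; rewrite -(subrK ((s - s') *: derive1 Y s0) (Y s - Y s')).
  apply: le_trans (enormD _ _) _; rewrite enormZ /La' mulrDl addrC mulrC mul1r.
  by apply: lerD => //; have := h2 s s' hs hs'; rewrite mul1r.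
have [d3 d30 h3] : exists2 d, 0 < d & forall s, `|s - s0| < d -> strip_speed s0 - e / 2 <= strip_speed s.
  have := @strip_speed_continuous s0 => /cvgrPdist_lt/(_ _ e2)/nbhs_ballP[d /= d0 hd].
  exists d => // s sd; have := hd s; rewrite -ball_normE /= distrC => /(_ sd).
  by rewrite ltr_norml => /andP[]; lra.
pose d := Num.min d1 (Num.min d2 (Num.min d3 (eta / (2 * La')))).
have d0 : 0 < d by rewrite !lt_min d10 d20 d30 divr_gt0// mulr_gt0.
exists d => // x y ax xy yb xd yd ax' yb'.
have inb s : x <= s <= y -> [/\ `|s - s0| < d1, `|s - s0| < d2, `|s - s0| < d3 &
    `|s - s0| <= eta / (2 * La')].
  move=> /andP[xs sy]; have : `|s - s0| < d by rewrite ltr_distl (lt_le_trans xd xs) (le_lt_trans sy yd).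
  by rewrite !lt_min => /and4P[? ? ? /ltW ?].
near=> t.
have t0 : 0 < t by near: t; exact: nbhs_right_gt.
have tL : t * La' <= eta / 4.
  have : t <= eta / 4 / La' by near: t; apply: nbhs_right_le; rewrite divr_gt0.
  by rewrite ler_pdivlMr.
have yx : 0 <= y - x by rewrite subr_ge0.
have cell : (area (strip x y t) <= (fine (unit_square_area R) * Num.sqrt (A * C - B ^+ 2) * (y - x) * t)%:E)%E.
  apply: le_trans (@area_quad R n (fun s u => c s + u *: Y s) A B C x 0 (y - x) t A0 D0 yx (ltW t0) _).
    by apply: areaS => _ [z hz <-]; exists z => //; rewrite /= subrKC add0r.
  move=> s u s' u'; rewrite subrKC add0r => hs /andP[u0 ut] hs' /andP[u'0 u't].
  have [s1 s2 _ s4] := inb _ hs; have [s1' s2' _ s4'] := inb _ hs'.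
  pose err := (c s - c s' - (s - s') *: derive1 c s0) + u *: (Y s - Y s') + (u - u') *: (Y s' - Y s0).
  have -> : c s + u *: Y s - (c s' + u' *: Y s') =
      (s - s') *: derive1 c s0 + (u - u') *: Y s0 + err.
    by apply/rowP => i; rewrite /err !mxE; ring.
  apply: hq.
  have herr : enorm err <= eta / 2 * (`|s - s'| + `|u - u'|).
    apply: le_trans (enormD _ _) _; rewrite mulrDr; apply: lerD.
      apply: le_trans (enormD _ _) _; rewrite enormZ (ger0_norm u0).
      have a1 := h1 s s' s1 s1'.
      have a2 : u * enorm (Y s - Y s') <= eta / 4 * `|s - s'|.
        apply: (@le_trans _ _ (t * (La' * `|s - s'|))).
          by apply: ler_pM => //; [exact: enorm_ge0|exact: YLip].
        by rewrite mulrA; apply: ler_wpM2r.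
      rewrite (_ : eta / 2 = eta / 4 + eta / 4); last by field.
      by rewrite mulrDl; exact: lerD.
    rewrite enormZ mulrC; apply: ler_wpM2r => //.
    have d2s0 : `|s0 - s0| < d2 by rewrite subrr normr0.
    apply: le_trans (YLip s' s0 s2' d2s0) _.
    apply: le_trans (ler_wpM2l (ltW La'0) s4') _.
    by rewrite le_eqVlt; apply/orP; left; apply/eqP; field; rewrite gt_eqF.
  apply: (@le_trans _ _ ((eta / 2 * (`|s - s'| + `|u - u'|)) ^+ 2)).
    have r0 : 0 <= eta / 2 * (`|s - s'| + `|u - u'|).
      by apply: mulr_ge0; [rewrite divr_ge0// ltW|rewrite addr_ge0].
    by rewrite ler_pXn2r ?nnegrE ?enorm_ge0.
  rewrite exprMn -[(s - s') ^+ 2]real_normK ?num_real// -[(u - u') ^+ 2]real_normK ?num_real//.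
  set p := `|s - s'|; set q := `|u - u'|.
  rewrite (_ : (eta / 2) ^+ 2 * (p + q) ^+ 2 = eta ^+ 2 * ((p + q) ^+ 2 / 4)); last by field.
  apply: ler_wpM2l; first exact: sqr_ge0.
  exact: sqr_mean_le.
apply: le_trans cell _; rewrite lee_fin.
have low : (strip_speed s0 - e / 2) * (y - x) <= P y - P x.
  have [||xi /[!in_itv]/= xixy ->] := @MVT_segment R P P' x y xy.
  - by move=> s /[!in_itv]/= /andP[xs sy]; apply: dP; rewrite (le_trans ax (ltW xs)) (le_trans (ltW sy) yb).
  - apply: derivable_within_continuous => s /[!in_itv]/= /andP[xs sy].
    have sab : a <= s <= b by rewrite (le_trans ax xs) (le_trans sy yb).
    exact: (@ex_derive _ _ _ _ _ _ _ (dP s sab)).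
  apply: ler_wpM2r => //; have [_ _ s3 _] := inb _ xixy.
  apply: le_trans (h3 _ s3) _; apply: hP.
  by move: xixy => /andP[h4 h5]; rewrite (le_trans ax h4) (le_trans h5 yb).
apply: (@le_trans _ _ (1 * (strip_speed s0 + e / 2) * (y - x) * t)).
  apply: ler_wpM2r; first exact: ltW.
  apply: ler_wpM2r => //; apply: ler_pM => //.
  - exact: unit_square_area_ge0.
  - exact: unit_square_area_le1.
rewrite mulrC; apply: ler_wpM2l; first exact: ltW.
by move: low; rewrite mul1r !mulrDl mulNr; lra.
Unshelve. all: by end_near. Qed.

End Strip.

(** * The angle between an arc and the rays *)

Section Arccosine.
Variable R : realType.

(** One-sided continuity of [acos], including the end points where it is not
    differentiable. *)
Lemma acos_le_near (u e : R) : -1 <= u <= 1 -> 0 < e ->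
  exists2 d, 0 < d & forall x, -1 <= x <= 1 -> u - d < x -> acos x <= acos u + e.
Proof.
move=> u1 e0; have [pe|ep] := leP pi (acos u + e).
  by exists 1 => // x x1 _; apply: le_trans pe; exact: acos_lepi.
have a0 := acos_ge0 u1.
have uK : cos (acos u) = u by apply: acosK; rewrite in_itv.
have ae : acos u + e \in `[0, pi] by rewrite in_itv /= ltW ?(ltW ep)// ltr_wpDl.
have au : acos u \in `[0, pi] by rewrite in_itv /= a0 acos_lepi.
exists (u - cos (acos u + e)).
  by rewrite subr_gt0 -{2}uK ltr_cos// ltrDl.
move=> x x1; rewrite subKr => h; rewrite leNgt; apply/negP => ax.
have xI : acos x \in `[0, pi] by rewrite in_itv /= acos_ge0// acos_lepi.
have xK : cos (acos x) = x by apply: acosK; rewrite in_itv.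
by move: h; rewrite -{1}xK ltr_cos// ltNge (ltW ax).
Qed.

Lemma acos_ge_near (u e : R) : -1 <= u <= 1 -> 0 < e ->
  exists2 d, 0 < d & forall x, -1 <= x <= 1 -> x < u + d -> acos u - e <= acos x.
Proof.
move=> u1 e0; have u1' : -1 <= - u <= 1 by case/andP: u1 => ? ?; apply/andP; split; lra.
have [d d0 h] := acos_le_near u1' e0; exists d => // x x1 xd.
have x1' : -1 <= - x <= 1 by case/andP: x1 => ? ?; apply/andP; split; lra.
have : - u - d < - x by lra.
by move=> /(h _ x1'); rewrite !acosN//; lra.
Qed.

(** Here [k] is the speed at which the tangent turns, [V] the speed of the arc
    divided by the distance to [p], [u] the cosine of the angle, and [De] the
    part of the derivative of [u] due to the turning.  With
    [q = sqrt (1 - u ^ 2)] and [Q = sqrt (lam ^ 2 - u ^ 2)], one has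
    [De >= - k Q] and [q - q ^ 2 / Q <= Q - q <= sqrt (lam ^ 2 - 1)]. *)
Lemma turning_bound (k De u V C lam : R) : u ^+ 2 <= 1 -> 1 < lam -> 0 <= k -> 0 <= V -> V <= C ->
  - (k * Num.sqrt (1 - u ^+ 2)) <= De ->
  V * Num.sqrt (1 - u ^+ 2) <=
  k + (De + V * (1 - u ^+ 2)) / Num.sqrt (lam ^+ 2 - u ^+ 2) + C * Num.sqrt (lam ^+ 2 - 1).
Proof.
move=> u1 l1 k0 V0 VC hDe.
have l2 : 1 < lam ^+ 2 by rewrite expr_gt1// ltW// (lt_trans ltr01).
set w := 1 - u ^+ 2 in hDe *; have w0 : 0 <= w by rewrite subr_ge0.
set de := lam ^+ 2 - 1; have de0 : 0 < de by rewrite subr_gt0.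
have -> : lam ^+ 2 - u ^+ 2 = w + de by rewrite /w /de; ring.
set q := Num.sqrt w in hDe *; set Q := Num.sqrt (w + de); set z := Num.sqrt de.
have q0 : 0 <= q := sqrtr_ge0 _; have z0 : 0 <= z := sqrtr_ge0 _.
have wde : 0 < w + de by rewrite ltr_wpDl.
have Q0 : 0 < Q by rewrite sqrtr_gt0.
have qE : q ^+ 2 = w by rewrite sqr_sqrtr.
have zE : z ^+ 2 = de by rewrite sqr_sqrtr// ltW.
have QE : Q ^+ 2 = q ^+ 2 + z ^+ 2 by rewrite qE zE sqr_sqrtr// ltW.
have qQ : q <= Q by rewrite ler_wsqrtr// lerDl ltW.
have Qz : Q <= q + z.
  rewrite -(@ler_pXn2r _ 2)// ?nnegrE ?addr_ge0// ?(ltW Q0)// QE.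
  by have := mulr_ge0 q0 z0; rewrite sqrrD; lra.
rewrite -qE.
have -> : k + (De + V * q ^+ 2) / Q + C * z = (k * Q + (De + V * q ^+ 2) + C * z * Q) / Q.
  by field; rewrite gt_eqF.
rewrite ler_pdivlMr//.
have h1 : k * q <= k * Q by apply: ler_wpM2l.
have h2 : V * q * (Q - q) <= C * Q * z.
  apply: ler_pM; rewrite ?mulr_ge0 ?subr_ge0//; last by rewrite lerBlDl.
  by apply: ler_pM.
move: h1 h2 hDe; rewrite expr2; lra.
Qed.

End Arccosine.

Section UnitVector.
Variables (R : realType) (n : nat).
Implicit Types f : R -> 'rV[R]_n.

Lemma dotp_unit_vec (w : 'rV[R]_n) : w != 0 -> dotp (unit_vec w) (unit_vec w) = 1.
Proof.
move=> w0; rewrite dotpZl dotpZr -sqr_enorm expr2; field.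
by rewrite enorm_eq0.
Qed.

Lemma is_derive_enorm f (s : R) df : f s != 0 -> is_derive s 1 f df ->
  is_derive s 1 (fun t => enorm (f t)) (dotp (f s) df / enorm (f s)).
Proof.
move=> f0 hf; have h := is_derive_dotp hf hf.
have p0 : 0 < dotp (f s) (f s) by rewrite lt_def dotp_eq0 f0 dotp_ge0.
have := @is_derive1_comp R Num.sqrt (fun t => dotp (f t) (f t)) s _ _ (is_derive1_sqrt p0) h.
move=> h2; apply: (is_derive_eq h2); rewrite -/(enorm (f s)) (dotpC df).
by field; rewrite enorm_eq0.
Qed.

Lemma is_derive_scale (a : R -> R) f (s : R) da df : is_derive s 1 a da -> is_derive s 1 f df ->
  is_derive s 1 (fun t => a t *: f t) (da *: f s + a s *: df).
Proof.
move=> ha /is_derive_rV hf; apply/is_derive_rV => i.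
have := is_deriveM ha (hf i) => h.
have -> : (fun t => (a t *: f t) 0 i) = a * (fun t => f t 0 i).
  by apply/funext => t; rewrite !mxE.
by apply: (is_derive_eq h); rewrite !mxE /GRing.scale /=; ring.
Qed.

Definition dunit_vec (w dw : 'rV[R]_n) : 'rV[R]_n :=
  (enorm w)^-1 *: (dw - (dotp w dw / dotp w w) *: w).

Lemma is_derive_unit_vec f (s : R) df : f s != 0 -> is_derive s 1 f df ->
  is_derive s 1 (fun t => unit_vec (f t)) (dunit_vec (f s) df).
Proof.
move=> f0 hf; have e0 : enorm (f s) != 0 by rewrite enorm_eq0.
have hV : is_derive s 1 (fun t => (enorm (f t))^-1)
    (- (dotp (f s) df / enorm (f s) ^+ 3)).
  have := is_derive_enorm f0 hf; set N := fun t => enorm (f t).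
  rewrite -[fun t => (enorm (f t))^-1]/(fun t => (N t)^-1) -[enorm (f s)]/(N s) in e0 *; set k := dotp _ _; clearbody N k => -[dN eN].
  split; first exact: derivableV.
  by rewrite (deriveV e0 dN) eN /GRing.scale /=; field.
apply: (is_derive_eq (is_derive_scale hV hf)); rewrite /dunit_vec -sqr_enorm.
by apply/rowP => i; rewrite !mxE; field.
Qed.

Lemma dotp_dunit_vec (w dw : 'rV[R]_n) : w != 0 -> dotp (unit_vec w) (dunit_vec w dw) = 0.
Proof.
move=> w0; rewrite !(dotpZl, dotpZr, dotpBr) -sqr_enorm; field.
by rewrite enorm_eq0.
Qed.

Lemma dotp_unit_le1 (T E : 'rV[R]_n) : dotp T T = 1 -> dotp E E = 1 -> dotp T E ^+ 2 <= 1.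
Proof. by move=> TT EE; have := dotp_sqr_le T E; rewrite TT EE mulr1. Qed.

(** Only the component of [E] orthogonal to [T] contributes, and its length is
    the sine of the angle. *)
Lemma dotp_orth_ge (D T E : 'rV[R]_n) : dotp T D = 0 -> dotp T T = 1 -> dotp E E = 1 ->
  - (enorm D * Num.sqrt (1 - dotp T E ^+ 2)) <= dotp D E.
Proof.
move=> TD TT EE; set u := dotp T E.
have -> : dotp D E = dotp D (E - u *: T) by rewrite dotpBr dotpZr (dotpC D T) TD mulr0 subr0.
have -> : Num.sqrt (1 - u ^+ 2) = enorm (E - u *: T).
  rewrite /enorm !(dotpBl, dotpBr, dotpZl, dotpZr) TT EE (dotpC E T) -/u.
  by congr Num.sqrt; ring.
by have := dotp_le_enorm D (E - u *: T); rewrite ler_norml => /andP[].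
Qed.

End UnitVector.

Section ViewAngle.
Variables (R : realType) (n : nat) (c : R -> 'rV[R]_n) (p : 'rV[R]_n).
Hypothesis cC : @Ck_on R R^o 'rV[R]_n 1 setT c.

Definition tangent (s : R) : 'rV[R]_n := unit_vec (derive1 c s).

Definition view_cos (s : R) : R := dotp (tangent s) (unit_vec (c s - p)).

Definition view_rate (s : R) : R := enorm (derive1 c s) / enorm (c s - p).

Lemma is_derive_ray (s : R) : is_derive s 1 (fun t => c t - p) (derive1 c s).
Proof.
by have := is_deriveB (Ck1_is_derive s cC) (is_derive_cst p s 1); rewrite subr0.
Qed.

Lemma view_cos_sqr_le1 s : derive1 c s != 0 -> c s - p != 0 -> view_cos s ^+ 2 <= 1.
Proof. by move=> c0 r0; apply: dotp_unit_le1; exact: dotp_unit_vec. Qed.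

(** The first term comes from the turning of the tangent, the second from the
    rotation of the ray. *)
Lemma is_derive_view_cos (s : R) D : derive1 c s != 0 -> c s - p != 0 -> is_derive s 1 tangent D ->
  is_derive s 1 view_cos
    (dotp D (unit_vec (c s - p)) + view_rate s * (1 - view_cos s ^+ 2)).
Proof.
move=> c0 r0 hT; have hE := is_derive_unit_vec r0 (is_derive_ray s).
apply: (is_derive_eq (is_derive_dotp hT hE)); congr (_ + _).
have v0 : enorm (derive1 c s) != 0 by rewrite enorm_eq0.
have rr0 : enorm (c s - p) != 0 by rewrite enorm_eq0.
rewrite /view_rate /view_cos /tangent /dunit_vec /unit_vec.
move: (c s - p) (derive1 c s) rr0 v0 => y w y0 w0; rewrite !(dotpZl, dotpZr, dotpBr) -!sqr_enorm.
by rewrite (dotpC y); field; rewrite y0.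
Qed.

(** The division by [lam > 1] keeps [acos] away from the points where it is not
    differentiable. *)
Definition view_angle (lam s : R) : R := acos (view_cos s / lam).

Lemma view_cos_div lam s : 1 < lam -> derive1 c s != 0 -> c s - p != 0 ->
  -1 < view_cos s / lam < 1.
Proof.
move=> l1 c0 r0; have l0 : 0 < lam by exact: lt_trans l1.
have h := view_cos_sqr_le1 c0 r0.
rewrite -ltr_norml normrM normfV (gtr0_norm l0) ltr_pdivrMr// mul1r.
by apply: le_lt_trans l1; rewrite -(@ler_pXn2r _ 2) ?nnegrE// real_normK ?num_real// expr1n.
Qed.

Lemma is_derive_view_angle lam (s : R) D : 1 < lam -> derive1 c s != 0 -> c s - p != 0 ->
  is_derive s 1 tangent D ->
  is_derive s 1 (view_angle lam)
    (- ((dotp D (unit_vec (c s - p)) + view_rate s * (1 - view_cos s ^+ 2)) /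
        Num.sqrt (lam ^+ 2 - view_cos s ^+ 2))).
Proof.
move=> l1 c0 r0 hT; have l0 : 0 < lam by exact: lt_trans l1.
have h1 := is_deriveZ lam^-1 (is_derive_view_cos c0 r0 hT).
have hw := view_cos_div l1 c0 r0.
have h2 : is_derive s 1 (fun t => view_cos t / lam)
    ((dotp D (unit_vec (c s - p)) + view_rate s * (1 - view_cos s ^+ 2)) / lam).
  have -> : (fun t => view_cos t / lam) = lam^-1 *: view_cos.
    by apply/funext => t; rewrite /GRing.scale /= mulrC.
  by apply: (is_derive_eq h1); rewrite /GRing.scale /= mulrC.
apply: (is_derive_eq (@is_derive1_comp R (@acos R) _ s _ _ (is_derive1_acos hw) h2)).
have -> : Num.sqrt (lam ^+ 2 - view_cos s ^+ 2) = lam * Num.sqrt (1 - (view_cos s / lam) ^+ 2).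
  rewrite -{2}(ger0_norm (ltW l0)) -sqrtr_sqr -sqrtrM ?sqr_ge0//; congr Num.sqrt.
  by field; rewrite gt_eqF.
have q0 : 0 < Num.sqrt (1 - (view_cos s / lam) ^+ 2).
  by case/andP: hw => ? ?; rewrite sqrtr_gt0; nra.
by field; rewrite !gt_eqF.
Qed.

End ViewAngle.

(** * Curvature and the sweep of an arc *)

Section VectorLimits.
Variables (R : realType) (n : nat) (T : Type) (F : set_system T) (FF : Filter F).

Lemma coord_cvg (f : T -> 'rV[R]_n) (a : 'rV[R]_n) i : f @ F --> a ->
  (fun x => f x 0 i) @ F --> a 0 i.
Proof.
by move=> fa; apply: (@cvg_comp _ _ _ f (fun M : 'rV[R]_n => M 0 i) _ _ _ fa); exact: coord_continuous.
Qed.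

Lemma dotp_cvg (f g : T -> 'rV[R]_n) (a b : 'rV[R]_n) : f @ F --> a -> g @ F --> b ->
  (fun x => dotp (f x) (g x)) @ F --> dotp a b.
Proof.
move=> fa gb; apply: cvg_big => [|i _]; first exact: add_continuous.
by apply: cvgM; exact: coord_cvg.
Qed.

Lemma unit_vec_cvg (f : T -> 'rV[R]_n) (a : 'rV[R]_n) : a != 0 -> f @ F --> a ->
  (fun x => unit_vec (f x)) @ F --> unit_vec a.
Proof.
move=> a0 fa; apply: cvgZ => //; apply: cvgV; first by rewrite enorm_eq0.
by apply: continuous_cvg => //; exact: enorm_continuous.
Qed.

Lemma dunit_vec_cvg (f g : T -> 'rV[R]_n) (a b : 'rV[R]_n) : a != 0 -> f @ F --> a -> g @ F --> b ->
  (fun x => dunit_vec (f x) (g x)) @ F --> dunit_vec a b.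
Proof.
move=> a0 fa gb; apply: cvgZ.
  apply: cvgV; first by rewrite enorm_eq0.
  by apply: continuous_cvg => //; exact: enorm_continuous.
apply: cvgB => //; apply: cvgZ => //; apply: cvgM; first exact: dotp_cvg.
by apply: cvgV; [rewrite dotp_eq0|exact: dotp_cvg].
Qed.

End VectorLimits.

Section ArcSweep.
Variables (R : realType) (n : nat) (c : R -> 'rV[R]_n) (p : 'rV[R]_n).
Hypothesis cC : @Ck_on R R^o 'rV[R]_n 1 setT c.
Hypothesis cC2 : @Ck_on R R^o 'rV[R]_n 2 `]0, 1[%classic c.
Hypothesis c'0 : forall s, 0 <= s <= 1 -> derive1 c s != 0.
Variable b : R.
Hypothesis b0 : 0 < b.
Hypothesis hb : forall s, 0 <= s <= 1 -> b <= sqdist p (c s).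
Local Notation mu := (@lebesgue_measure R).

Definition turning (s : R) : R := enorm (derive1 (tangent c) s).

Lemma ray_neq0 s : 0 <= s <= 1 -> c s - p != 0.
Proof. by move=> /hb h; rewrite -dotp_eq0 gt_eqF// (lt_le_trans b0 h). Qed.

Lemma itvoo_cc (s : R) : 0 < s < 1 -> 0 <= s <= 1.
Proof. by move=> /andP[? ?]; rewrite !ltW. Qed.

Lemma is_derive_derive1 (s : R) : 0 < s < 1 -> is_derive s 1 (derive1 c) (derive1 (derive1 c) s).
Proof.
move=> s01; have [_ /(_ 1) [h _]] := cC2; have := h s; rewrite /= in_itv /= => /(_ s01).
rewrite (D1_derive1 c) => d; rewrite derive1E; apply: derivableP.
exact: (@diff_derivable _ R^o).
Qed.

Lemma continuous_derive2 (s : R) : 0 < s < 1 -> {for s, continuous (derive1 (derive1 c))}.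
Proof.
move=> s01; have [_ /(_ 1) [_ /(_ 1) h]] := cC2; have := h s; rewrite /= in_itv /= => /(_ s01).
rewrite (D1_derive1 c).
by rewrite (D1_derive1 (derive1 c)).
Qed.

Lemma is_derive_tangent (s : R) : 0 < s < 1 ->
  is_derive s 1 (tangent c) (dunit_vec (derive1 c s) (derive1 (derive1 c) s)).
Proof.
by move=> s01; apply: is_derive_unit_vec; [exact: c'0 (itvoo_cc s01)|exact: is_derive_derive1].
Qed.

Lemma derive1_tangent (s : R) : 0 < s < 1 ->
  derive1 (tangent c) s = dunit_vec (derive1 c s) (derive1 (derive1 c) s).
Proof. by move=> s01; rewrite derive1E (@derive_val _ _ _ _ _ _ _ (is_derive_tangent s01)). Qed.

Lemma turning_continuous (s : R) : 0 < s < 1 -> {for s, continuous turning}.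
Proof.
move=> s01; rewrite /prop_for /continuous_at.
have h : (fun t => enorm (dunit_vec (derive1 c t) (derive1 (derive1 c) t))) t @[t --> s] -->
    turning s.
  rewrite /turning (derive1_tangent s01); apply: continuous_cvg; first exact: enorm_continuous.
  apply: dunit_vec_cvg; first exact: c'0 (itvoo_cc s01).
    exact: (@Ck1_continuous_derive1 R n c s cC).
  exact: continuous_derive2.
apply: cvg_trans h; apply: near_eq_cvg.
have /near_in_itvoo : s \in `]0, 1[ by rewrite in_itv.
apply: filterS => t; rewrite in_itv /= => t01.
by rewrite /turning (derive1_tangent t01).
Qed.

Lemma turning_curvature (s : R) : 0 < s < 1 ->
  enorm (curvature c s) * enorm (derive1 c s) = turning s.
Proof.
move=> s01; have v0 : enorm (derive1 c s) != 0 by rewrite enorm_eq0; exact: c'0 (itvoo_cc s01).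
rewrite /curvature enormZ ger0_norm ?invr_ge0 ?enorm_ge0// -/(tangent c) mulrC mulrA divff//.
by rewrite mul1r.
Qed.

Lemma view_cos_continuous (s : R) : 0 <= s <= 1 -> {for s, continuous (view_cos c p)}.
Proof.
move=> s01; apply: dotp_cvg; apply: unit_vec_cvg.
- exact: c'0.
- exact: (@Ck1_continuous_derive1 R n c s cC).
- exact: ray_neq0.
- exact: (is_derive_continuous (is_derive_ray p cC s)).
Qed.

Lemma view_rate_bounded : exists2 C, 0 <= C & forall s, 0 <= s <= 1 -> view_rate c p s <= C.
Proof.
have h : {within `[0, 1], continuous (view_rate c p)}.
  apply: continuous_in_subspaceT => s /[!inE] /=; rewrite in_itv /= => s01.
  apply: cvgM.
    apply: continuous_cvg; first exact: enorm_continuous.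
    exact: (@Ck1_continuous_derive1 R n c s cC).
  apply: cvgV; first by rewrite enorm_eq0; exact: ray_neq0.
  apply: continuous_cvg; first exact: enorm_continuous.
  exact: (is_derive_continuous (is_derive_ray p cC s)).
have [t _ ht] := EVT_max (@ler01 R) h.
exists (Num.max 0 (view_rate c p t)); first by rewrite le_max lexx.
by move=> s s01; rewrite le_max; apply/orP; right; apply: ht; rewrite in_itv.
Qed.

Lemma view_rate_ge0 s : 0 <= view_rate c p s.
Proof. by rewrite divr_ge0 ?enorm_ge0. Qed.

Section Field.
Variables (ep eta : R).
Hypotheses (ep0 : 0 < ep) (eta0 : 0 < eta) (etab : eta <= b / 2).

(** The velocity of the radial flow along the arc. *)
Definition ray_field (s : R) : 'rV[R]_n :=
  - isq ep eta (sqdist p (c s)) *: (c s - p).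

Lemma Ck_ray_field : @Ck_on R R^o 'rV[R]_n 1 setT ray_field.
Proof.
apply: (@Ck_scale R R^o).
  apply: (@CkN R R^o R^o); apply: (@Ck_comp1 R R^o); first exact: Ck_isq.
  exact: (@Ck_sqdist R n p R^o).
by apply: (@CkB R R^o); [exact: cC|exact: (@Ck_cst R R^o)].
Qed.

(** [smax s >= s - eta] bounds the quotient by [s / (s - eta)]. *)
Lemma isq_mul_le r2 : b <= r2 -> isq ep eta r2 * r2 <= 1 + 2 * eta / b.
Proof.
move=> br; have rb : 0 < r2 - eta by move: etab br b0; lra.
have s0 : 0 < smax ep eta r2 by exact: smax_gt0.
rewrite /isq mulrC ler_pdivrMr//.
apply: (@le_trans _ _ ((1 + 2 * eta / b) * (r2 - eta))); last first.
  apply: ler_wpM2l; last exact: smax_ge_id.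
  by rewrite addr_ge0// divr_ge0 ?(ltW b0)// mulr_ge0// ltW.
set k := eta / b; have k0 : 0 <= k by rewrite divr_ge0 ?(ltW b0) ?(ltW eta0).
have kb : k * b = eta by rewrite /k; field; rewrite gt_eqF.
have k2 : k <= 1 / 2 by rewrite /k ler_pdivrMr//; move: etab; lra.
have h1 : k * b <= k * r2 by apply: ler_wpM2l.
have h2 : k * eta <= 1 / 2 * eta by apply: ler_wpM2r => //; exact: ltW.
by rewrite -mulrA -/k mulrDl mul1r; move: h1 h2; rewrite kb; lra.
Qed.

(** The first term is the speed of the radial projection of the arc to the unit
    sphere about [p]. *)
Lemma strip_speed_le s : 0 <= s <= 1 -> strip_speed c ray_field s <=
  view_rate c p s * Num.sqrt (1 - view_cos c p s ^+ 2) + 2 * eta / b * view_rate c p s.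
Proof.
move=> s01; set W := view_rate c p s; set u := view_cos c p s.
have W0 : 0 <= W := view_rate_ge0 s.
have q0 := sqrtr_ge0 (1 - u ^+ 2); set q := Num.sqrt _ in q0 *.
have q1 : q <= 1.
  by rewrite -[leRHS]sqrtr1 ler_wsqrtr// gerBl sqr_ge0.
have r0 : enorm (c s - p) != 0 by rewrite enorm_eq0; exact: ray_neq0.
have v0 : enorm (derive1 c s) != 0 by rewrite enorm_eq0; exact: c'0.
have g0 : 0 <= isq ep eta (sqdist p (c s)) by exact: isq_ge0.
have -> : strip_speed c ray_field s = isq ep eta (sqdist p (c s)) * sqdist p (c s) * (W * q).
  have -> : isq ep eta (sqdist p (c s)) * sqdist p (c s) * (W * q) =
      Num.sqrt ((isq ep eta (sqdist p (c s)) * sqdist p (c s) * W) ^+ 2) * q.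
    have h : 0 <= isq ep eta (sqdist p (c s)) * sqdist p (c s) * W.
      apply: mulr_ge0 => //; apply: mulr_ge0 => //; exact: dotp_ge0.
    by rewrite sqrtr_sqr (ger0_norm h) mulrA.
  rewrite -sqrtrM ?sqr_ge0// /strip_speed; congr Num.sqrt.
  rewrite /ray_field; set g := isq ep eta _.
  rewrite /u /view_cos /W /view_rate /tangent /unit_vec /sqdist; clearbody g.
  move: (c s - p) (derive1 c s) r0 v0 => y w y0 w0.
  rewrite !(dotpZl, dotpZr) -!sqr_enorm; field; rewrite y0; exact: w0.
have hs := isq_mul_le (hb s01); apply: (@le_trans _ _ ((1 + 2 * eta / b) * (W * q))).
  by apply: ler_wpM2r => //; exact: mulr_ge0.
rewrite mulrDl mul1r lerD2l; apply: ler_wpM2l.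
  by rewrite divr_ge0 ?(ltW b0)// mulr_ge0// ltW.
by rewrite ler_piMr.
Qed.

End Field.

(** The integral starts at [a / 2], so that it is differentiable from both sides
    on the closed interval. *)
Lemma turning_primitive (I a d : R) : 0 < a -> a <= d -> d < 1 ->
  (\int[mu]_(t in `]0%R, 1%R[) (turning t)%:E <= I%:E)%E ->
  exists2 K : R -> R, (forall s, a <= s <= d -> is_derive s 1 K (turning s)) & K d - K a <= I.
Proof.
move=> a0 ad d1 hI; pose a' := a / 2; pose u := (d + 1) / 2.
have a'0 : 0 < a' by rewrite divr_gt0.
have a'a : a' < a by rewrite /a'; lra.
have du : d < u by rewrite /u; lra.
have u1 : u < 1 by rewrite /u; lra.
have cont x y : 0 < x -> y < 1 -> {within `[x, y], continuous turning}.
  move=> x0 y1; apply: continuous_in_subspaceT => s /[!inE] /=; rewrite in_itv /= => /andP[xs sy].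
  by apply: turning_continuous; rewrite (lt_le_trans x0)//= (le_lt_trans sy).
have int x y : 0 < x -> y < 1 -> mu.-integrable `[x, y] (EFin \o turning).
  by move=> x0 y1; apply: continuous_compact_integrable; [exact: segment_compact|exact: cont].
exists (fun y => \int[mu]_(t in `[a', y]) (turning t))%R => [s /andP[as_ sd]|].
  have su : s < u by exact: le_lt_trans du.
  have a's : a' < s by exact: lt_le_trans as_.
  have ts : {for s, continuous turning}.
    by apply: turning_continuous; rewrite (lt_trans a'0)//= (lt_trans su).
  have [h1 h2] := continuous_FTC1_closed su (int a' u a'0 u1) a's ts.
  by rewrite -h2 derive1E; apply: derivableP.
apply: (@le_trans _ _ (\int[mu]_(t in `[a', d]) (turning t))%R).
  by rewrite gerBl; apply: Rintegral_ge0 => t _; exact: enorm_ge0.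
rewrite -lee_fin /Rintegral fineK; last by apply: integrable_fin_num => //; exact: int.
apply: le_trans hI; apply: ge0_subset_integral => //.
- apply/measurable_realfun.measurable_EFinP.
  apply: measurable_realfun.subspace_continuous_measurable_fun; first exact: measurable_itv.
  apply: continuous_in_subspaceT => s /[!inE] /=; rewrite in_itv /= => s01.
  exact: turning_continuous.
- by move=> t _; rewrite lee_fin enorm_ge0.
- by move=> t /=; rewrite !in_itv /= => /andP[? ?]; apply/andP; split; lra.
Qed.

Lemma view_angle_continuous lam s : 1 < lam -> 0 <= s <= 1 ->
  {for s, continuous (view_angle c p lam)}.
Proof.
move=> l1 s01; have h := view_cos_div l1 (c'0 s01) (ray_neq0 s01).
apply: (@continuous_comp _ _ _ (fun t => view_cos c p t / lam) (@acos R)).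
  by apply: cvgM; [exact: view_cos_continuous|exact: cvg_cst].
exact: continuous_acos.
Qed.

Lemma view_cos_itv s : 0 <= s <= 1 -> -1 <= view_cos c p s <= 1.
Proof.
move=> s01; have := view_cos_sqr_le1 (c'0 s01) (ray_neq0 s01).
by move=> h; apply/andP; split; nra.
Qed.

Lemma view_cos_div_near lam m s : 1 < lam -> lam - 1 < m -> 0 <= s <= 1 ->
  `|view_cos c p s / lam - view_cos c p s| < m.
Proof.
move=> l1 lm /view_cos_itv; rewrite -ler_norml; set u := view_cos c p s => u1.
have l0 : 0 < lam by exact: lt_trans l1.
have -> : u / lam - u = - (u * ((lam - 1) / lam)) by field; rewrite gt_eqF.
rewrite normrN normrM (ger0_norm (x := (lam - 1) / lam)); last by rewrite divr_ge0 ?subr_ge0 ?ltW.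
apply: le_lt_trans lm; apply: (@le_trans _ _ (1 * ((lam - 1) / lam))).
  by apply: ler_wpM2r => //; rewrite divr_ge0 ?subr_ge0 ?ltW.
by rewrite mul1r ler_pdivrMr// ler_peMr ?subr_ge0// ltW.
Qed.

(** As [lam] tends to 1 the angles at the ends tend to their true values. *)
Lemma view_angle_ends C e : 0 <= C -> 0 < e -> exists lam, [/\ 1 < lam,
  C * Num.sqrt (lam ^+ 2 - 1) <= e,
  view_angle c p lam 0 <= acos (view_cos c p 0) + e &
  acos (view_cos c p 1) - e <= view_angle c p lam 1].
Proof.
move=> C0 e0; have I0 : 0 <= (0 : R) <= 1 by rewrite lexx ler01.
have I1 : 0 <= (1 : R) <= 1 by rewrite lexx ler01.
have [d0 d00 h0] := acos_le_near (view_cos_itv I0) e0.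
have [d1 d10 h1] := acos_ge_near (view_cos_itv I1) e0.
pose k := e / (C + 1); have k0 : 0 < k by rewrite divr_gt0// ltr_wpDl.
pose m := Num.min 1 (Num.min (d0 / 2) (Num.min (d1 / 2) (k ^+ 2 / 3))).
have m0 : 0 < m by rewrite !lt_min ltr01 !divr_gt0// exprn_gt0.
have [m1 md0 md1 mk] : [/\ m <= 1, m <= d0 / 2, m <= d1 / 2 & m <= k ^+ 2 / 3].
  by have : m <= m := lexx m; rewrite {2}/m !le_min => /and4P[].
clearbody m; have l1 : 1 < 1 + m by rewrite ltrDl.
have itv s : 0 <= s <= 1 -> -1 <= view_cos c p s / (1 + m) <= 1.
  by move=> s01; have /andP[? ?] := view_cos_div l1 (c'0 s01) (ray_neq0 s01); rewrite !ltW.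
exists (1 + m); split => //.
- apply: (@le_trans _ _ (C * k)).
    apply: ler_wpM2l => //; rewrite -(ger0_norm (ltW k0)) -sqrtr_sqr; apply: ler_wsqrtr.
    have : m ^+ 2 <= m by rewrite expr2 ler_piMr// ltW.
    by rewrite sqrrD; move: mk; rewrite mul1r expr1n mulr2n; lra.
  by rewrite /k mulrCA ler_piMr ?(ltW e0)// ler_pdivrMr ?mul1r ?lerDl// ltr_wpDl.
- apply: h0; first exact: itv.
  have : `|view_cos c p 0 / (1 + m) - view_cos c p 0| < d0.
    by apply: view_cos_div_near => //; lra.
  by rewrite ltr_norml => /andP[]; lra.
- apply: h1; first exact: itv.
  have : `|view_cos c p 1 / (1 + m) - view_cos c p 1| < d1.
    by apply: view_cos_div_near => //; lra.
  by rewrite ltr_norml => /andP[]; lra.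
Qed.

(** In the interior of the arc, the turning minus the angle with the ray has a
    derivative that dominates the sweep, by [turning_bound].  Near the ends,
    where the integral of the turning may be improper, the sweep is bounded by
    the length of the parameter interval. *)
Lemma area_arc_sweep_le (I ep e : R) : 0 < ep -> 0 < e ->
  (\int[mu]_(t in `]0%R, 1%R[) (turning t)%:E <= I%:E)%E ->
  exists2 d, 0 < d & forall eta, 0 < eta -> eta < d -> \forall t \near 0^'+,
    (area (strip c (ray_field ep eta) 0 1 t) <=
     (t * (I + acos (view_cos c p 0) - acos (view_cos c p 1) + e))%:E)%E.
Proof.
move=> ep0 e0 hI; have [C C0 hC] := view_rate_bounded.
(* The errors made below add up to at most [9 * e1]. *)
pose e1 := e / 10; have e10 : 0 < e1 by rewrite divr_gt0.
have [lam [l1 hlam hang0 hang1]] := view_angle_ends C0 e10.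
have I0 : 0 <= (0 : R) <= 1 by rewrite lexx ler01.
have I1 : 0 <= (1 : R) <= 1 by rewrite lexx ler01.
have [r0 r00 hr0] : exists2 r, 0 < r & forall s, `|s| < r ->
    view_angle c p lam s <= view_angle c p lam 0 + e1.
  have := view_angle_continuous l1 I0 => /cvgrPdist_lt/(_ _ e10)/nbhs_ballP[r /= r0 hr].
  exists r => // s sr; have := hr s; rewrite -ball_normE /= sub0r normrN => /(_ sr).
  by rewrite ltr_norml => /andP[]; lra.
have [r1 r10 hr1] : exists2 r, 0 < r & forall s, `|1 - s| < r ->
    view_angle c p lam 1 - e1 <= view_angle c p lam s.
  have := view_angle_continuous l1 I1 => /cvgrPdist_lt/(_ _ e10)/nbhs_ballP[r /= r0' hr].
  exists r => // s sr; have := hr s; rewrite -ball_normE /= => /(_ sr).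
  by rewrite ltr_norml => /andP[]; lra.
pose C2 := C + 2 * e1; have C20 : 0 < C2 by rewrite /C2; lra.
(* [w] is the length of the two end pieces. *)
pose w := Num.min (1 / 4) (Num.min (r0 / 2) (Num.min (r1 / 2) (e1 / C2))).
have w0 : 0 < w by rewrite !lt_min !divr_gt0.
have [w4 wr0 wr1 wC] : [/\ w <= 1 / 4, w <= r0 / 2, w <= r1 / 2 & w <= e1 / C2].
  by have : w <= w := lexx w; rewrite {2}/w !le_min => /and4P[].
move: wC; rewrite ler_pdivlMr// => wC; clearbody w.
have [w1 wle1 wc0 wc1] : [/\ w <= 1 - w, w <= 1, 0 <= 1 - w & 1 - w < 1].
  by split; lra.
have wc : 1 - w <= 1 := ltW wc1.
have [K dK hK] := turning_primitive w0 w1 wc1 hI.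
exists (Num.min (b / 2) (e1 * b / (2 * (C + 1)))).
  by rewrite lt_min !divr_gt0// ?mulr_gt0// ltr_wpDl.
move=> eta eta0; rewrite lt_min => /andP[/ltW etab].
rewrite ltr_pdivlMr; last by rewrite mulr_gt0// ltr_wpDl.
move=> etaC.
have speed s : 0 <= s <= 1 -> strip_speed c (ray_field ep eta) s <=
    view_rate c p s * Num.sqrt (1 - view_cos c p s ^+ 2) + e1.
  move=> s01; apply: le_trans (strip_speed_le ep0 eta0 etab s01) _; rewrite lerD2l.
  have h1 : 2 * eta / b * view_rate c p s <= 2 * eta / b * C.
    by apply: ler_wpM2l; [rewrite divr_ge0 ?(ltW b0)// mulr_ge0// ltW|exact: hC].
  apply: le_trans h1 _; rewrite mulrAC ler_pdivrMr//.
  by apply: le_trans (ltW etaC); nra.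
have YC := Ck_ray_field ep0 eta0.
(* The crude bound used on the end pieces. *)
have ends x y : 0 <= x -> x <= y -> y <= 1 -> \forall t \near 0^'+,
    (area (strip c (ray_field ep eta) x y t) <=
     (t * ((C + e1) * y - (C + e1) * x + e1 * (y - x)))%:E)%E.
  move=> x0 xy y1; apply: (@area_strip_le R n c (ray_field ep eta) cC YC x y e1
    (fun s => (C + e1) * s) (fun=> C + e1) xy e10) => s /andP[xs sy].
    have := is_deriveZ (C + e1) (is_derive_id s (1 : R)).
    by rewrite /GRing.scale /= mulr1.
  have s01 : 0 <= s <= 1 by rewrite (le_trans x0)//= (le_trans sy).
  apply: le_trans (speed s s01) _; rewrite lerD2r; apply: le_trans (hC s s01).
  rewrite ler_piMr ?view_rate_ge0// -[leRHS]sqrtr1 ler_wsqrtr// gerBl.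
  exact: sqr_ge0.
pose L := C * Num.sqrt (lam ^+ 2 - 1) + e1.
have middle : \forall t \near 0^'+,
    (area (strip c (ray_field ep eta) w (1 - w) t) <=
     (t * ((K (1 - w) - view_angle c p lam (1 - w) + L * (1 - w)) -
           (K w - view_angle c p lam w + L * w) + e1 * (1 - w - w)))%:E)%E.
  apply: (@area_strip_le R n c (ray_field ep eta) cC YC w (1 - w) e1
    (fun s => K s - view_angle c p lam s + L * s)
    (fun s => turning s + (dotp (derive1 (tangent c) s) (unit_vec (c s - p)) +
       view_rate c p s * (1 - view_cos c p s ^+ 2)) /
        Num.sqrt (lam ^+ 2 - view_cos c p s ^+ 2) + L) w1 e10) => s /andP[ws sw].
    have s01 : 0 < s < 1 by rewrite (lt_le_trans w0 ws) (le_lt_trans sw wc1).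
    have dT := is_derive_tangent s01; rewrite -(derive1_tangent s01) in dT.
    have hA := is_derive_view_angle cC l1 (c'0 (itvoo_cc s01)) (ray_neq0 (itvoo_cc s01)) dT.
    have hs : w <= s <= 1 - w by rewrite ws.
    have hL : is_derive s 1 (fun t => L * t) L.
      by have := is_deriveZ L (is_derive_id s (1 : R)); rewrite /GRing.scale /= mulr1.
    by have := is_deriveD (is_deriveB (dK s hs) hA) hL; rewrite opprK.
  have s01 : 0 < s < 1 by rewrite (lt_le_trans w0 ws) (le_lt_trans sw wc1).
  have s01c := itvoo_cc s01; apply: le_trans (speed s s01c) _.
  rewrite /L addrA lerD2r; apply: turning_bound => //.
  - by apply: view_cos_sqr_le1; [exact: c'0|exact: ray_neq0].
  - exact: enorm_ge0.
  - exact: view_rate_ge0.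
  - exact: hC.
  - rewrite /turning (derive1_tangent s01); apply: dotp_orth_ge.
    + by apply: dotp_dunit_vec; exact: c'0.
    + by apply: dotp_unit_vec; exact: c'0.
    + by apply: dotp_unit_vec; exact: ray_neq0.
have e0w := ends 0 w (lexx _) (ltW w0) wle1.
have ew1 := ends (1 - w) 1 wc0 wc (lexx _).
near=> t; have t0 : 0 < t by near: t; exact: nbhs_right_gt.
apply: (@le_trans _ _ (area (strip c (ray_field ep eta) 0 w t) +
    (area (strip c (ray_field ep eta) w (1 - w) t) +
     area (strip c (ray_field ep eta) (1 - w) 1 t)))%E).
  apply: le_trans (leeD (lexx _) (areaU _ _)); apply: le_trans (areaU _ _); apply: areaS.
  move=> _ [[s u] /= [/andP[s0 s1] hu] <-].
  have [sw|/ltW ws] := leP s w; first by left; exists (s, u) => //=; split => //; rewrite s0.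
  right; have [sw'|/ltW ws'] := leP s (1 - w); [left|right]; exists (s, u) => //=; split => //.
    by rewrite ws.
  by rewrite ws'.
have h1 : (area (strip c (ray_field ep eta) 0 w t) <=
    (t * ((C + e1) * w - (C + e1) * 0 + e1 * (w - 0)))%:E)%E by near: t.
have h2 : (area (strip c (ray_field ep eta) (1 - w) 1 t) <=
    (t * ((C + e1) * 1 - (C + e1) * (1 - w) + e1 * (1 - (1 - w))))%:E)%E by near: t.
have h3 : (area (strip c (ray_field ep eta) w (1 - w) t) <=
     (t * ((K (1 - w) - view_angle c p lam (1 - w) + L * (1 - w)) -
           (K w - view_angle c p lam w + L * w) + e1 * (1 - w - w)))%:E)%E by near: t.
apply: le_trans (leeD h1 (leeD h3 h2)) _; rewrite -!EFinD lee_fin -!mulrDr ler_pM2l//.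
have a0 := hr0 w; rewrite (gtr0_norm w0) in a0; have {}a0 := a0 (ltac:(lra) : w < r0).
have a1 := hr1 (1 - w); rewrite subKr (gtr0_norm w0) in a1; have {}a1 := a1 (ltac:(lra) : w < r1).
have hL : L * (1 - w - w) <= 2 * e1.
  have : L <= 2 * e1 by rewrite /L; lra.
  have L0 : 0 <= L by rewrite /L addr_ge0 ?(ltW e10)// mulr_ge0 ?sqrtr_ge0.
  by apply: le_trans; rewrite ler_piMr//; lra.
have he : e1 * (1 - w - w) <= e1 by rewrite ler_piMr ?(ltW e10)//; lra.
have eE : e = 10 * e1 by rewrite /e1; field.
move: wC hL he hK a0 a1 hang0 hang1; rewrite eE /C2.
by rewrite (mulrC w) !mulrDl !mulrBr !mulr1 !mulr0; lra.
Unshelve. all: by end_near. Qed.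

End ArcSweep.

(** * Vertices and density *)

Section Conclusion.
Variables (R : realType) (n : nat) (G : graph R n) (p : 'rV[R]_n).
Hypothesis pG : ~ graph_set G p.
Local Notation m := (narcs G).
Local Notation mu := (@lebesgue_measure R).

Lemma near_forall_ord (k : nat) (P : 'I_k -> R -> Prop) :
  (forall i, \forall x \near 0^'+, P i x) -> \forall x \near (0 : R)^'+, forall i, P i x.
Proof. by move=> h; apply: filter_forall. Qed.

(** The graph is compact. *)
Lemma graph_away : exists2 b, 0 < b & forall x, graph_set G x -> b <= sqdist p x.
Proof.
have h : \forall b \near (0 : R)^'+, forall i : 'I_m, forall t, 0 <= t <= 1 ->
    b <= sqdist p (edge i t).
  apply: near_forall_ord => i; have cC : @Ck_on R R^o 'rV[R]_n 1 setT (edge i) := (edge_C1 i).1.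
  have cont : {within `[0, 1], continuous (fun t => sqdist p (edge i t))}.
    apply: continuous_subspaceT => t; have h := is_derive_continuous (is_derive_ray p cC t).
    by apply: dotp_cvg; exact: h.
  have [t0 /[!in_itv]/= t01 ht] := EVT_min (@ler01 R) cont.
  have q0 : 0 < sqdist p (edge i t0).
    rewrite lt_def sqdist_ge0 andbT dotp_eq0 subr_eq0; apply/eqP => eq.
    by apply: pG; exists i => //; exists t0 => //=; rewrite in_itv.
  near=> b => t t01'; apply: (@le_trans _ _ (sqdist p (edge i t0))).
    by near: b; apply: nbhs_right_le.
  by apply: ht; rewrite in_itv.
have [b [b0 hb]] := filter_ex (filterI (nbhs_right_gt (0 : R)) h).
by exists b => // x [i _ [t /= t01 <-]]; apply: hb; rewrite in_itv in t01.
Unshelve. all: by end_near. Qed.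

Definition arc_bound (I : 'I_m -> R) (i : 'I_m) : R :=
  I i + acos (view_cos (edge i) p 0) - acos (view_cos (edge i) p 1).

Lemma area_graph_sweep_le (I : 'I_m -> R) (ep e : R) : 0 < ep -> 0 < e ->
  (forall i, \int[mu]_(t in `]0%R, 1%R[) (turning (edge i) t)%:E <= (I i)%:E)%E ->
  exists2 d, 0 < d & forall eta, 0 < eta -> eta < d -> \forall t \near 0^'+,
    (area ((fun z => radial_flow (isq ep eta) p z.1 z.2) @` (`[0%R, t] `*` graph_set G))
      <= (t * (\sum_(i < m) arc_bound I i + e))%:E)%E.
Proof.
move=> ep0 e0 hI; have [b b0 hb] := graph_away.
pose e' := e / m.+1%:R; have e'0 : 0 < e' by rewrite divr_gt0.
have h : \forall d \near (0 : R)^'+, forall i : 'I_m, \forall t \near 0^'+,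
    (area (strip (edge i) (ray_field (edge i) p ep d) 0 1 t) <=
     (t * (arc_bound I i + e'))%:E)%E.
  apply: near_forall_ord => i.
  have hbi (s : R) : 0 <= s <= 1 -> b <= sqdist p (edge i s).
    by move=> s01; apply: hb; exists i => //; exists s => //=; rewrite in_itv.
  have c0 (s : R) : 0 <= s <= 1 -> derive1 (edge i) s != 0.
    by move=> s01; apply: (edge_C1 i).2; rewrite /= in_itv.
  have [d d0 hd] := area_arc_sweep_le (edge_C1 i).1 (edge_C2 i) c0 b0 hbi ep0 e'0 (hI i).
  near=> eta; apply: hd; first by near: eta; exact: nbhs_right_gt.
  by near: eta; exact: nbhs_right_lt.
have [d /= d0 hd] := h.
exists d => // eta eta0 etad.
have {}hd : forall i : 'I_m, \forall t \near 0^'+,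
    (area (strip (edge i) (ray_field (edge i) p ep eta) 0 1 t) <=
     (t * (arc_bound I i + e'))%:E)%E.
  by apply: hd => //=; rewrite sub0r normrN gtr0_norm.
near=> t.
have t0 : 0 < t by near: t; exact: nbhs_right_gt.
have ht : forall i : 'I_m, (area (strip (edge i) (ray_field (edge i) p ep eta) 0 1 t) <=
     (t * (arc_bound I i + e'))%:E)%E by near: t; exact: near_forall_ord.
apply: (@le_trans _ _ (area (\bigcup_(i in [set: 'I_m])
    strip (edge i) (ray_field (edge i) p ep eta) 0 1 t))).
  apply: areaS => _ [[u x] [/= ut [i _ [s /= s01 <-]]] <-].
  exists i => //; exists (s, u) => /=; first by move: ut s01; rewrite !in_itv.
  by rewrite /radial_flow /ray_field scalerA mulrN scaleNr.
apply: le_trans (area_bigcup_ord _) _.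
apply: (@le_trans _ _ (\sum_(i < m) (t * (arc_bound I i + e'))%:E)%E).
  by apply: lee_sum => i _.
rewrite sumEFin lee_fin -mulr_sumr ler_pM2l// big_split /= lerD2l.
rewrite sumr_const card_ord -[_ *+ _]mulr_natr /e' -mulrA ler_piMr ?(ltW e0)//.
by rewrite mulrC ler_pdivrMr// mul1r ler_nat.
Unshelve. all: by end_near. Qed.

Lemma enorm_unit_vec (w : 'rV[R]_n) : w != 0 -> enorm (unit_vec w) = 1.
Proof. by move=> w0; rewrite /enorm dotp_unit_vec// sqrtr1. Qed.

Lemma enorm_end_tangent ib : enorm (@end_tangent R n G ib) = 1.
Proof.
rewrite /end_tangent enormZ normrX normrN normr1 expr1n mul1r enorm_unit_vec//.
by apply: (edge_C1 ib.1).2; rewrite /= in_itv /=; case: ib.2 => /=; rewrite ?lexx ?ler01.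
Qed.

(** The supremum is finite because [acos] is non-negative. *)
Lemma vertex_curvature_ge q (e : 'rV[R]_n) : enorm e = 1 ->
  \sum_(ib : 'I_m * bool | arc_end (@edge R n G) ib == q)
     (pi / 2 - acos (dotp (end_tangent ib) e)) <= vertex_curvature G q.
Proof.
move=> e1; apply: ub_le_sup; last by exists e.
exists (\sum_(ib : 'I_m * bool | arc_end (@edge R n G) ib == q) (pi / 2)) => _ [e' e'1 <-].
apply: ler_sum => ib _; rewrite gerBl acos_ge0// -ler_norml.
by apply: le_trans (dotp_le_enorm _ _) _; rewrite enorm_end_tangent e'1 mulr1.
Qed.

Lemma arc_end_away ib : arc_end (@edge R n G) ib - p != 0.
Proof.
rewrite subr_eq0; apply/eqP => eq; apply: pG; exists ib.1 => //; exists (ib.2 : nat)%:R => //=.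
by rewrite in_itv /=; case: ib.2 => /=; rewrite ?lexx ?ler01.
Qed.

(** The direction towards [p] is admissible in the total curvature of a vertex,
    and turns its terms into the angles at the ends of the arcs: at an initial
    end the tangent makes with it the angle [pi - psi], at a final end, where
    [end_tangent] is reversed, the angle [psi]. *)
Lemma angle_sum_le : \sum_(i < m) (acos (view_cos (edge i) p 0) - acos (view_cos (edge i) p 1))
  <= \sum_(q <- vertices G) vertex_curvature G q.
Proof.
pose F ib := pi / 2 - acos (dotp (@end_tangent R n G ib)
  (- unit_vec (arc_end (@edge R n G) ib - p))).
have e i : acos (view_cos (edge i) p 0) - acos (view_cos (edge i) p 1) = \sum_b F (i, b).
  have i0 : -1 <= view_cos (edge i) p 0 <= 1.
    rewrite -ler_norml; apply: le_trans (dotp_le_enorm _ _) _.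
    have -> : tangent (edge i) 0 = end_tangent (i, false) by rewrite /end_tangent expr0 scale1r.
    by rewrite enorm_end_tangent mul1r enorm_unit_vec//; exact: (arc_end_away (i, false)).
  rewrite big_bool /F /end_tangent /= expr0 expr1 scale1r scaleN1r dotpNl !dotpNr opprK.
  rewrite /arc_end /= -/(tangent _ _) -/(tangent _ _) -/(view_cos _ _ _) -/(view_cos _ _ _).
  by rewrite acosN//; lra.
rewrite (eq_bigr _ (fun i _ => e i)) pair_big /=.
rewrite (eq_bigr F) => [|[i b] _ //].
have -> : \sum_(ib : 'I_m * bool) F ib =
    \sum_(q <- vertices G) \sum_(ib : 'I_m * bool | arc_end (@edge R n G) ib == q) F ib.
  rewrite (exchange_big_dep xpredT) //=; apply: eq_bigr => ib _.
  rewrite (eq_bigl (pred1 (arc_end (@edge R n G) ib))) => [|q]; last by rewrite /= eq_sym.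
  have ibV : arc_end (@edge R n G) ib \in vertices G by rewrite mem_undup; apply: map_f; rewrite mem_enum.
  by rewrite -big_filter filter_pred1_uniq ?undup_uniq// big_seq1.
rewrite big_seq [leRHS]big_seq; apply: ler_sum => q.
rewrite mem_undup => /mapP[ib0 _ qE].
have e1 : enorm (- unit_vec (q - p)) = 1.
  by rewrite enormN enorm_unit_vec// qE arc_end_away.
apply: le_trans (vertex_curvature_ge q e1).
by rewrite le_eqVlt; apply/orP; left; apply/eqP; apply: eq_bigr => ib /eqP <-.
Qed.

Section Density.
Variable Sigma : set 'rV[R]_n.
Hypotheses (hS : surface_class G Sigma) (hst : strongly_stationary G Sigma).

Definition area_ratio (r : R) : R := ball_area Sigma p (r ^+ 2) / r ^+ 2.

Lemma density_ratioE r : 0 < r -> density_ratio Sigma p r = (area_ratio r / pi)%:E.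
Proof.
move=> r0; have r2 : 0 < r ^+ 2 by rewrite exprn_gt0.
rewrite /density_ratio -{1}(gtr0_norm r0) -sqrtr_sqr -sqballE// (ball_areaE hst) -EFinM.
congr EFin; rewrite /area_ratio; move: (pi) (pi_gt0 R) => q q0; field.
by rewrite !gt_eqF.
Qed.

Lemma density_ratio_cvg : cvg (density_ratio Sigma p e @[e --> 0^'+]).
Proof.
have [b b0 hb] := graph_away.
apply: nondecreasing_at_right_is_cvge; near=> x => r s.
have x0 : 0 < x by near: x; exact: nbhs_right_gt.
have xb : x <= Num.sqrt b by near: x; apply: nbhs_right_le; rewrite sqrtr_gt0.
rewrite !in_itv /= => /andP[r0 rx] /andP[s0 sx]; rewrite le_eqVlt => /orP[/eqP -> //|rs].
rewrite !density_ratioE// lee_fin; apply: ler_wpM2r; first by rewrite invr_ge0 pi_ge0.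
apply: (ball_area_monotone hS hst); first by rewrite exprn_gt0.
  by rewrite ltr_sqr ?nnegrE ?ltW.
move=> y Gy; apply: le_trans (hb y Gy).
rewrite -[leRHS](sqr_sqrtr (ltW b0)) ler_sqr ?nnegrE ?sqrtr_ge0 ?(ltW s0)//.
exact: le_trans (ltW sx) xb.
Unshelve. all: by end_near. Qed.

Lemma density_le S : (forall ep, 0 < ep -> 2 * (ball_area Sigma p ep / ep) <= S) ->
  ((2 * pi)%:E * density Sigma p <= S%:E)%E.
Proof.
move=> hSw; have p0 := pi_gt0 R.
have h : (density Sigma p <= (S / (2 * pi))%:E)%E.
  apply: lime_le; first exact: density_ratio_cvg.
  near=> r; have r0 : 0 < r by near: r; exact: nbhs_right_gt.
  rewrite density_ratioE// lee_fin ler_pdivlMr ?mulr_gt0//.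
  rewrite (_ : area_ratio r / pi * (2 * pi) = 2 * area_ratio r); first by apply: hSw; rewrite exprn_gt0.
  by move: (pi) p0 => q q0; field; rewrite gt_eqF.
apply: le_trans (lee_wpmul2l _ h) _; first by rewrite lee_fin mulr_ge0// ltW.
by rewrite -EFinM lee_fin mulrCA divff ?mulr1// gt_eqF// mulr_gt0.
Unshelve. all: by end_near. Qed.

Lemma density_le_total_curvature : ((2 * pi)%:E * density Sigma p <= total_curvature G)%E.
Proof.
pose J i := (\int[mu]_(t in `]0%R, 1%R[) (enorm (curvature (@edge R n G i) t) *
  enorm (derive1 (edge i) t))%:E)%E.
have J0 i : (0 <= J i)%E.
  by apply: integral_ge0 => t _; rewrite lee_fin mulr_ge0 ?enorm_ge0.
have JE i : J i = (\int[mu]_(t in `]0%R, 1%R[) (turning (edge i) t)%:E)%E.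
  apply: eq_integral => t; rewrite inE /= in_itv /= => t01; congr EFin.
  apply: turning_curvature => // s s01.
  by apply: (edge_C1 i).2; rewrite /= in_itv.
rewrite /total_curvature -/(J _).
have [->|Jfin] := eqVneq (\sum_(i < m) J i)%E +oo%E; first by rewrite addye// leey.
have Ji i : J i \is a fin_num.
  rewrite ge0_fin_numE// ltey; apply: contra_neq Jfin => Jy.
  by rewrite (bigD1 i)//= Jy addye// gt_eqF// (lt_le_trans (ltNyr 0))// sume_ge0.
have -> : (\sum_(i < m) J i = (\sum_(i < m) fine (J i))%:E)%E.
  by rewrite -sumEFin; apply: eq_bigr => i _; rewrite fineK.
rewrite -EFinD; apply: (@le_trans _ _ (\sum_(i < m) arc_bound (fun i => fine (J i)) i)%:E).
  apply: density_le => ep ep0; apply: (ball_area_le_sweep hS hst) => // e e0.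
  by apply: area_graph_sweep_le => // i; rewrite -JE fineK.
rewrite lee_fin /arc_bound.
under eq_bigr do rewrite -addrA.
by rewrite big_split /= lerD2l; exact: angle_sum_le.
Qed.

End Density.
End Conclusion.

Theorem corollary5 (R : realType) (n : nat) (G : graph R n)
    (Sigma : set 'rV[R]_n)
    (hSigma : surface_class G Sigma)
    (hstat : strongly_stationary G Sigma)
    (p : 'rV[R]_n) (hp : (Sigma `\` graph_set G) p) :
  cvg (density_ratio Sigma p e @[e --> 0^'+]) /\
  ((2 * pi)%:E * density Sigma p <= total_curvature G)%E.
Proof.
split; first exact: density_ratio_cvg hp.2 _ hSigma hstat.
exact: density_le_total_curvature hp.2 _ hSigma hstat.
Qed.
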